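(* Let $\mathcal D$ be the diagram of $\mathfrak g$-modules described in the context. At every vertex of $\mathcal D$ the homology (kernel of the outgoing arrow modulo the image of the incoming arrow) is zero, except at the vertices $M_A^{0,0}\cong M(0,0,0,0)$ and $M_C^{-1,-1}\cong M(1,1,3,0)$, where the homology is isomorphic to the one-dimensional trivial $\mathfrak g$-module.
   Context: Let $\Lambda(4)$ be the Grassmann superalgebra on odd generators $\xi_1,\dots,\xi_4$; for $I=i_1\cdots i_r$ write $\xi_I=\xi_{i_1}\cdots\xi_{i_r}$, $|I|=r$, $\xi_{ij}=\xi_i\xi_j$. Let $K(1,4)_+=\mathbb C[t]\otimes\Lambda(4)$ ($t$ even) with Lie superalgebra bracket $[f,g]=(2f-\sum_i\xi_i\partial_{\xi_i}f)\partial_tg-\partial_tf\,(2g-\sum_i\xi_i\partial_{\xi_i}g)+(-1)^{p(f)}\sum_i\partial_{\xi_i}f\,\partial_{\xi_i}g$. Let $\mathfrak g=K(1,4)_+\oplus\mathbb CC$ with bracket $[f,g]+\psi(f,g)C$, $C$ central, where $\psi$ is the skew-symmetric 2-cocycle whose only nonzero values on the basis $\{t^m\xi_I\}$ are (up to skew-symmetry) $\psi(1,\xi_1\xi_2\xi_3\xi_4)=-2$ and $\psi(\xi_i,\partial_{\xi_i}(\xi_1\xi_2\xi_3\xi_4))=-1$; $\mathfrak g$ is the annihilation superalgebra of the conformal superalgebra $K_4'$. Grade $\mathfrak g$ by $\deg t^m\xi_I=2m+|I|-2$, $\deg C=0$; so $\mathfrak g_{-2}=\mathbb C1$, $\mathfrak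 g_{-1}=\langle\xi_1,\dots,\xi_4\rangle$, $\mathfrak g_0=\langle C,t,\xi_{ij}\rangle$. Let $\eta_i$ be the image of $\xi_i$ in $U(\mathfrak g_{<0})$ and put $w_{11}=\eta_2+i\eta_1$, $w_{22}=\eta_2-i\eta_1$, $w_{12}=-\eta_4+i\eta_3$, $w_{21}=\eta_4+i\eta_3$. Let $h_x=-i\xi_{12}+i\xi_{34}$, $h_y=-i\xi_{12}-i\xi_{34}$, $e_x=\frac12(-\xi_{13}-\xi_{24}-i\xi_{14}+i\xi_{23})$, $f_x=\frac12(\xi_{13}+\xi_{24}-i\xi_{14}+i\xi_{23})$, $e_y=\frac12(-\xi_{13}+\xi_{24}+i\xi_{14}+i\xi_{23})$, $f_y=\frac12(\xi_{13}-\xi_{24}+i\xi_{14}+i\xi_{23})$; they span $\mathfrak g_0^{ss}\cong\mathfrak{sl}_2\oplus\mathfrak{sl}_2$, identified with $\langle x_1\partial_{x_2},x_2\partial_{x_1},x_1\partial_{x_1}-x_2\partial_{x_2}\rangle\oplus\langle y_1\partial_{y_2},y_2\partial_{y_1},y_1\partial_{y_1}-y_2\partial_{y_2}\rangle$ via $e_x\mapsto x_1\partial_{x_2}$, $f_x\mapsto x_2\partial_{x_1}$, $h_x\mapsto x_1\partial_{x_1}-x_2\partial_{x_2}$ and likewise for $y$. For $\mu=(m,n,\mu_t,\mu_C)$, $F(\mu)$ is the irreducible finite-dimensional $\mathfrak g_0$-module with a highest weight vector (killed by $e_x,e_y$) on which $h_x,h_y,t,C$ act by $m,n,\mu_t,\mu_C$,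 extended to $\mathfrak g_{\ge0}$ by letting $\mathfrak g_{>0}$ act trivially, and $M(\mu)=U(\mathfrak g)\otimes_{U(\mathfrak g_{\ge0})}F(\mu)\cong U(\mathfrak g_{<0})\otimes F(\mu)$. Let $V_A=\mathbb C[x_1,x_2,y_1,y_2]$, $V_B=\mathbb C[\partial_{x_1},\partial_{x_2},y_1,y_2]$, $V_C=\mathbb C[\partial_{x_1},\partial_{x_2},\partial_{y_1},\partial_{y_2}]$, $V_D=\mathbb C[x_1,x_2,\partial_{y_1},\partial_{y_2}]$ (polynomial algebras in the indicated commuting variables). $\mathfrak g_0^{ss}$ acts by derivations with $x_i\partial_{x_j}(x_k)=\delta_{jk}x_i$, $x_i\partial_{x_j}(\partial_{x_k})=-\delta_{ik}\partial_{x_j}$, $x_i\partial_{x_j}$ killing $y$- and $\partial_y$-variables, and symmetrically for $y_i\partial_{y_j}$. Let $E_x$ (resp. $E_y$) be the derivation $x_1\partial_{x_1}+x_2\partial_{x_2}$ (resp. $y_1\partial_{y_1}+y_2\partial_{y_2}$) with the same rule ($+1$ on $x_k$, $-1$ on $\partial_{x_k}$). $t$ acts on $V_X$ as $-\frac12(E_x+E_y)+i_X$ and $C$ as $\frac12(E_x-E_y)+j_X$, with $(i_X,j_X)=(0,0),(1,-1),(2,0),(1,1)$ for $X=A,B,C,D$. $V_X^{m,n}$ is the subspace where $E_x=m$, $E_y=n$; for $m,n\ge0$: $V_A^{m,n}\cong F(m,n,-\frac{m+n}2,\frac{m-n}2)$, $V_B^{-m,n}\cong F(m,n,1+\frac{m-n}2,-\frac{m+n}2-1)$,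 $V_C^{-m,-n}\cong F(m,n,\frac{m+n}2+2,\frac{n-m}2)$, $V_D^{m,-n}\cong F(m,n,1+\frac{n-m}2,\frac{m+n}2+1)$. Set $M_X^{m,n}=U(\mathfrak g)\otimes_{U(\mathfrak g_{\ge0})}V_X^{m,n}=U(\mathfrak g_{<0})\otimes V_X^{m,n}$ ($\mathfrak g_{>0}$ acting trivially on $V_X^{m,n}$). For $u\in U(\mathfrak g_{<0})$ and linear $\phi:V_X\to V_Y$ define $(u\otimes\phi)(u'\otimes v)=u'u\otimes\phi(v)$. On $V_X$, $\partial_{x_j}$ means differentiation in $x_j$ if $X\in\{A,D\}$ and multiplication by $\partial_{x_j}$ if $X\in\{B,C\}$; $\partial_{y_j}$ means differentiation in $y_j$ if $X\in\{A,B\}$ and multiplication by $\partial_{y_j}$ if $X\in\{C,D\}$. Define $\nabla=\sum_{a,b\in\{1,2\}}w_{ab}\otimes\partial_{x_a}\partial_{y_b}$, mapping $M_X^{m,n}\to M_X^{m-1,n-1}$. Define $\nabla_2:M_A^{m,0}\to M_D^{m-2,0}$ ($m\ge2$) and $\nabla_2:M_B^{-m,0}\to M_C^{-m-2,0}$ ($m\ge0$) by $\nabla_2(u\otimes p)=uw_{11}w_{12}\otimes\partial_{x_1}^2p+u(w_{11}w_{22}+w_{21}w_{12})\otimes\partial_{x_1}\partial_{x_2}p+uw_{21}w_{22}\otimes\partial_{x_2}^2p$, the resulting polynomial in $x_1,x_2$ (resp. $\partial_{x_1},\partial_{x_2}$) regarded as an element of $V_D^{m-2,0}=\mathbb C[x_1,x_2]_{m-2}$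 (resp. $V_C^{-m-2,0}$). Define $\widetilde\nabla_2:M_A^{0,n}\to M_B^{0,n-2}$ ($n\ge2$) and $\widetilde\nabla_2:M_D^{0,-n}\to M_C^{0,-n-2}$ ($n\ge0$) by $\widetilde\nabla_2(u\otimes p)=uw_{11}w_{21}\otimes\partial_{y_1}^2p+u(w_{12}w_{21}+w_{11}w_{22})\otimes\partial_{y_1}\partial_{y_2}p+uw_{12}w_{22}\otimes\partial_{y_2}^2p$, regarded analogously. Define $\nabla_3:M_A^{0,1}\to M_C^{-1,0}$ by $\nabla_3(u\otimes(ay_1+by_2))=a\,uw_{11}w_{21}w_{12}\otimes\partial_{x_1}+a\,uw_{11}w_{21}w_{22}\otimes\partial_{x_2}+b\,u(w_{12}w_{21}+w_{11}w_{22})w_{12}\otimes\partial_{x_1}+b\,u(w_{12}w_{21}+w_{11}w_{22})w_{22}\otimes\partial_{x_2}$ and $\widetilde\nabla_3:M_A^{1,0}\to M_C^{0,-1}$ by $\widetilde\nabla_3(u\otimes(ax_1+bx_2))=a\,uw_{11}w_{12}w_{21}\otimes\partial_{y_1}+a\,uw_{11}w_{12}w_{22}\otimes\partial_{y_2}+b\,u(w_{21}w_{12}+w_{11}w_{22})w_{21}\otimes\partial_{y_1}+b\,u(w_{21}w_{12}+w_{11}w_{22})w_{22}\otimes\partial_{y_2}$ ($a,b\in\mathbb C$, $u\in U(\mathfrak g_{<0})$). The diagram $\mathcal D$ has vertices $M_A^{m,n},M_B^{-m,n},M_C^{-m,-n},M_D^{m,-n}$ ($m,n\ge0$) and arrows: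 $\nabla:M_A^{m,n}\to M_A^{m-1,n-1}$ ($m,n\ge1$); $\nabla:M_B^{-m,n}\to M_B^{-m-1,n-1}$ ($m\ge0,n\ge1$); $\nabla:M_C^{-m,-n}\to M_C^{-m-1,-n-1}$ ($m,n\ge0$); $\nabla:M_D^{m,-n}\to M_D^{m-1,-n-1}$ ($m\ge1,n\ge0$); the maps $\nabla_2,\widetilde\nabla_2$ on the ranges above; $\nabla_3$; $\widetilde\nabla_3$. These are $\mathfrak g$-module homomorphisms and composites of consecutive arrows are zero. Every vertex except $M_A^{0,0}$ has exactly one outgoing arrow and every vertex except $M_C^{0,0}$ has exactly one incoming arrow; missing arrows are taken to be zero maps when computing homology. *)

(* Defs.v *)
From HB Require Import structures.
From mathcomp Require Import all_boot all_order all_algebra.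

From mathcomp Require Import finmap monalg.

Set Implicit Arguments.
Unset Strict Implicit.
Unset Printing Implicit Defensive.

Import Order.TTheory GRing.Theory Num.Theory.
Local Open Scope ring_scope.

(* Indices: the odd generators xi_1..xi_4 (resp. eta_1..eta_4) are indexed  *)
(* by 'I_4 = {0,1,2,3}, i.e. xi_(k+1) <-> k.  A Grassmann monomial xi_I is   *)
(* indexed by I0 : {set 'I_4} and means the product in increasing order.      *)

Definition cnt_lt (J : {set 'I_4}) (i : 'I_4) : nat := #|[set j in J | (j < i)%N]|.
Definition cnt_gt (J : {set 'I_4}) (i : 'I_4) : nat := #|[set j in J | (i < j)%N]|.
(* xi_I0 * xi_J = (-1)^(mulsgn I0 J) xi_(I0 u J)  when I0, J are disjoint *)
Definition mulsgn (I0 J : {set 'I_4}) : nat :=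
  \sum_(i in I0) #|[set j in J | (j < i)%N]|.

(* Basis of g = K(1,4)_+ (+) C C : GT m I0 = t^m xi_I0,  GC = C. *)
Inductive gb := GC | GT of nat & {set 'I_4}.

Definition gpar (a : gb) : bool := if a is GT _ I0 then odd #|I0| else false.

(* Basis of U(g_<0) generators: NTh = image Theta of 1 (even), NEta k = eta_(k+1). *)
Inductive nb := NTh | NEta of 'I_4.
Definition npar (y : nb) : bool := if y is NEta _ then true else false.
Definition n2g (y : nb) : gb :=
  if y is NEta k then GT 0 [set k] else GT 0 set0.

(* Monomials of V_X: exponents (a1,a2,b1,b2) of the four commuting variables *)
(* (z1,z2,w1,w2), where z_j = x_j for X in {A,D} and z_j = d_{x_j} for X in   *)
(* {B,C}; w_j = y_j for X in {A,B} and w_j = d_{y_j} for X in {C,D}.          *)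
Definition mon := (nat * nat * nat * nat)%type.

(* Basis of U(g_<0) (x) V_X : (k, J, e) = Theta^k eta_J (x) (monomial e)    *)
(* (PBW normal form, eta_J the increasing product).                          *)
Definition MB := (nat * {set 'I_4} * mon)%type.

Inductive VX := VA | VB | VC | VD.

Definition VX_eqb (X Y : VX) : bool :=
  match X, Y with VA, VA | VB, VB | VC, VC | VD, VD => true | _, _ => false end.
Lemma VX_eqP : Equality.axiom VX_eqb.
Proof. by case; case; constructor. Qed.
HB.instance Definition _ := hasDecEq.Build VX VX_eqP.

(* sx X = true iff the x-variables of V_X are d_{x_1}, d_{x_2}; likewise sy *)
Definition sx (X : VX) : bool := match X with VB | VC => true | _ => false end.
Definition sy (X : VX) : bool := match X with VC | VD => true | _ => false end.

Section Construction.
Variable K : numClosedFieldType.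

Definition sgn (n : nat) : K := (-1) ^+ n.

(* the cocycle psi (super-skew-symmetric): psi(1, xi_1234) = -2,            *)
(* psi(xi_k, d_{xi_k} xi_1234) = -1, where d_{xi_k} xi_1234                   *)
(* = (-1)^(cnt_lt setT k) xi_(complement of k).                               *)
Definition psi (a b : gb) : K :=
  match a, b with
  | GT 0 I0, GT 0 J =>
      (if (I0 == set0) && (J == setT) then -2 else 0)
    + (if (I0 == setT) && (J == set0) then 2 else 0)
    + \sum_(k : 'I_4)
        (((I0 == [set k]) && (J == ~: [set k])) || ((J == [set k]) && (I0 == ~: [set k])))%:R
        * (- sgn (cnt_lt setT k))
  | _, _ => 0
  end.

(* bracket of basis elements, as a list of (coefficient, basis element):   *)
(* [f,g] = (2f - E f) d_t g - d_t f (2g - E g) + (-1)^p(f) sum_k d_k f d_k g *)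
(*         + psi(f,g) C                                                      *)
Definition gbr (a b : gb) : seq (K * gb) :=
  match a, b with
  | GT m I0, GT n J =>
      (if [disjoint I0 & J] && (0 < m + n)%N then
         [:: (((2%:R - (#|I0|)%:R) * n%:R - m%:R * (2%:R - (#|J|)%:R)) * sgn (mulsgn I0 J),
              GT (m + n).-1 (I0 :|: J))]
       else [::])
   ++ [seq (sgn #|I0| * sgn (cnt_lt I0 k) * sgn (cnt_lt J k) * sgn (mulsgn (I0 :\ k) (J :\ k)),
            GT (m + n) ((I0 :\ k) :|: (J :\ k)))
       | k <- enum 'I_4 & [&& k \in I0, k \in J & [disjoint I0 :\ k & J :\ k]]]
   ++ [:: (psi a b, GC)]
  | _, _ => [::]
  end.

Definition vec := {malg K[MB]}.
Definition bv (b : MB) : vec := << b >>.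
Definition lext (f : MB -> vec) (x : vec) : vec := \sum_(b <- msupp x) x@_b *: f b.

(* left / right multiplication in U(g_<0) (Theta central, eta_i eta_j =     *)
(* - eta_j eta_i for i <> j, eta_i^2 = -Theta/2 since [xi_i, xi_i] = -1)      *)
Definition lmulb (y : nb) (b : MB) : vec :=
  let: (k, J, e) := b in
  match y with
  | NTh => bv (k.+1, J, e)
  | NEta i => if i \notin J then sgn (cnt_lt J i) *: bv (k, i |: J, e)
              else (sgn (cnt_lt J i) * (- 2%:R^-1)) *: bv (k.+1, J :\ i, e)
  end.
Definition rmulb (y : nb) (b : MB) : vec :=
  let: (k, J, e) := b in
  match y with
  | NTh => bv (k.+1, J, e)
  | NEta i => if i \notin J then sgn (cnt_gt J i) *: bv (k, i |: J, e)
              else (sgn (cnt_gt J i) * (- 2%:R^-1)) *: bv (k.+1, J :\ i, e)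
  end.
Definition lmul (y : nb) : vec -> vec := lext (lmulb y).
Definition rmul (y : nb) : vec -> vec := lext (rmulb y).

Definition mvec (c : K) (e : mon) : vec := c *: bv (0%N, set0, e).

(* e_x = x1 d_{x2}, f_x = x2 d_{x1}, h_x = x1 d_{x1} - x2 d_{x2} acting by   *)
(* derivations with the rules of the paper, written in the variables z.      *)
Definition ex_op (s : bool) (e : mon) : vec :=
  let: (a1, a2, b1, b2) := e in
  if ~~ s then mvec a2%:R (a1.+1, a2.-1, b1, b2)
  else mvec (- a1%:R) (a1.-1, a2.+1, b1, b2).
Definition fx_op (s : bool) (e : mon) : vec :=
  let: (a1, a2, b1, b2) := e in
  if ~~ s then mvec a1%:R (a1.-1, a2.+1, b1, b2)
  else mvec (- a2%:R) (a1.+1, a2.-1, b1, b2).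
Definition hx_op (s : bool) (e : mon) : vec :=
  let: (a1, a2, b1, b2) := e in
  if ~~ s then mvec (a1%:R - a2%:R) e else mvec (a2%:R - a1%:R) e.
Definition ey_op (s : bool) (e : mon) : vec :=
  let: (a1, a2, b1, b2) := e in
  if ~~ s then mvec b2%:R (a1, a2, b1.+1, b2.-1)
  else mvec (- b1%:R) (a1, a2, b1.-1, b2.+1).
Definition fy_op (s : bool) (e : mon) : vec :=
  let: (a1, a2, b1, b2) := e in
  if ~~ s then mvec b1%:R (a1, a2, b1.-1, b2.+1)
  else mvec (- b2%:R) (a1, a2, b1.+1, b2.-1).
Definition hy_op (s : bool) (e : mon) : vec :=
  let: (a1, a2, b1, b2) := e in
  if ~~ s then mvec (b1%:R - b2%:R) e else mvec (b2%:R - b1%:R) e.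

Definition Ex (X : VX) (e : mon) : K :=
  let: (a1, a2, _, _) := e in if sx X then - (a1 + a2)%:R else (a1 + a2)%:R.
Definition Ey (X : VX) (e : mon) : K :=
  let: (_, _, b1, b2) := e in if sy X then - (b1 + b2)%:R else (b1 + b2)%:R.

Definition iX (X : VX) : K := match X with VA => 0 | VB => 1 | VC => 2%:R | VD => 1 end.
Definition jX (X : VX) : K := match X with VA => 0 | VB => -1 | VC => 0 | VD => 1 end.

Definition i2 : K := 'i / 2%:R.
Definition h2 : K := 2%:R^-1.

(* action of the degree-0 basis elements C, t, xi_ij on V_X; the xi_ij are  *)
(* expressed through h_x,h_y,e_x,f_x,e_y,f_y by inverting the definitions:  *)
(* xi_12 = i/2 (h_x+h_y), xi_34 = -i/2 (h_x-h_y),                            *)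
(* xi_13 = -1/2 (e_x-f_x+e_y-f_y), xi_24 = 1/2 (e_y-f_y-e_x+f_x),            *)
(* xi_14 = -i/2 (e_y+f_y-e_x-f_x), xi_23 = -i/2 (e_x+f_x+e_y+f_y).           *)
Definition rho (X : VX) (a : gb) (e : mon) : vec :=
  let s := sx X in let s' := sy X in
  match a with
  | GC => mvec ((Ex X e - Ey X e) * h2 + jX X) e
  | GT 1 _ => mvec (- (Ex X e + Ey X e) * h2 + iX X) e
  | GT _ I0 =>
    let o0 : 'I_4 := inord 0 in let o1 : 'I_4 := inord 1 in
    let o2 : 'I_4 := inord 2 in let o3 : 'I_4 := inord 3 in
    if I0 == [set o0; o1] then i2 *: (hx_op s e + hy_op s' e)
    else if I0 == [set o2; o3] then (- i2) *: (hx_op s e - hy_op s' e)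
    else if I0 == [set o0; o2] then (- h2) *: (ex_op s e - fx_op s e + ey_op s' e - fy_op s' e)
    else if I0 == [set o1; o3] then h2 *: (ey_op s' e - fy_op s' e - ex_op s e + fx_op s e)
    else if I0 == [set o0; o3] then (- i2) *: (ey_op s' e + fy_op s' e - ex_op s e - fx_op s e)
    else if I0 == [set o1; o2] then (- i2) *: (ex_op s e + fx_op s e + ey_op s' e + fy_op s' e)
    else 0
  end.

(* ---------------- the g-action on M_X = U(g) (x)_{U(g_>=0)} V_X ----------- *)

(* action of a basis element a on 1 (x) e: g_<0 by left multiplication,     *)
(* g_0 through rho, g_>0 trivially *)
Definition act0 (X : VX) (a : gb) (e : mon) : vec :=
  match a with
  | GC => rho X a e
  | GT m I0 =>
      if (2 * m + #|I0| < 2)%N then bv ((I0 == set0 : nat), I0, e)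
      else if (2 * m + #|I0| == 2)%N then rho X a e
      else 0
  end.

(* a . (y w (x) e) = (-1)^(p(a)p(y)) y . (a . (w (x) e)) + [a,y] . (w (x) e) *)
Fixpoint actw (X : VX) (w : seq nb) (a : gb) (e : mon) {struct w} : vec :=
  match w with
  | [::] => act0 X a e
  | y :: w' =>
      sgn (gpar a && npar y) *: lmul y (actw X w' a e)
      + \sum_(cb <- gbr a (n2g y)) cb.1 *: actw X w' cb.2 e
  end.

Definition word (k : nat) (J : {set 'I_4}) : seq nb :=
  nseq k NTh ++ [seq NEta j | j <- enum J].

Definition actb (X : VX) (a : gb) (b : MB) : vec :=
  let: (k, J, e) := b in actw X (word k J) a e.

Definition act (X : VX) (a : gb) : vec -> vec := lext (actb X a).

(* the operator "d_{x_j}" (j = 0,1 for x_1,x_2) on V_X, applied to the V_X   *)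
(* factor: differentiation in z_j if X in {A,D}, multiplication by z_j if   *)
(* X in {B,C}; similarly "d_{y_j}" *)
Definition dXb (X : VX) (j : bool) (b : MB) : vec :=
  let: (k, J, (a1, a2, b1, b2)) := b in
  if sx X then (if j then bv (k, J, (a1, a2.+1, b1, b2)) else bv (k, J, (a1.+1, a2, b1, b2)))
  else (if j then a2%:R *: bv (k, J, (a1, a2.-1, b1, b2))
        else a1%:R *: bv (k, J, (a1.-1, a2, b1, b2))).
Definition dYb (X : VX) (j : bool) (b : MB) : vec :=
  let: (k, J, (a1, a2, b1, b2)) := b in
  if sy X then (if j then bv (k, J, (a1, a2, b1, b2.+1)) else bv (k, J, (a1, a2, b1.+1, b2)))
  else (if j then b2%:R *: bv (k, J, (a1, a2, b1, b2.-1))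
        else b1%:R *: bv (k, J, (a1, a2, b1.-1, b2))).
Definition dX (X : VX) (j : bool) : vec -> vec := lext (dXb X j).
Definition dY (X : VX) (j : bool) : vec -> vec := lext (dYb X j).

(* w_ab (a,b = false for 1, true for 2) as combinations of the eta's:        *)
(* w11 = eta2 + i eta1, w22 = eta2 - i eta1, w12 = -eta4 + i eta3,            *)
(* w21 = eta4 + i eta3 *)
Definition w (a b : bool) : seq (K * 'I_4) :=
  match a, b with
  | false, false => [:: (1, inord 1); ('i, inord 0)]
  | true, true => [:: (1, inord 1); (- 'i, inord 0)]
  | false, true => [:: (-1, inord 3); ('i, inord 2)]
  | true, false => [:: (1, inord 3); ('i, inord 2)]
  end.
Definition rmulw (c : seq (K * 'I_4)) (x : vec) : vec :=
  \sum_(p <- c) p.1 *: rmul (NEta p.2) x.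
Definition rw (ws : seq (bool * bool)) (x : vec) : vec :=
  foldl (fun y ab => rmulw (w ab.1 ab.2) y) x ws.

Definition nabla (X : VX) (x : vec) : vec :=
  \sum_(a <- [:: false; true]) \sum_(b <- [:: false; true])
    rw [:: (a, b)] (dX X a (dY X b x)).

Definition nabla2 (X : VX) (x : vec) : vec :=
  rw [:: (false, false); (false, true)] (dX X false (dX X false x))
  + (rw [:: (false, false); (true, true)] (dX X false (dX X true x))
     + rw [:: (true, false); (false, true)] (dX X false (dX X true x)))
  + rw [:: (true, false); (true, true)] (dX X true (dX X true x)).

Definition nabla2t (X : VX) (x : vec) : vec :=
  rw [:: (false, false); (true, false)] (dY X false (dY X false x))
  + (rw [:: (false, true); (true, false)] (dY X false (dY X true x))
     + rw [:: (false, false); (true, true)] (dY X false (dY X true x)))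
  + rw [:: (false, true); (true, true)] (dY X true (dY X true x)).

(* nabla_3 : M_A^{0,1} -> M_C^{-1,0}; dY VA j extracts the coefficient of   *)
(* y_j, and dX VC j multiplies by d_{x_j} *)
Definition nabla3 (x : vec) : vec :=
  let a := dY VA false x in let b := dY VA true x in
  rw [:: (false, false); (true, false); (false, true)] (dX VC false a)
  + rw [:: (false, false); (true, false); (true, true)] (dX VC true a)
  + (rw [:: (false, true); (true, false); (false, true)] (dX VC false b)
     + rw [:: (false, false); (true, true); (false, true)] (dX VC false b))
  + (rw [:: (false, true); (true, false); (true, true)] (dX VC true b)
     + rw [:: (false, false); (true, true); (true, true)] (dX VC true b)).

Definition nabla3t (x : vec) : vec :=
  let a := dX VA false x in let b := dX VA true x in
  rw [:: (false, false); (false, true); (true, false)] (dY VC false a)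
  + rw [:: (false, false); (false, true); (true, true)] (dY VC true a)
  + (rw [:: (true, false); (false, true); (true, false)] (dY VC false b)
     + rw [:: (false, false); (true, true); (true, false)] (dY VC false b))
  + (rw [:: (true, false); (false, true); (true, true)] (dY VC true b)
     + rw [:: (false, false); (true, true); (true, true)] (dY VC true b)).

(* vertex (X, m, n) with m, n >= 0 stands for M_A^{m,n}, M_B^{-m,n},        *)
(* M_C^{-m,-n}, M_D^{m,-n} according to X *)
Definition vtx := (VX * nat * nat)%type.

Definition inM (v : vtx) (x : vec) : Prop :=
  forall b : MB, x@_b != 0 ->
    let: (_, _, (a1, a2, b1, b2)) := b in (a1 + a2 = v.1.2)%N /\ (b1 + b2 = v.2)%N.

Definition outmap (v : vtx) : vec -> vec :=
  let: (X, m, n) := v in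
  match X with
  | VA => if (0 < m)%N && (0 < n)%N then nabla VA
          else if (2 <= m)%N && (n == 0)%N then nabla2 VA
          else if (m == 0)%N && (2 <= n)%N then nabla2t VA
          else if (m == 0)%N && (n == 1)%N then nabla3
          else if (m == 1)%N && (n == 0)%N then nabla3t
          else (fun _ => 0)
  | VB => if (0 < n)%N then nabla VB else nabla2 VB
  | VC => nabla VC
  | VD => if (0 < m)%N then nabla VD else nabla2t VD
  end.

Definition target (v : vtx) : option vtx :=
  let: (X, m, n) := v in
  match X with
  | VA => if (0 < m)%N && (0 < n)%N then Some (VA, m.-1, n.-1)
          else if (2 <= m)%N && (n == 0)%N then Some (VD, m - 2, 0)%N
          else if (m == 0)%N && (2 <= n)%N then Some (VB, 0, n - 2)%N
          else if (m == 0)%N && (n == 1)%N then Some (VC, 1, 0)%N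
          else if (m == 1)%N && (n == 0)%N then Some (VC, 0, 1)%N
          else None
  | VB => if (0 < n)%N then Some (VB, m.+1, n.-1) else Some (VC, m + 2, 0)%N
  | VC => Some (VC, m.+1, n.+1)
  | VD => if (0 < m)%N then Some (VD, m.-1, n.+1) else Some (VC, 0, n + 2)%N
  end.

Definition Ker (v : vtx) (x : vec) : Prop := inM v x /\ outmap v x = 0.
(* image of the incoming arrow at v (zero if there is none) *)
Definition Img (v : vtx) (y : vec) : Prop :=
  y = 0 \/ exists (v' : vtx) (x : vec), [/\ target v' = Some v, inM v' x & y = outmap v' x].

Definition homology_zero (v : vtx) : Prop := forall x, Ker v x -> Img v x.

(* homology Ker/Img at v is isomorphic to the one-dimensional trivial        *)
(* g-module: it is spanned by the class of a single x0 which is nonzero, and  *)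
(* every (basis element of) g maps Ker v into Img v *)
Definition homology_trivial1 (v : vtx) : Prop :=
  (exists x0, [/\ Ker v x0, ~ Img v x0 & forall x, Ker v x -> exists c : K, Img v (x - c *: x0)])
  /\ (forall (a : gb) (x : vec), Ker v x -> Img v (act v.1.1 a x)).

End Construction.

(* Main.v *)
Require Import Defs.
From HB Require Import structures.
From mathcomp Require Import all_boot all_order all_algebra.
From mathcomp Require Import finmap monalg ring ssrZ.
From Stdlib Require BinInt.

(* Right multiplication by the w_ab satisfies the Clifford relations over C[Theta] whose
   only nonzero anticommutators are {w_11, w_22} = -2 Theta and {w_21, w_12} = 2 Theta.
   Hence D_b = w_1b d_(x_1) + w_2b d_(x_2) satisfies D_1^2 = D_2^2 = {D_1, D_2} = 0, and
   nabla = D_1 d_(y_1) + D_2 d_(y_2), nabla_2 = D_2 D_1.  Contraction is a homotopy showing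
   that each D_b is exact in positive x-degree.  The weight grading (w_a1 of weight 1, w_a2
   of weight -1, weights between -2 and 2) makes zigzags between D_1 and D_2 terminate, so
   ker D_1 D_2 = im D_1 + im D_2 and ker D_1 /\ ker D_2 = im D_2 D_1.  Comparing
   coefficients of the monomials in y then gives exactness at almost all vertices with
   x-degree at least 1 or 2; the few remaining ones are done by hand with the Clifford
   relations, and the exchange of x and y (with eta_4 -> - eta_4) gives the others.
   At M_A^(0,0) the image is the augmentation ideal of U(g_<0).  At M_C^(-1,-1) the kernel
   is the image plus the line through one explicit vector x_0, again by means of the
   augmentation.  There the action commutes with Theta up to terms of the same shape, so
   its triviality only has to be tested on the vectors nabla(eta_J) and x_0, on which
   t^m xi_I acts by zero for m >= 6; the cases m <= 5 are a finite computation. *)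

Set Implicit Arguments.
Unset Strict Implicit.
Unset Printing Implicit Defensive.
Import Order.TTheory GRing.Theory Num.Theory.
Local Open Scope ring_scope.

(** * Operators and eigenvectors *)

(** On x-degree m the homotopy for D_b is diagonal, with eigenvalue m + r if d_x differentiates and
    m + 2 - r if it multiplies, where r in {0, 1, 2} counts the factors w_1b and w_2b. It
    degenerates only at m = 0, and this is why the vertices of low degree need arguments of their
    own and why homology can survive at all. The Clifford relations do not disturb the homotopy:
    right multiplication by w_ab is exterior multiplication plus Theta times a contraction, and
    contractions anticommute with each other. The vector x_0 has the single component D_1 (w_12 w_21
    + w_11 w_22) at d_(y_1). Up to sign this is also D_2 (w_11 w_21), so D_1 and D_2 both kill it;
    it is not in the image because w_12 w_21 + w_11 w_22 lies outside the left ideal generated by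
    w_11 w_21 and w_12 w_22. The operators are first studied as linear maps on an arbitrary space
    with separating coefficient functionals. Identities between vectors then become identities
    between scalars, and the finitely supported functions appear only once the formal consequences
    of the relations are available. *)

Section Modules.
Variables (K : numClosedFieldType) (V : lmodType K) (I : Type) (co : I -> V -> K).
Hypothesis co_lin : forall d k x y, co d (k *: x + y) = k * co d x + co d y.

Lemma coD d x y : co d (x + y) = co d x + co d y.
Proof. by have := co_lin d 1 x y; rewrite scale1r mul1r. Qed.
Lemma co0 d : co d 0 = 0.
Proof. by apply: (addrI (co d 0)); rewrite -coD !addr0. Qed.
Lemma coZ d k x : co d (k *: x) = k * co d x.
Proof. by have := co_lin d k x 0; rewrite co0 !addr0. Qed.
Lemma coN d x : co d (- x) = - co d x.
Proof. by rewrite -scaleN1r coZ mulN1r. Qed.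

Section LinearRules.
Variable f : {linear V -> V}.
Lemma opD x y : f (x + y) = f x + f y. Proof. exact: linearD. Qed.
Lemma opB x y : f (x - y) = f x - f y. Proof. exact: linearB. Qed.
Lemma opN x : f (- x) = - f x. Proof. exact: linearN. Qed.
Lemma opZ k x : f (k *: x) = k *: f x. Proof. exact: linearZ. Qed.
Lemma op0 : f 0 = 0. Proof. exact: linear0. Qed.
Definition lin_opE := (opD, opN, opZ, op0).
End LinearRules.

End Modules.

(** A vector identity is tested on coefficients, and the coefficients of the remaining atoms are
    generalized; what is left is an identity in the field for [ring] or [field]. *)
Ltac coefs_with lin sep := let d := fresh "d" in
  apply: sep => d; rewrite !(coD lin, coZ lin, coN lin, co0 lin);
  repeat match goal with |- context [?co d ?t] =>
    generalize (co d t); intro end.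

Section Eigen.
Variables (K : numClosedFieldType) (V : lmodType K) (I : Type) (co : I -> V -> K).
Hypothesis co_lin : forall d k x y, co d (k *: x + y) = k * co d x + co d y.
Hypothesis co_sep : forall x y, (forall d, co d x = co d y) -> x = y.
Local Ltac coefs := coefs_with co_lin co_sep.

(** The product of the factors [L - r] over [rs] kills [x]. When [rs] has no repetitions, this says
    that [x] is a sum of eigenvectors, without mentioning eigenspaces. *)
Definition annihilated (L : {linear V -> V}) (rs : seq K) (x : V) : Prop :=
  foldr (fun r y => L y - r *: y) x rs = 0.

Lemma annihilated_eigenE (L : {linear V -> V}) rs r x : L x = r *: x ->
  foldr (fun r y => L y - r *: y) x rs = (\prod_(s <- rs) (r - s)) *: x.
Proof.
move=> Lx; elim: rs => [|s rs /= ->]; first by rewrite big_nil scale1r.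
by rewrite (opZ L) Lx big_cons; coefs; ring.
Qed.

Lemma annihilated_eigen (L : {linear V -> V}) rs r x :
  L x = r *: x -> r \in rs -> annihilated L rs x.
Proof.
move=> Lx rrs; rewrite /annihilated (annihilated_eigenE rs Lx).
by rewrite (perm_big _ (perm_to_rem rrs)) big_cons /= subrr mul0r scale0r.
Qed.

Lemma annihilated_eigen_eq0 (L : {linear V -> V}) rs r x :
  L x = r *: x -> r \notin rs -> annihilated L rs x -> x = 0.
Proof.
move=> Lx rrs; rewrite /annihilated (annihilated_eigenE rs Lx) => /eqP.
rewrite scaler_eq0 => /orP[|/eqP//]; rewrite prodf_seq_eq0 => /hasP[t trs].
by rewrite subr_eq0 => /eqP rt; rewrite rt trs in rrs.
Qed.

Lemma annihilated_lin (L : {linear V -> V}) rs k x y :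
  annihilated L rs x -> annihilated L rs y -> annihilated L rs (k *: x + y).
Proof.
rewrite /annihilated => Ex Ey.
have -> : foldr (fun r y => L y - r *: y) (k *: x + y) rs =
  k *: foldr (fun r y => L y - r *: y) x rs + foldr (fun r y => L y - r *: y) y rs.
  by elim: rs {Ex Ey} => // r rs /= ->; rewrite opD opZ; coefs; ring.
by rewrite Ex Ey scaler0 addr0.
Qed.

Definition subspace (S : V -> Prop) := S 0 /\ forall k x y, S x -> S y -> S (k *: x + y).

Lemma subD S x y : subspace S -> S x -> S y -> S (x + y).
Proof. by move=> [_ H] Sx Sy; rewrite -[x]scale1r; apply: H. Qed.
Lemma subZ S k x : subspace S -> S x -> S (k *: x).
Proof. by move=> [S0 H] Sx; rewrite -[_ *: _]addr0; apply: H. Qed.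
Lemma subB S x y : subspace S -> S x -> S y -> S (x - y).
Proof. by move=> SS Sx Sy; apply: subD => //; rewrite -scaleN1r; apply: subZ. Qed.

Lemma subN S x : subspace S -> S x -> S (- x).
Proof. by move=> SS Sx; rewrite -scaleN1r; apply: subZ. Qed.

Lemma annihilated_subspace L rs : subspace (annihilated L rs).
Proof.
split; last by move=> *; apply: annihilated_lin.
by rewrite /annihilated; elim: rs => //= r rs ->; rewrite op0 scaler0 subr0.
Qed.

(* Splitting into eigenvectors without leaving an L-stable subspace: the
   component for r is x - u, where u solves (L - r) u = (L - r) x. *)
Lemma eigen_ind (L : {linear V -> V}) (rs : seq K) (S Q : V -> Prop) :
    uniq rs -> subspace S -> (forall x, S x -> S (L x)) -> subspace Q ->
    (forall r x, r \in rs -> S x -> L x = r *: x -> Q x) ->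
  forall x, S x -> annihilated L rs x -> Q x.
Proof.
move=> + SS SL; elim: rs Q => [|r rs IH] Q /=.
  by move=> _ [Q0 _] _ x _; rewrite /annihilated /= => ->.
move=> /andP[rrs urs] QQ Qe x Sx; rewrite /annihilated /= => Ex.
have Sx' : S (L x - r *: x) by apply: subB => //; [apply: SL | apply: subZ].
(* The induction hypothesis is applied to the solvability of (L - r) u = v inside both [S] and [Q],
   not to [Q] itself. *)
pose Q' v := exists u, [/\ S u, Q u & L u - r *: u = v].
have : Q' (L x - r *: x).
  apply: (IH Q') => //.
  - split; first by exists 0; rewrite op0 scaler0 subr0; case: SS; case: QQ.
    move=> k _ _ [u [Su Qu <-]] [v [Sv Qv <-]]; exists (k *: u + v).
    split; [by apply: SS.2 | by apply: QQ.2 |].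
    by rewrite (opD L) (opZ L); coefs; ring.
  (* On an eigenvector for [s], the operator [L - r] is the nonzero scalar [s - r] and is inverted
     explicitly. *)
  - move=> s y srs Sy Ly; have sr : s - r != 0.
      by rewrite subr_eq0; apply: contraNneq rrs => <-.
    exists ((s - r)^-1 *: y); split; first exact: subZ.
      by apply: subZ => //; apply: Qe Sy Ly; rewrite inE srs orbT.
    by rewrite opZ Ly; coefs; field.
  - rewrite /annihilated -[RHS]Ex; elim: rs {IH Ex Qe urs rrs} => //= s rs ->.
    by rewrite !(opD L) !(opN L) !(opZ L); coefs; ring.
move=> [u [Su Qu Eu]]; rewrite -[x](subrK u); apply: subD => //.
apply: (Qe r); first by rewrite inE eqxx.
  exact: subB.
have -> : L (x - u) = r *: (x - u) + ((L x - r *: x) - (L u - r *: u)).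
  by rewrite (opD L) (opN L); coefs; ring.
by rewrite Eu subrr addr0.
Qed.
End Eigen.

(** * Creation, annihilation and right multiplication *)

Section Ops.
Variable K : numClosedFieldType.
Implicit Types (x y : vec K) (b : MB).
Notation vec := (vec K).
Notation bv := (@bv K).

Lemma coef_bv b b' : (bv b)@_b' = (b == b')%:R.
Proof. exact: mcoeffU. Qed.

Lemma vecE x : x = \sum_(b <- msupp x) x@_b *: bv b.
Proof.
rewrite [LHS]monalgE; apply: eq_bigr => b _; apply/malgP => k.
by rewrite mcoeffZ !mcoeffU mulr_natr.
Qed.

Lemma lextE_mmap (f : MB -> vec) (d : {fset MB}) x : (msupp x `<=` d)%fset ->
  lext f x = \sum_(b <- d) x@_b *: f b.
Proof.
move=> sub; rewrite /lext (big_fset_incl _ sub) // => b _ /mcoeff_outdom->.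
by rewrite scale0r.
Qed.

Lemma lext_is_linear (f : MB -> vec) : linear (lext f).
Proof.
move=> c x y.
have s1 : (msupp x `<=` msupp x `|` msupp y)%fset by apply: fsubsetUl.
have s2 : (msupp y `<=` msupp x `|` msupp y)%fset by apply: fsubsetUr.
have s3 : (msupp (c *: x + y) `<=` msupp x `|` msupp y)%fset.
  apply: fsubset_trans (msuppD_le _ _) _.
  by apply: fsetSU; apply: msuppZ_le.
rewrite (lextE_mmap f s1) (lextE_mmap f s2) (lextE_mmap f s3).
rewrite scaler_sumr -big_split; apply: eq_bigr => b _ /=.
by rewrite mcoeffD mcoeffZ scalerDl scalerA.
Qed.
HB.instance Definition _ f := GRing.isLinear.Build K vec vec _ (lext f) (lext_is_linear f).

Lemma lext_bv (f : MB -> vec) b : lext f (bv b) = f b.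
Proof.
by rewrite /lext /Defs.bv msuppU oner_eq0 big_seq_fset1 mcoeffUU scale1r.
Qed.

Lemma lin_ext (f g : {linear vec -> vec}) : (forall b, f (bv b) = g (bv b)) -> f =1 g.
Proof.
move=> fg x; rewrite (vecE x) !linear_sum; apply: eq_bigr => b _.
by rewrite !linearZ /= fg.
Qed.

End Ops.

Section Ops.
Variable K : numClosedFieldType.
Implicit Types (x y : vec K) (b : MB) (J : {set 'I_4}) (i : 'I_4).
Notation vec := (vec K).
Notation bv := (@bv K).
Notation sgn := (@sgn K).

HB.instance Definition _ (g : nb) := GRing.Linear.copy (@rmul K g) (lext (rmulb K g)).
HB.instance Definition _ (g : nb) := GRing.Linear.copy (@lmul K g) (lext (lmulb K g)).
HB.instance Definition _ X j := GRing.Linear.copy (@dX K X j) (lext (dXb K X j)).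
HB.instance Definition _ X j := GRing.Linear.copy (@dY K X j) (lext (dYb K X j)).

(** Weighted substitutions of basis elements: [opU] touches only the factor Theta^k eta_J and [opE]
    only the polynomial factor, so operators of different kinds commute for a formal reason
    ([opUE]). *)
Definition opU (c : nat * {set 'I_4} -> K) (s : nat * {set 'I_4} -> nat * {set 'I_4}) : vec -> vec :=
  lext (fun b => c b.1 *: bv (s b.1, b.2)).
Definition opE (c : mon -> K) (s : mon -> mon) : vec -> vec :=
  lext (fun b => c b.2 *: bv (b.1, s b.2)).
HB.instance Definition _ c s := GRing.Linear.copy (opU c s) (lext _).
HB.instance Definition _ c s := GRing.Linear.copy (opE c s) (lext _).

Lemma opU_bv c s b : opU c s (bv b) = c b.1 *: bv (s b.1, b.2).
Proof. exact: lext_bv. Qed.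
Lemma opE_bv c s b : opE c s (bv b) = c b.2 *: bv (b.1, s b.2).
Proof. exact: lext_bv. Qed.

Lemma opUE c s c' s' x : opU c s (opE c' s' x) = opE c' s' (opU c s x).
Proof.
apply: (@lin_ext _ (opU c s \o opE c' s') (opE c' s' \o opU c s)) => b /=.
by rewrite opE_bv opU_bv !linearZ /= opU_bv opE_bv !scalerA mulrC.
Qed.

(** Exterior multiplication by eta_i and the contraction adjoint to it. The sign counts the larger
    indices because eta_i enters at the right end. *)
Definition crea i : vec -> vec :=
  opU (fun p => (i \notin p.2)%:R * sgn (cnt_gt p.2 i)) (fun p => (p.1, i |: p.2)).
Definition anni i : vec -> vec :=
  opU (fun p => (i \in p.2)%:R * sgn (cnt_gt p.2 i)) (fun p => (p.1, p.2 :\ i)).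
Definition theta : vec -> vec := opU (fun=> 1) (fun p => (p.1.+1, p.2)).
HB.instance Definition _ i := GRing.Linear.copy (crea i) (opU _ _).
HB.instance Definition _ i := GRing.Linear.copy (anni i) (opU _ _).
HB.instance Definition _ := GRing.Linear.copy theta (opU _ _).

Lemma sgn_odd n : sgn n = sgn (odd n).
Proof. by rewrite /Defs.sgn signr_odd. Qed.

Lemma cnt_gtU J i j : i \notin J -> cnt_gt (i |: J) j = ((j < i) + cnt_gt J j)%N.
Proof.
move=> iJ; rewrite /cnt_gt; case: (ltnP j i) => ji.
  rewrite (_ : [set _ in _ | _] = i |: [set k in J | (j < k)%N]).
    by rewrite cardsU1 inE (negbTE iJ).
  by apply/setP => k; rewrite !inE; case: eqP => // ->; rewrite ji.
rewrite add0n; congr #|pred_of_set _|; apply/setP => k; rewrite !inE.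
by case: eqP => // ->; rewrite ltnNge ji (negbTE iJ).
Qed.

Lemma cnt_gtD J i j : i \in J -> cnt_gt J j = ((j < i) + cnt_gt (J :\ i) j)%N.
Proof. by move=> iJ; rewrite -{1}(setD1K iJ) cnt_gtU // !inE eqxx. Qed.

Lemma sgnD m n : sgn (m + n) = sgn m * sgn n.
Proof. exact: exprD. Qed.
Lemma sgn_sqr n : sgn n * sgn n = 1.
Proof. by rewrite -sgnD addnn /Defs.sgn -muln2 exprM sqrr_sign. Qed.

(** Source of the anticommutation signs: exactly one of i < j and j < i holds. *)
Lemma sgn_gt_anti (i j : 'I_4) : i != j -> sgn (i < j)%N = - sgn (j < i)%N.
Proof.
move=> ij; rewrite /Defs.sgn; case: ltngtP (ij) => //; rewrite ?expr1 ?expr0 ?opprK //.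
by move/val_inj->; rewrite eqxx.
Qed.

Lemma crea_crea i j x : crea i (crea j x) = - crea j (crea i x).
Proof.
apply: (@lin_ext _ (crea i \o crea j) (-%R \o (crea j \o crea i))) => -[[k J] e] /=.
rewrite /crea !opU_bv !linearZ /= !opU_bv -scaleNr !scalerA /= !inE !negb_or.
case: (eqVneq i j) => [->|ij] /=; first by rewrite /= !(mul0r, mulr0, oppr0, scale0r).
rewrite setUCA /=.
have [iJ|iJ] := boolP (i \in J); first by rewrite !(mul0r, mulr0, oppr0, scale0r).
have [jJ|jJ] := boolP (j \in J); first by rewrite !(mul0r, mulr0, oppr0, scale0r).
congr (_ *: _); rewrite !mul1r !cnt_gtU // !sgnD (sgn_gt_anti ij); ring.
Qed.

Lemma anni_anni i j x : anni i (anni j x) = - anni j (anni i x).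
Proof.
apply: (@lin_ext _ (anni i \o anni j) (-%R \o (anni j \o anni i))) => -[[k J] e] /=.
rewrite /anni !opU_bv !linearZ /= !opU_bv -scaleNr !scalerA /= !inE.
case: (eqVneq i j) => [->|ij] /=; first by rewrite /= !(mul0r, mulr0, oppr0, scale0r).
rewrite setDDl setUC -setDDl.
have [iJ|iJ] := boolP (i \in J); last by rewrite !(mul0r, mulr0, oppr0, scale0r).
have [jJ|jJ] := boolP (j \in J); last by rewrite !(mul0r, mulr0, oppr0, scale0r).
congr (_ *: _); rewrite !mul1r (cnt_gtD j iJ) (cnt_gtD i jJ) !sgnD (sgn_gt_anti ij); ring.
Qed.

Lemma anni_crea i j x : anni i (crea j x) = (i == j)%:R *: x - crea j (anni i x).
Proof.
apply: (@lin_ext _ (anni i \o crea j) ((i == j)%:R \*: idfun \- (crea j \o anni i))) => -[[k J] e] /=.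
rewrite /anni /crea !opU_bv !linearZ /= !opU_bv ?scalerN !scalerA /= !inE.
have [<-|ij] /= := eqVneq i j.
  rewrite !mul1r.
  have [iJ|iJ] /= := boolP (i \in J).
    rewrite !mul0r scale0r !mul1r (cnt_gtD i iJ) ltnn add0n sgn_sqr.
    by rewrite setD1K // !scale1r subrr.
  rewrite (cnt_gtU i iJ) ltnn add0n !mul1r sgn_sqr !mul0r scale0r subr0.
  by rewrite setU1K.
rewrite scale0r sub0r /=.
have [iJ|iJ] := boolP (i \in J); last by rewrite !(mul0r, mulr0, oppr0, scale0r).
have [jJ|jJ] := boolP (j \in J); first by rewrite !(mul0r, mulr0, oppr0, scale0r).
have -> : (j |: J) :\ i = j |: J :\ i.
  by apply/setP => l; rewrite !inE; case: (eqVneq l i) => [->|]; rewrite ?(negbTE ij) ?andbT.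
rewrite -scaleNr !mul1r (cnt_gtU i jJ) (cnt_gtD j iJ) !sgnD (sgn_gt_anti ij).
by congr (_ *: _); rewrite mulrACA mulrN sgn_sqr mulN1r mulrC.
Qed.

Lemma theta_crea i x : crea i (theta x) = theta (crea i x).
Proof.
apply: (@lin_ext _ (crea i \o theta) (theta \o crea i)) => -[[k J] e] /=.
by rewrite /crea /theta !opU_bv !linearZ /= !opU_bv !scalerA mulrC.
Qed.
Lemma theta_anni i x : anni i (theta x) = theta (anni i x).
Proof.
apply: (@lin_ext _ (anni i \o theta) (theta \o anni i)) => -[[k J] e] /=.
by rewrite /anni /theta !opU_bv !linearZ /= !opU_bv !scalerA mulrC.
Qed.

Lemma theta_inj x : theta x = 0 -> x = 0.
Proof.
suff th_coef k J e : (theta x)@_(k.+1, J, e) = x@_(k, J, e).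
  by move=> x0; apply/malgP => -[[k J] e]; rewrite -th_coef x0 !mcoeff0.
rewrite [in LHS](vecE x) [in RHS](vecE x) !linear_sum.
rewrite !(raddf_sum (mcoeff _)) /=; apply: eq_bigr => -[[k' J'] e'] _.
rewrite linearZ /= /theta opU_bv scale1r !mcoeffZ !coef_bv.
by rewrite /= !xpair_eqE eqSS.
Qed.

(** Since eta_i^2 = - Theta / 2, Clifford multiplication is exterior multiplication deformed by
    Theta times a contraction. *)
Lemma rmulE i x : rmul (NEta i) x = crea i x - 2^-1 *: theta (anni i x).
Proof.
apply: (@lin_ext _ (rmul (NEta i)) (crea i \- 2^-1 \*: (theta \o anni i))) => -[[k J] e] /=.
rewrite [rmul _ _]lext_bv /= /crea /anni /theta !opU_bv !linearZ /= !opU_bv !scalerA.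
have [iJ|iJ] /= := boolP (i \in J); rewrite !(mul0r, mul1r, mulr0, mulr1, scale0r, sub0r, subr0) //.
  by rewrite add0r scale1r scalerN mulrN scaleNr mulrC.
by rewrite addr0.
Qed.

End Ops.

(** * The w_ab as creation operators, with their dual contractions *)

Section Clifford.
Variables (K : numClosedFieldType) (V : lmodType K) (I : Type) (co : I -> V -> K).
Hypothesis co_lin : forall d k x y, co d (k *: x + y) = k * co d x + co d y.
Hypothesis co_sep : forall x y, (forall d, co d x = co d y) -> x = y.

Local Ltac coefs := coefs_with co_lin co_sep.

Variables (th : {linear V -> V}) (crea anni : 'I_4 -> {linear V -> V}) (o0 o1 o2 o3 : 'I_4).
Hypothesis o_neq : uniq [:: o0; o1; o2; o3].
Hypothesis crea_crea : forall i j x, crea i (crea j x) = - crea j (crea i x).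
Hypothesis anni_anni : forall i j x, anni i (anni j x) = - anni j (anni i x).
Hypothesis anni_crea : forall i j x, anni i (crea j x) = (i == j)%:R *: x - crea j (anni i x).

Definition opsE := (lin_opE th, lin_opE (crea o0), lin_opE (crea o1), lin_opE (crea o2), lin_opE (crea o3), 
   lin_opE (anni o0), lin_opE (anni o1), lin_opE (anni o2), lin_opE (anni o3)).

Lemma o_neqE : ((o1 == o0) = false) * ((o0 == o1) = false) * ((o2 == o0) = false) *
  ((o0 == o2) = false) * ((o3 == o0) = false) * ((o0 == o3) = false) *
  ((o1 == o2) = false) * ((o2 == o1) = false) * ((o1 == o3) = false) *
  ((o3 == o1) = false) * ((o2 == o3) = false) * ((o3 == o2) = false).
Proof.
move: o_neq; rewrite /= !inE !negb_or => /and4P[/and3P[? ? ?] /andP[? ?] ? _].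
by do !split; apply/negbTE; rewrite // eq_sym.
Qed.

Definition cA (a b : bool) (x : V) : V :=
  match a, b with
  | false, false => crea o1 x + 'i *: crea o0 x
  | true, true => crea o1 x - 'i *: crea o0 x
  | false, true => - crea o3 x + 'i *: crea o2 x
  | true, false => crea o3 x + 'i *: crea o2 x
  end.

(** The factor 1/2 and the conjugated signs of ['i] make [io] the basis dual to [cA], so that
    [io_cA] takes the canonical form. *)
Definition io (a b : bool) (x : V) : V :=
  2^-1 *: match a, b with
  | false, false => anni o1 x - 'i *: anni o0 x
  | true, true => anni o1 x + 'i *: anni o0 x
  | false, true => - anni o3 x - 'i *: anni o2 x
  | true, false => anni o3 x - 'i *: anni o2 x
  end.

Lemma cA_is_linear a b : linear (cA a b).
Proof.
case: a; case: b.
- exact: (linearP (crea o1 \- 'i \*: crea o0)).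
- exact: (linearP (crea o3 \+ 'i \*: crea o2)).
- exact: (linearP (-%R \o crea o3 \+ 'i \*: crea o2)).
- exact: (linearP (crea o1 \+ 'i \*: crea o0)).
Qed.
HB.instance Definition _ a b := GRing.isLinear.Build K V V _ (cA a b) (cA_is_linear a b).
Lemma io_is_linear a b : linear (io a b).
Proof.
case: a; case: b.
- exact: (linearP (2^-1 \*: (anni o1 \+ 'i \*: anni o0))).
- exact: (linearP (2^-1 \*: (anni o3 \- 'i \*: anni o2))).
- exact: (linearP (2^-1 \*: (-%R \o anni o3 \- 'i \*: anni o2))).
- exact: (linearP (2^-1 \*: (anni o1 \- 'i \*: anni o0))).
Qed.
HB.instance Definition _ a b := GRing.isLinear.Build K V V _ (io a b) (io_is_linear a b).

Lemma crea2 i x : crea i (crea i x) = 0.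
Proof.
have /eqP := crea_crea i i x; rewrite -addr_eq0 -mulr2n -scaler_nat scaler_eq0.
by rewrite pnatr_eq0 /= => /eqP.
Qed.
Lemma anni2 i x : anni i (anni i x) = 0.
Proof.
have /eqP := anni_anni i i x; rewrite -addr_eq0 -mulr2n -scaler_nat scaler_eq0.
by rewrite pnatr_eq0 /= => /eqP.
Qed.

Definition cc_rules := (crea_crea o1 o0, crea_crea o2 o0, crea_crea o3 o0,
  crea_crea o2 o1, crea_crea o3 o1, crea_crea o3 o2, crea2).
Definition aa_rules := (anni_anni o1 o0, anni_anni o2 o0, anni_anni o3 o0,
  anni_anni o2 o1, anni_anni o3 o1, anni_anni o3 o2, anni2).

Lemma cA_cA a b c d x : cA a b (cA c d x) = - cA c d (cA a b x).
Proof.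
by case: a; case: b; case: c; case: d; rewrite /cA !opsE ?cc_rules; coefs; ring.
Qed.

Lemma io_io a b c d x : io a b (io c d x) = - io c d (io a b x).
Proof.
by case: a; case: b; case: c; case: d; rewrite /io !opsE ?aa_rules; coefs; ring.
Qed.

Lemma io_cA a b c d x :
  io a b (cA c d x) = ((a == c) && (b == d))%:R *: x - cA c d (io a b x).
Proof.
(* The relation i^2 = -1 enters only through these contractions; afterwards ['i] is an atom. *)
have ii : 'i * 'i = -1 :> K by rewrite -expr2 sqrCi.
have i1 z : z * 'i * 'i = - z :> K by rewrite -mulrA ii mulrN1.
have i2 z : 'i * z * 'i = - z :> K by rewrite mulrAC ii mulN1r.
by case: a; case: b; case: c; case: d; rewrite /io /cA !opsE !anni_crea ?eqxx ?o_neqE /=; coefs;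
  rewrite !(mulrBr, mulrDr, mulNr, mulrN, mul1r, mul0r, opprD, opprK) ?mulrA ?i1 ?i2; field.
Qed.

Section Commute.
Variable f : {linear V -> V}.
Lemma cA_comm a b x : (forall i x, crea i (f x) = f (crea i x)) -> cA a b (f x) = f (cA a b x).
Proof. by move=> H; case: a; case: b; rewrite /cA !H !(lin_opE f). Qed.
Lemma io_comm a b x : (forall i x, anni i (f x) = f (anni i x)) -> io a b (f x) = f (io a b x).
Proof. by move=> H; case: a; case: b; rewrite /io !H !(lin_opE f). Qed.

Hypothesis crea_swap : forall i x, crea i (f x) = (if i == o3 then -1 else 1) *: f (crea i x).
Hypothesis anni_swap : forall i x, anni i (f x) = (if i == o3 then -1 else 1) *: f (anni i x).
Lemma cA_swap a b x : cA b a (f x) = f (cA a b x).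
Proof.
case: a; case: b; rewrite /cA !crea_swap !o_neqE ?eqxx !(lin_opE f) //;
  by rewrite ?scaleN1r ?scale1r ?opprK.
Qed.
Lemma io_swap a b x : io b a (f x) = f (io a b x).
Proof.
case: a; case: b; rewrite /io !anni_swap !o_neqE ?eqxx !(lin_opE f) //;
  by rewrite ?scaleN1r ?scale1r ?opprK.
Qed.
End Commute.
End Clifford.

(** * Right multiplication by the w_ab and the weight grading *)

Section Clifford.
Variables (K : numClosedFieldType) (V : lmodType K) (I : Type) (co : I -> V -> K).
Hypothesis co_lin : forall d k x y, co d (k *: x + y) = k * co d x + co d y.
Hypothesis co_sep : forall x y, (forall d, co d x = co d y) -> x = y.

Local Ltac coefs := coefs_with co_lin co_sep.
Variables (th : {linear V -> V}) (cA io : bool -> bool -> {linear V -> V}).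
Hypothesis cA_cA : forall a b c d x, cA a b (cA c d x) = - cA c d (cA a b x).
Hypothesis io_io : forall a b c d x, io a b (io c d x) = - io c d (io a b x).
Hypothesis io_cA : forall a b c d x,
  io a b (cA c d x) = ((a == c) && (b == d))%:R *: x - cA c d (io a b x).
Hypothesis cA_th : forall a b x, cA a b (th x) = th (cA a b x).
Hypothesis io_th : forall a b x, io a b (th x) = th (io a b x).

(** Half the coefficient of Theta in the anticommutator of w_ab with its partner of opposite
    indices: -1 for the pair w_11, w_22 and 1 for the pair w_12, w_21. *)
Definition dual_sgn (a b : bool) : K := if a == b then -1 else 1.
Definition Rop a b x : V := cA a b x + dual_sgn a b *: th (io (~~ a) (~~ b) x).
Lemma Rop_is_linear a b : linear (Rop a b).
Proof. exact: (linearP (cA a b \+ dual_sgn a b \*: (th \o io (~~ a) (~~ b)))). Qed.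
HB.instance Definition _ a b := GRing.isLinear.Build K V V _ (Rop a b) (Rop_is_linear a b).

Lemma Rop_th a b x : Rop a b (th x) = th (Rop a b x).
Proof. by rewrite /Rop cA_th io_th (opD th) (opZ th). Qed.

(** The Theta-term of [Rop] is itself a contraction, and contractions anticommute; hence [io] sees
    [Rop] exactly as it sees [cA]. This is what lets the Koszul homotopy survive the deformation. *)
Lemma io_Rop a b c d x :
  io a b (Rop c d x) = ((a == c) && (b == d))%:R *: x - Rop c d (io a b x).
Proof.
rewrite /Rop (opD (io a b)) (opZ (io a b)) io_cA io_th io_io (opN th).
by coefs; ring.
Qed.

Lemma Rop_Rop a b c d x : Rop a b (Rop c d x) =
  (((a == ~~ c) && (b == ~~ d))%:R * (dual_sgn a b + dual_sgn c d)) *: th x - Rop c d (Rop a b x).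
Proof.
rewrite /Rop (opD (cA a b)) (opZ (cA a b)) (opD (io _ _)) (opZ (io (~~ a) _)) !cA_th !io_th.
rewrite (opD (cA c d)) (opZ (cA c d)) (opD (io (~~ c) _)) (opZ (io (~~ c) _)) !cA_th !io_th.
rewrite !(opD th) !(opZ th) !io_cA (cA_cA a b c d) (io_io (~~ c)) !(opD th) !(opN th) !(opZ th).
rewrite (_ : (~~ c == a) = (a == ~~ c)) 1?eq_sym // (_ : (~~ d == b) = (b == ~~ d)) 1?eq_sym //.
rewrite (_ : (~~ a == c) = (a == ~~ c)); last by case: a; case: c.
rewrite (_ : (~~ b == d) = (b == ~~ d)); last by case: b; case: d.
by coefs; ring.
Qed.

(** Occupation number of w_ab in the exterior algebra. The four occupation numbers are commuting
    idempotents, which makes the weight diagonalizable. *)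
Definition num a b x : V := cA a b (io a b x).
Lemma num_is_linear a b : linear (num a b).
Proof. exact: (linearP (cA a b \o io a b)). Qed.
HB.instance Definition _ a b := GRing.isLinear.Build K V V _ (num a b) (num_is_linear a b).

Lemma cA2 a b x : cA a b (cA a b x) = 0.
Proof.
have /eqP := cA_cA a b a b x; rewrite -addr_eq0 -mulr2n -scaler_nat scaler_eq0.
by rewrite pnatr_eq0 /= => /eqP.
Qed.
Lemma io2 a b x : io a b (io a b x) = 0.
Proof.
have /eqP := io_io a b a b x; rewrite -addr_eq0 -mulr2n -scaler_nat scaler_eq0.
by rewrite pnatr_eq0 /= => /eqP.
Qed.

Lemma num_cA a b c d x :
  num a b (cA c d x) = cA c d (num a b x) + ((a == c) && (b == d))%:R *: cA c d x.
Proof.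
rewrite /num io_cA (opD (cA a b)) (opN (cA a b)) (opZ (cA a b)) (cA_cA a b c d).
by case: eqP => [->|_]; case: eqP => [->|_] /=; coefs; ring.
Qed.
Lemma num_io a b c d x :
  num a b (io c d x) = io c d (num a b x) - ((a == c) && (b == d))%:R *: io c d x.
Proof.
rewrite /num io_io io_cA (opN (cA a b)) [a == c]eq_sym [b == d]eq_sym.
by case: eqP => [->|_]; case: eqP => [->|_] /=; coefs; ring.
Qed.
Lemma num_num a b c d x : num a b (num c d x) = num c d (num a b x).
Proof. by rewrite {2 3}/num num_cA num_io (opB (cA c d)) (opZ (cA c d)); coefs; ring. Qed.
Lemma num_th a b x : num a b (th x) = th (num a b x).
Proof. by rewrite /num io_th cA_th. Qed.

Lemma num_idem a b x : annihilated (num a b) [:: 0; 1] x.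
Proof.
have E : num a b (num a b x) = num a b x.
  by rewrite /num io_cA !eqxx scale1r (opB (cA a b)) cA2 subr0.
by rewrite /annihilated /= scale1r scale0r subr0 (opB (num a b)) /= E subrr.
Qed.

Definition wt (b : bool) : K := if b then -1 else 1.
Definition weight x : V :=
  num false false x + num true false x - num false true x - num true true x.
Lemma weight_is_linear : linear weight.
Proof.
exact: (linearP (num false false \+ num true false \- num false true \- num true true)).
Qed.
HB.instance Definition _ := GRing.isLinear.Build K V V _ weight weight_is_linear.

Lemma weight_cA a b x : weight (cA a b x) = cA a b (weight x) + wt b *: cA a b x.
Proof.
rewrite /weight !num_cA !(opD (cA a b)) !(opN (cA a b)).
by case: a; case: b => /=; coefs; rewrite /wt; ring.
Qed.
Lemma weight_io a b x : weight (io a b x) = io a b (weight x) - wt b *: io a b x.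
Proof.
rewrite /weight !num_io !(opD (io a b)) !(opN (io a b)).
by case: a; case: b => /=; coefs; rewrite /wt; ring.
Qed.
Lemma weight_th x : weight (th x) = th (weight x).
Proof. by rewrite /weight !num_th !(opD th) !(opN th). Qed.

(** Theta has weight 0, and the contraction in [Rop] removes a factor whose weight is opposite to
    that of w_ab; both terms therefore shift the weight by the same amount. *)
Lemma weight_Rop a b x : weight (Rop a b x) = Rop a b (weight x) + wt b *: Rop a b x.
Proof.
rewrite /Rop (opD weight) (opZ weight) /= weight_cA weight_th weight_io (opB th) (opZ th).
by case: b; coefs; rewrite /wt /=; ring.
Qed.

Section Commute.
Variable f : {linear V -> V}.
Hypothesis cA_f : forall a b x, cA a b (f x) = f (cA a b x).
Hypothesis io_f : forall a b x, io a b (f x) = f (io a b x).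
Hypothesis th_f : forall x, th (f x) = f (th x).
Lemma Rop_comm a b x : Rop a b (f x) = f (Rop a b x).
Proof. by rewrite /Rop cA_f io_f th_f (opD f) (opZ f). Qed.
Lemma weight_comm x : weight (f x) = f (weight x).
Proof. by rewrite /weight /num !io_f !cA_f !(opD f) !(opN f). Qed.
End Commute.

Lemma Rop_swap (f : {linear V -> V}) a b x :
  (forall a b x, cA b a (f x) = f (cA a b x)) -> (forall a b x, io b a (f x) = f (io a b x)) ->
  (forall x, th (f x) = f (th x)) -> Rop b a (f x) = f (Rop a b x).
Proof.
move=> cf iof tf; rewrite /Rop cf iof tf (opD f) (opZ f).
by rewrite /dual_sgn eq_sym.
Qed.

(** Splitting along the four occupation numbers in turn leaves common eigenvectors, of weight r1 +
    r2 - r3 - r4 with every r in {0, 1}. *)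
Lemma weight_annihilated x : annihilated weight [:: -2; -1; 0; 1; 2] x.
Proof.
pose Q := annihilated weight [:: -2; -1; 0; 1; 2].
have QQ : subspace Q by apply: annihilated_subspace.
have u01 : uniq [:: 0; 1 : K] by rewrite /= inE eq_sym oner_eq0.
pose ev a b r y := num a b y = r *: y.
have evS a b r : subspace (ev a b r).
  split; first by rewrite /ev op0 scaler0.
  by move=> k u v; rewrite /ev (opD (num a b)) (opZ (num a b)) /= => -> ->; coefs; ring.
have evN a b r c d y : ev a b r y -> ev a b r (num c d y).
  by rewrite /ev num_num => ->; rewrite (opZ (num c d)).
have sI S T : subspace S -> subspace T -> subspace (fun y => S y /\ T y).
  move=> [S0 SS] [T0 TT]; split=> // k u v [Su Tu] [Sv Tv].
  by split; [apply: SS | apply: TT].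
apply: (eigen_ind co_lin co_sep (L := num false false) u01 (S := fun=> True) _ _ QQ);
  rewrite ?num_idem //; last by move: (num_idem false false x).
move=> r1 {}x r1P _ E1.
apply: (eigen_ind co_lin co_sep (L := num true false) u01 (evS false false r1) _ QQ _ E1); 
  [exact: evN | | exact: num_idem].
move=> r2 {E1}x r2P E1 E2.
pose S2 y := ev false false r1 y /\ ev true false r2 y.
have SS2 : subspace S2 by apply: sI.
apply: (@eigen_ind _ _ _ _ co_lin co_sep (num false true) _ S2 Q u01 SS2 _ QQ _ x) => //;
  [by move=> y []; split; apply: evN | | exact: num_idem].
move=> r3 {E1 E2}x r3P [E1 E2] E3.
pose S3 y := S2 y /\ ev false true r3 y.
have SS3 : subspace S3 by apply: sI.
apply: (@eigen_ind _ _ _ _ co_lin co_sep (num true true) _ S3 Q u01 SS3 _ QQ _ x) => //;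
  [by move=> y [[? ?] ?]; do !split; apply: evN | | exact: num_idem].
move=> r4 {E1 E2 E3}x r4P [[E1 E2] E3] E4.
have Ex : weight x = (r1 + r2 - r3 - r4) *: x.
  by rewrite /weight E1 E2 E3 E4; coefs; ring.
apply: (annihilated_eigen co_lin co_sep Ex).
have mem r : r1 + r2 - r3 - r4 = r -> r \in [:: -2; -1; 0; 1; 2] ->
  r1 + r2 - r3 - r4 \in [:: -2; -1; 0; 1; 2] by move=> ->.
move: r1P r2P r3P r4P mem; rewrite ![_ \in [:: 0; 1]]inE ![_ \in [:: 1]]inE.
by move=> /orP[]/eqP-> /orP[]/eqP-> /orP[]/eqP-> /orP[]/eqP-> mem;
  first [ apply: (mem (-2)); first ring; rewrite !inE eqxx ?orbT
        | apply: (mem (-1)); first ring; rewrite !inE eqxx ?orbT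
        | apply: (mem 0); first ring; rewrite !inE eqxx ?orbT
        | apply: (mem 1); first ring; rewrite !inE eqxx ?orbT
        | apply: (mem 2); first ring; rewrite !inE eqxx ?orbT ].
Qed.

End Clifford.

(** * The differentials D_1 and D_2 *)

(** Degree after [p], while [pv] is the degree after [q]. The truncated predecessor at 0 is
    harmless: the operator concerned vanishes there, by [k_M0_p] and [k_M0_q]. *)
Definition nx (s : bool) (m : nat) : nat := if s then m.+1 else m.-1.
Definition pv (s : bool) (m : nat) : nat := if s then m.-1 else m.+1.

(* [th] is the central Theta, [R a b] right multiplication by w_(ab), [io a b] the
   dual contraction, [W] the weight grading, [p j] the operator written d_(x_j) in the
   paper (derivation or, if [s], multiplication), [q j] its partner, [M m] x-degree m. *)
Record koszul (K : numClosedFieldType) (V : lmodType K) (th W : {linear V -> V})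
    (R io : bool -> bool -> {linear V -> V}) (s : bool) (p q : bool -> {linear V -> V})
    (M : nat -> V -> Prop) : Prop := Koszul {
  k_R_R : forall a b c d x, R a b (R c d x) =
  (((a == ~~ c) && (b == ~~ d))%:R * ((if a == b then -1 else 1) + (if c == d then -1 else 1))) *: th x - R c d (R a b x);
  k_io_R : forall a b c d x,
  io a b (R c d x) = ((a == c) && (b == d))%:R *: x - R c d (io a b x);
  k_io_io : forall a b c d x, io a b (io c d x) = - io c d (io a b x);
  k_R_th : forall a b x, R a b (th x) = th (R a b x);
  k_th_inj : forall x, th x = 0 -> x = 0;
  k_W_R : forall a b x, W (R a b x) = R a b (W x) + (if b then -1 else 1 : K) *: R a b x;
  k_W_io : forall a b x, W (io a b x) = io a b (W x) - (if b then -1 else 1 : K) *: io a b x;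
  k_W_ann : forall x, annihilated W [:: -2; -1; 0; 1; 2] x;
  k_p_R : forall j a b x, p j (R a b x) = R a b (p j x);
  k_q_R : forall j a b x, q j (R a b x) = R a b (q j x);
  k_p_io : forall j a b x, p j (io a b x) = io a b (p j x);
  k_p_W : forall j x, p j (W x) = W (p j x);
  k_q_W : forall j x, q j (W x) = W (q j x);
  k_p_p : forall j k x, p j (p k x) = p k (p j x);
  k_p_q : forall j k x, p j (q k x) = q k (p j x) + ((j == k)%:R * (if s then -1 else 1)) *: x;
  k_M_sub : forall m, subspace (M m);
  k_M_R : forall m a b x, M m x -> M m (R a b x);
  k_M_io : forall m a b x, M m x -> M m (io a b x);
  k_M_W : forall m x, M m x -> M m (W x);
  k_M_p : forall m j x, M m x -> M (nx s m) (p j x);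
  k_M_q : forall m j x, M m x -> M (pv s m) (q j x);
  k_M_eul : forall m x, M m x -> q false (p false x) + q true (p true x) = (if s then m.+2%:R else m%:R : K) *: x;
  k_M0_q : s -> forall j x, M 0 x -> q j x = 0;
  k_M0_p : ~~ s -> forall j x, M 0 x -> p j x = 0 }.

Section Koszul.
Variables (K : numClosedFieldType) (V : lmodType K) (I : Type) (co : I -> V -> K).
Hypothesis co_lin : forall d k x y, co d (k *: x + y) = k * co d x + co d y.
Hypothesis co_sep : forall x y, (forall d, co d x = co d y) -> x = y.
Local Ltac coefs := coefs_with co_lin co_sep.
Variables (th W : {linear V -> V}) (R io : bool -> bool -> {linear V -> V}).
Variables (s : bool) (p q : bool -> {linear V -> V}) (M : nat -> V -> Prop).
Hypothesis HK : koszul th W R io s p q M.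
Let dual_sgn (a b : bool) : K := if a == b then -1 else 1.
Let wt (b : bool) : K := if b then -1 else 1.
Let eps : K := if s then -1 else 1.
(** Eigenvalue of the sum of [q j] after [p j]: the Euler operator, shifted by 2 when [q]
    differentiates what [p] has multiplied. *)
Let eul (m : nat) : K := if s then m.+2%:R else m%:R.
Let R_R : forall a b c d x, R a b (R c d x) =
  (((a == ~~ c) && (b == ~~ d))%:R * (dual_sgn a b + dual_sgn c d)) *: th x - R c d (R a b x).
Proof. exact: (k_R_R HK). Qed.
Let io_R := k_io_R HK.
Let io_io := k_io_io HK.
Let R_th := k_R_th HK.
Let th_inj := k_th_inj HK.
Let W_R : forall a b x, W (R a b x) = R a b (W x) + wt b *: R a b x.
Proof. exact: (k_W_R HK). Qed.
Let W_io : forall a b x, W (io a b x) = io a b (W x) - wt b *: io a b x.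
Proof. exact: (k_W_io HK). Qed.
Let W_ann := k_W_ann HK.
Let p_R := k_p_R HK.
Let q_R := k_q_R HK.
Let p_io := k_p_io HK.
Let p_W := k_p_W HK.
Let q_W := k_q_W HK.
Let p_p := k_p_p HK.
Let p_q : forall j k x, p j (q k x) = q k (p j x) + ((j == k)%:R * eps) *: x.
Proof. exact: (k_p_q HK). Qed.
Let M_sub := k_M_sub HK.
Let M_R := k_M_R HK.
Let M_io := k_M_io HK.
Let M_W := k_M_W HK.
Let M_p := k_M_p HK.
Let M_q := k_M_q HK.
Let M_eul : forall m x, M m x -> q false (p false x) + q true (p true x) = eul m *: x.
Proof. exact: (k_M_eul HK). Qed.
Let M0_q := k_M0_q HK.
Let M0_p := k_M0_p HK.
Local Notation nx := (nx s).
Local Notation pv := (pv s).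

Notation Ra := (R false false).
Notation Rb := (R true false).
Notation Rc := (R false true).
Notation Rd := (R true true).

Definition D b x : V := R false b (p false x) + R true b (p true x).
Lemma D_is_linear b : linear (D b).
Proof. exact: (linearP ((R false b \o p false) \+ (R true b \o p true))). Qed.
HB.instance Definition _ b := GRing.isLinear.Build K V V _ (D b) (D_is_linear b).

Lemma D_comm (f : {linear V -> V}) b x : (forall a c y, R a c (f y) = f (R a c y)) ->
  (forall j y, p j (f y) = f (p j y)) -> D b (f x) = f (D b x).
Proof. by move=> fR fp; rewrite /D !fp !fR (opD f). Qed.

(** Contracting homotopy for [D b]. The operator [N b], which counts the factors w_1b and w_2b, is
    the correction to the Euler operator in [D_hom]. *)
Definition hom b x : V := io false b (q false x) + io true b (q true x).
Definition N b x : V := R false b (io false b x) + R true b (io true b x).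
Lemma N_is_linear b : linear (N b).
Proof. exact: (linearP ((R false b \o io false b) \+ (R true b \o io true b))). Qed.
HB.instance Definition _ b := GRing.isLinear.Build K V V _ (N b) (N_is_linear b).

(** For different indices the two Theta-terms carry the same factor d_(x_1) d_(x_2), and they cancel
    because {w_11, w_22} and {w_21, w_12} are opposite. *)
Lemma D_D b c x : D b (D c x) = - D c (D b x).
Proof.
rewrite /D !(opD (p _)) !p_R !(opD (R _ _)).
rewrite (R_R false b false c) (R_R false b true c) (R_R true b false c) (R_R true b true c).
rewrite (p_p true false); case: b; case: c; coefs; rewrite /dual_sgn /=; ring.
Qed.

Lemma DD b x : D b (D b x) = 0.
Proof.
have /eqP := D_D b b x; rewrite -addr_eq0 -mulr2n -scaler_nat scaler_eq0.
by rewrite pnatr_eq0 /= => /eqP.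
Qed.

Lemma RR a b x : R a b (R a b x) = 0.
Proof.
have := R_R a b a b x; rewrite (_ : (a == ~~ a) = false); last by case: a.
rewrite mul0r scale0r sub0r => /eqP; rewrite -addr_eq0 -mulr2n -scaler_nat scaler_eq0.
by rewrite pnatr_eq0 /= => /eqP.
Qed.

Lemma D_hom b x :
  D b (hom b x) + hom b (D b x) = q false (p false x) + q true (p true x) + eps *: N b x.
Proof.
rewrite /D /hom /N !(opD (p _)) !(opD (q _)) !p_io !q_R !p_q !(opD (io _ _)) !(opD (R _ _)).
rewrite !(opZ (io _ _)) !(opZ (R _ _)) !io_R.
by coefs; rewrite !eqxx /=; ring.
Qed.

Lemma N_R a b x : N b (R a b x) = R a b (N b x) + R a b x.
Proof.
have anti c d y : R c b (R d b y) = - R d b (R c b y).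
  by rewrite R_R (_ : (b == ~~ b) = false) ?andbF ?mul0r ?scale0r ?sub0r //; case: (b).
rewrite /N !io_R !(opB (R _ _)) !(opZ (R _ _)) (opD (R a b)) !(anti a).
by case: a => /=; coefs; rewrite eqxx /=; ring.
Qed.

Lemma p_N j b x : p j (N b x) = N b (p j x).
Proof. by rewrite /N (opD (p j)) !p_R !p_io. Qed.

Lemma D_N b x : D b (N b x) = N b (D b x) - D b x.
Proof. by rewrite /D !p_N (opD (N b)) /= !N_R; coefs; ring. Qed.

(** [N b] is a sum of two commuting idempotents: idempotent because contractions square to zero,
    commuting because w_1b and w_2b anticommute. *)
Lemma N_annihilated b x : annihilated (N b) [:: 0; 1; 2] x.
Proof.
pose Q := annihilated (N b) [:: 0; 1; 2].
have QQ : subspace Q by apply: annihilated_subspace.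
have u01 : uniq [:: 0; 1 : K] by rewrite /= inE eq_sym oner_eq0.
have anti c d y : R c b (R d b y) = - R d b (R c b y).
  by rewrite R_R (_ : (b == ~~ b) = false) ?andbF ?mul0r ?scale0r ?sub0r //; case: (b).
have nlin a : linear (fun y => R a b (io a b y)) by exact: (linearP (R a b \o io a b)).
pose n a : {linear V -> V} := (R a b \o io a b).
have nE a y : n a y = R a b (io a b y) by [].
have io2 a y : io a b (io a b y) = 0.
  have /eqP := io_io a b a b y; rewrite -addr_eq0 -mulr2n -scaler_nat scaler_eq0.
  by rewrite pnatr_eq0 /= => /eqP.
have nn a y : annihilated (n a) [:: 0; 1] y.
  have E : n a (n a y) = n a y.
    by rewrite !nE io_R !eqxx scale1r io2 op0 subr0.
  change (n a (n a y - 1 *: y) - 0 *: (n a y - 1 *: y) = 0).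
  by rewrite scale1r scale0r subr0 (opB (n a)) E subrr.
have comm y : n false (n true y) = n true (n false y).
  rewrite !nE !io_R /= !scale0r !sub0r !(opN (R _ _)) (anti true) opprK (io_io false).
  by rewrite !(opN (R _ _)) opprK.
pose ev r y := n false y = r *: y.
have evS r : subspace (ev r).
  split; first by rewrite /ev op0 scaler0.
  by move=> k u v; rewrite /ev (opD (n false)) (opZ (n false)) => -> ->; coefs; ring.
apply: (@eigen_ind _ _ _ _ co_lin co_sep (n false) _ (fun=> True) Q u01 _ _ QQ _ x) => //.
move=> r1 {}x r1P _ E1.
apply: (@eigen_ind _ _ _ _ co_lin co_sep (n true) _ (ev r1) Q u01 (evS r1) _ QQ _ x) => //.
  by move=> y; rewrite /ev comm => ->; rewrite opZ.
move=> r2 {E1}x r2P E1 E2.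
have Ex : N b x = (r1 + r2) *: x by rewrite scalerDl -E1 -E2.
apply: (annihilated_eigen co_lin co_sep Ex).
by move: r1P r2P; rewrite !inE => /orP[]/eqP-> /orP[]/eqP->;
  rewrite ?addr0 ?add0r -?mulr2n eqxx ?orbT.
Qed.

(** On an eigenspace of [N b] the preimage is a multiple of [hom b x]. The subspaces [T] and [T']
    let it inherit a further property, in practice a weight. *)
Lemma D_exact_in (T T' : V -> Prop) b m x : subspace T -> subspace T' ->
    (forall y, T y -> T (N b y)) -> (forall y, T y -> T' (hom b y)) ->
    (0 < m)%N -> M m x -> T x -> D b x = 0 ->
  exists z, [/\ M (pv m) z, T' z & D b z = x].
Proof.
move=> TS TS' TN Th m0 Mx Tx Dx.
(* The homotopy acts by m + j or by m + 2 - j with j at most 2; the hypothesis m > 0 makes both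
   nonzero. *)
have eul_neq0 (j : nat) : (j <= 2)%N -> eul m + eps * j%:R != 0.
  rewrite /eul /eps; case: (s) => j2.
    by rewrite mulN1r subr_eq0 eqr_nat gtn_eqF // ltnS (leq_trans j2) // ltnS.
  by rewrite mul1r -natrD pnatr_eq0 addn_eq0 negb_and -lt0n m0.
pose S y := [/\ M m y, T y & D b y = 0].
pose Q y := exists z, [/\ M (pv m) z, T' z & D b z = y].
have u012 : uniq [:: 0; 1; 2%:R : K].
  have -> : [:: 0; 1; 2%:R : K] = [seq n%:R | n <- iota 0 3] by [].
  by rewrite map_inj_uniq ?iota_uniq // => j k /eqP; rewrite eqr_nat => /eqP.
apply: (@eigen_ind _ _ _ _ co_lin co_sep (N b) _ S Q u012 _ _ _ _ x);
  last exact: N_annihilated.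
- split; first by split; [exact: (M_sub m).1 | exact: TS.1 | exact: op0].
  move=> k y z [My Ty Dy] [Mz Tz Dz]; split; [exact: (M_sub m).2 | exact: TS.2 |].
  by rewrite (opD (D b)) (opZ (D b)) /= Dy Dz scaler0 addr0.
- move=> y [My Ty Dy]; split; [|exact: TN|].
    by rewrite /N; apply: subD => //; apply: M_R; apply: M_io.
  by rewrite D_N Dy op0 subr0.
- split; first by exists 0; split; [exact: (M_sub _).1 | exact: TS'.1 | exact: op0].
  move=> k y z [y' [My Ty <-]] [z' [Mz Tz <-]]; exists (k *: y' + z').
  split; [exact: (M_sub _).2 | exact: TS'.2 |].
  by rewrite (opD (D b)) (opZ (D b)).
- move=> r y rP [My Ty Dy] Ny.
  have := D_hom b y; rewrite Dy {2}/hom !op0 addr0 addr0 (M_eul My) Ny scalerA -scalerDl => E.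
  have [j /eul_neq0 c0 rj] : exists2 j : nat, (j <= 2)%N & r = j%:R.
    by move: rP; rewrite !inE => /or3P[]/eqP->; [exists 0%N|exists 1%N|exists 2%N].
  exists ((eul m + eps * r)^-1 *: hom b y); split.
  + apply: subZ; first exact: M_sub.
    by rewrite /hom; apply: subD; [exact: M_sub | |]; apply: M_io; apply: M_q.
  + by apply: subZ => //; apply: Th.
  + by rewrite (opZ (D b)) /= E scalerA mulVf ?scale1r // rj.
- by [].
Qed.

Lemma D_exact b m x : (0 < m)%N -> M m x -> D b x = 0 ->
  exists z, M (pv m) z /\ D b z = x.
Proof.
move=> m0 Mx Dx.
have TT : subspace (fun _ : V => True) by [].
have [z [Mz _ <-]] := @D_exact_in (fun=> True) (fun=> True) b m x TT TT
  (fun _ _ => Logic.I) (fun _ _ => Logic.I) m0 Mx Logic.I Dx.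
by exists z.
Qed.

Lemma W_hom b x : W (hom b x) = hom b (W x) - wt b *: hom b x.
Proof.
by rewrite /hom (opD W) !W_io !q_W; coefs; ring.
Qed.

Lemma W_D b x : W (D b x) = D b (W x) + wt b *: D b x.
Proof. by rewrite /D (opD W) !W_R !p_W; coefs; ring. Qed.

Lemma W_N b x : W (N b x) = N b (W x).
Proof.
rewrite /N (opD W) !W_R !W_io !(opB (R _ _)) !(opZ (R _ _)); coefs; ring.
Qed.

Lemma M_D b m x : M m x -> M (nx m) (D b x).
Proof. by move=> Mx; rewrite /D; apply: subD => //; apply: M_R; apply: M_p. Qed.

Lemma M_D2 b m x : (0 < m)%N -> M (pv m) x -> M m (D b x).
Proof.
move=> m0 /(M_D b); rewrite /nx /pv.
by case: (s) => //; rewrite prednK.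
Qed.

Opaque D.

Definition ev lam x : Prop := W x = lam *: x.
Lemma ev_sub lam : subspace (ev lam).
Proof.
split; first by rewrite /ev op0 scaler0.
by move=> k x y; rewrite /ev (opD W) (opZ W) => -> ->; coefs; ring.
Qed.

Lemma D_exact_ev lam b m x : (0 < m)%N -> M m x -> ev lam x -> D b x = 0 ->
  exists z, [/\ M (pv m) z, ev (lam - wt b) z & D b z = x].
Proof.
move=> m0 Mx Wx Dx; apply: (@D_exact_in (ev lam)) => //; try exact: ev_sub.
  by move=> y; rewrite /ev W_N => ->; rewrite (opZ (N b)).
move=> y; rewrite /ev W_hom => ->; rewrite /hom !(opZ (q _)) !(opZ (io _ _)).
by coefs; ring.
Qed.

Lemma ev_out lam x : lam \notin [:: -2; -1; 0; 1; 2] -> ev lam x -> x = 0.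
Proof.
by move=> lamP Wx; apply: (annihilated_eigen_eq0 co_lin co_sep Wx lamP).
Qed.

(** Writing the weights as n - 2 with n < 5 moves comparisons between them from [K] to the natural
    numbers. *)
Let rsE : [:: -2; -1; 0; 1; 2 : K] = [seq n%:R - 2 | n <- iota 0 5].
Proof.
have e0 : -2 = 0%:R - 2 :> K by ring.
have e1 : -1 = 1%:R - 2 :> K by ring.
have e2 : 0 = 2%:R - 2 :> K by ring.
have e3 : 1 = 3%:R - 2 :> K by ring.
have e4 : 2 = 4%:R - 2 :> K by ring.
by rewrite [in LHS]e0 [X in [:: _, X & _]]e1 [X in [:: _, _, X & _]]e2
  [X in [:: _, _, _, X & _]]e3 [X in [:: _, _, _, _, X & _]]e4.
Qed.

Let uniq_rs : uniq [:: -2; -1; 0; 1; 2 : K].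
Proof.
by rewrite rsE map_inj_uniq ?iota_uniq // => j k /addIr /eqP; rewrite eqr_nat => /eqP.
Qed.

Let nat_lam (n : nat) (lam : K) : lam + 2 = n%:R -> (4 < n)%N ->
  lam \notin [:: -2; -1; 0; 1; 2].
Proof.
move=> E n4; rewrite rsE; apply/mapP => -[k]; rewrite mem_iota /= => k5 lk.
move/eqP: E; rewrite lk subrK eqr_nat => /eqP kn.
by move: n4; rewrite -kn ltnNge -ltnS k5.
Qed.

Let neg_lam (n : nat) (lam : K) : lam + 2 = - n.+1%:R -> lam \notin [:: -2; -1; 0; 1; 2].
Proof.
move=> E; rewrite rsE; apply/mapP => -[k _ lk].
by move/eqP: E; rewrite lk subrK -addr_eq0 -natrD pnatr_eq0 addnS.
Qed.

Lemma evN3 x : ev (-3) x -> x = 0.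
Proof. by apply: ev_out; apply: (@neg_lam 0); ring. Qed.
Lemma evN4 x : ev (-4) x -> x = 0.
Proof. by apply: ev_out; apply: (@neg_lam 1); ring. Qed.
Lemma ev3 x : ev 3 x -> x = 0.
Proof. by apply: ev_out; apply: (@nat_lam 5) => //; ring. Qed.
Lemma ev4 x : ev 4 x -> x = 0.
Proof. by apply: ev_out; apply: (@nat_lam 6) => //; ring. Qed.

(* Downward induction on the weight: both step maps raise the weight by 2, and
   weights beyond 2 do not occur. *)
Lemma weight_down (S Q : V -> Prop) : subspace S -> (forall x, S x -> S (W x)) -> subspace Q ->
  (forall lam, (forall x, S x -> ev (lam + 2) x -> Q x) -> forall x, S x -> ev lam x -> Q x) ->
  forall x, S x -> Q x.
Proof.
move=> SS SW QS step x Sx.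
have P3 y : S y -> ev 3 y -> Q y by move=> _ /ev3->; exact: QS.1.
have P4 y : S y -> ev 4 y -> Q y by move=> _ /ev4->; exact: QS.1.
have P1 : forall y, S y -> ev 1 y -> Q y.
  by apply: step; rewrite (_ : 1 + 2 = 3) //; ring.
have P2 : forall y, S y -> ev 2 y -> Q y.
  by apply: step; rewrite (_ : 2 + 2 = 4) //; ring.
have P0 : forall y, S y -> ev 0 y -> Q y.
  by apply: step; rewrite (_ : 0 + 2 = 2) //; ring.
have Pm1 : forall y, S y -> ev (-1) y -> Q y.
  by apply: step; rewrite (_ : -1 + 2 = 1) //; ring.
have Pm2 : forall y, S y -> ev (-2) y -> Q y.
  by apply: step; rewrite (_ : -2 + 2 = 0) //; ring.
apply: (eigen_ind co_lin co_sep uniq_rs SS SW QS _ Sx (W_ann x)) => r y.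
by rewrite !inE => /orP[/eqP->|/orP[/eqP->|/orP[/eqP->|/orP[/eqP->|/eqP->]]]]; auto.
Qed.

Lemma nxpv m : (s || (1 < m))%N -> (0 < m)%N -> (0 < nx m)%N /\ pv (nx m) = m.
Proof. by rewrite /nx /pv; case: (s) => //=; case: m => [|[|m]]. Qed.

(** One zigzag: D_2 kills D_1 x, so D_1 x = D_2 z with z of weight higher by 2 and again in the
    kernel of D_2 D_1. If z = D_1 z1 + D_2 z2, then D_1 kills x + D_2 z1, which is therefore in the
    image of D_1. The degree condition puts D_1 x in positive x-degree. *)
Lemma D_split m x : (0 < m)%N -> s || (1 < m)%N -> M m x -> D true (D false x) = 0 ->
  exists z1 z2, [/\ M (pv m) z1, M (pv m) z2 & x = D false z1 + D true z2].
Proof.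
move=> m0 sm Mx Dx; have [nm0 pnm] := nxpv sm m0.
pose S y := M m y /\ D true (D false y) = 0.
pose Q y := exists z1 z2, [/\ M (pv m) z1, M (pv m) z2 & y = D false z1 + D true z2].
apply: (@weight_down S Q) => //.
- split; first by split; [exact: (M_sub m).1 | rewrite (op0 (D false)) (op0 (D true))].
  move=> k y z [My Dy] [Mz Dz]; split; first exact: (M_sub m).2.
  by rewrite (opD (D false)) (opZ (D false)) /= (opD (D true)) (opZ (D true)) /= Dy Dz scaler0 addr0.
- move=> y [My Dy]; split; first exact: M_W.
  have -> : D true (D false (W y)) = W (D true (D false y)).
    by rewrite W_D W_D (opD (D true) (D false (W y))) (opZ (D true)) /=; coefs; rewrite /wt; ring.
  by rewrite Dy op0.
- split; first by exists 0, 0; rewrite !op0 addr0; split=> //; exact: (M_sub _).1.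
  move=> k _ _ [y1 [y2 [My1 My2 ->]]] [z1 [z2 [Mz1 Mz2 ->]]].
  exists (k *: y1 + z1), (k *: y2 + z2); split; try exact: (M_sub _).2.
  by rewrite (opD (D false)) (opZ (D false)) (opD (D true)) (opZ (D true)) /=; coefs; ring.
- move=> lam IH y [My Dy] Wy.
  have WDy : ev (lam + 1) (D false y).
    by rewrite /ev W_D Wy (opZ (D false)) /=; coefs; rewrite /wt; ring.
  have [z [Mz Wz Dz]] := D_exact_ev nm0 (M_D false My) WDy Dy.
  rewrite pnm in Mz.
  have Wz2 : ev (lam + 2) z by rewrite (_ : lam + 2 = lam + 1 - wt true) // /wt; ring.
  have Sz : S z by split => //; rewrite D_D Dz DD oppr0.
  have [z1 [z2 [Mz1 Mz2 Ez]]] := IH z Sz Wz2.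
  have Dyz : D false (y + D true z1) = 0.
    by rewrite (opD (D false)) /= -Dz Ez (opD (D true)) /= DD addr0 [D true _]D_D addNr.
  have [u [Mu Du]] := D_exact m0 (subD (M_sub m) My (M_D2 true m0 Mz1)) Dyz.
  exists u, (- z1); split => //; first by rewrite -scaleN1r; apply: subZ.
  by rewrite Du (opN (D true)) addrK.
Qed.

(** Writing x = D_2 y turns D_1 x = 0 into D_2 D_1 y = 0. Then [D_split] applies to y, and only the
    D_1-part of y survives under D_2. *)
Lemma D_cap m x : (0 < m)%N -> (~~ s || (1 < m)%N) -> M m x -> D false x = 0 -> D true x = 0 ->
  exists z, M (pv (pv m)) z /\ x = D true (D false z).
Proof.
move=> m0 sm Mx D1x D2x.
have [y [My Ey]] := D_exact m0 Mx D2x.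
have pm : (0 < pv m)%N && (s || (1 < pv m)%N).
  by move: sm; rewrite /pv; case: (s) => //=; case: (m) m0 => [|[|k]].
case/andP: pm => pm0 pm1; have Dy : D true (D false y) = 0 by rewrite D_D Ey D1x oppr0.
have [z1 [z2 [Mz1 Mz2 E]]] := D_split pm0 pm1 My Dy.
by exists z1; split => //; rewrite -Ey E (opD (D true)) /= DD addr0.
Qed.

(** Right multiplication by w_12 w_21 + w_11 w_22, the middle coefficient of the second-order map in
    d_y, whose outer coefficients are w_11 w_21 and w_12 w_22. *)
Definition G x : V := Rb (Rc x) + Rd (Ra x).
Lemma G_is_linear : linear G.
Proof. exact: (linearP ((Rb \o Rc) \+ (Rd \o Ra))). Qed.
HB.instance Definition _ := GRing.isLinear.Build K V V _ G G_is_linear.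

(** Oriented rules: they move [Ra] outward past the others, then [Rb], then [Rc], so composites
    reach a sorted form in which identities are linear. *)
Let R_sort x : (Rb (Ra x) = - Ra (Rb x)) * (Rc (Ra x) = - Ra (Rc x)) *
  (Rd (Ra x) = (-2) *: th x - Ra (Rd x)) * (Rc (Rb x) = 2 *: th x - Rb (Rc x)) *
  (Rd (Rb x) = - Rb (Rd x)) * (Rd (Rc x) = - Rc (Rd x)).
Proof. by do !split; rewrite R_R; coefs; rewrite /dual_sgn /=; ring. Qed.

Let RlinE := (lin_opE Ra, lin_opE Rb, lin_opE Rc, lin_opE Rd, lin_opE th).

Ltac R_normal := rewrite ?p_R ?RlinE; do ?[progress rewrite ?(R_sort, RR, R_th) ?RlinE];
  coefs; ring.

Lemma p_G j x : p j (G x) = G (p j x).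
Proof. by rewrite /G (opD (p j)) !p_R. Qed.

Let DE b x : D b x = R false b (p false x) + R true b (p true x).
Proof. by []. Qed.

Lemma D_true_D_false x : D true (D false x) =
  Rc (Ra (p false (p false x))) + (Rd (Ra (p false (p true x))) + Rc (Rb (p false (p true x))))
  + Rd (Rb (p true (p true x))).
Proof.
rewrite !DE !(opD (p _)) !p_R (p_p true false); R_normal.
Qed.

(** With the three identities that follow, these are the coefficients, by monomials in d_(y_1) and
    d_(y_2), of the statement that nabla kills the image of the second-order map in d_y. *)
Lemma D_true_RbRa x : D true (Rb (Ra x)) = - D false (G x).
Proof. rewrite !DE !p_G /G !p_R. R_normal. Qed.

Lemma D_true_G x : D true (G x) = - D false (Rd (Rc x)).
Proof. rewrite !DE !p_G /G !p_R. R_normal. Qed.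

Lemma D_true_RdRc x : D true (Rd (Rc x)) = 0.
Proof. rewrite !DE !p_R. R_normal. Qed.

Lemma D_false_RbRa x : D false (Rb (Ra x)) = 0.
Proof. rewrite !DE !p_R. R_normal. Qed.

(** Carrying w_11 w_21 across D_2 produces Theta D_1 x, which gives access to D_1 after cancelling
    Theta. *)
Lemma RbRa_D_true x : Rb (Ra (D true x)) = (-2) *: th (D false x) + D true (Rb (Ra x)).
Proof. rewrite !DE !p_R. R_normal. Qed.

(** A preceding factor w_ab makes the middle product fall into the multiples of the outer ones.
    Classes built on [G] thus see only the constant term of their argument. *)
Lemma G_R m a b x : M m x ->
  exists y z, [/\ M m y, M m z & G (R a b x) = Rb (Ra y) + Rd (Rc z)].
Proof.
move=> Mx; have M0 := (M_sub m).1; have MN y : M m y -> M m (- y).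
  by move=> My; rewrite -scaleN1r; apply: subZ.
case: a; case: b.
- exists 0, (- Rb x); split; [exact: M0 | by apply: MN; apply: M_R |].
  by rewrite /G; R_normal.
- exists (- Rd x), 0; split; [by apply: MN; apply: M_R | exact: M0 |].
  by rewrite /G; R_normal.
- exists 0, (- Ra x); split; [exact: M0 | by apply: MN; apply: M_R |].
  by rewrite /G; R_normal.
- exists (- Rc x), 0; split; [by apply: MN; apply: M_R | exact: M0 |].
  by rewrite /G; R_normal.
Qed.

Lemma M_G m x : M m x -> M m (G x).
Proof. by move=> Mx; rewrite /G; apply: subD => //; do 2!apply: M_R. Qed.
Opaque G.

(** Contraction inverts multiplication on its kernel, [R a b (io a b x) = x]. Using this for both
    factors and anticommuting once gives the witness. *)
Lemma ker_R2 m a b c d x : (a, b) != (c, d) -> M m x -> R a b x = 0 -> R c d x = 0 ->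
  exists y, M m y /\ x = R c d (R a b y).
Proof.
move=> ne Mx x1 x2; exists (- io c d (io a b x)); split.
  by rewrite -scaleN1r; apply: subZ => //; do 2!apply: M_io.
have E a' b' : R a' b' x = 0 -> R a' b' (io a' b' x) = x.
  by move=> x0; have := io_R a' b' a' b' x; rewrite x0 op0 !eqxx scale1r => /esym/eqP;
    rewrite subr_eq0 => /eqP.
have := io_R c d a b (io a b x); rewrite (E a b x1) => E2.
move: ne E2; rewrite xpair_eqE [c == a]eq_sym [d == b]eq_sym => /negbTE->.
by rewrite scale0r sub0r => E2; rewrite -[LHS](E c d x2) E2 (opN (R a b)).
Qed.

(** Here [D b x] is a linear form in two independent variables, and the derivatives [q] read off its
    coefficients. *)
Lemma D_inj0 b x : s -> M 0 x -> D b x = 0 -> R false b x = 0 /\ R true b x = 0.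
Proof.
move=> ss Mx Dx.
have E j : q j (D b x) = R j b x.
  have qp k : q j (p k x) = (j == k)%:R *: x.
    have := p_q k j x; rewrite (M0_q ss) // op0 => /esym/eqP.
    rewrite addr_eq0 /eps ss mulrN1 scaleNr opprK => /eqP->.
    by rewrite eq_sym.
  rewrite DE (opD (q j)) !q_R !qp !(opZ (R _ _)).
  by case: (j) => /=; coefs; ring.
by split; rewrite -E Dx op0.
Qed.

(** Substitute for [D_split] in x-degree 0, where no lower degree can map in. The zigzag is the
    same, but each round closes with an element killed by w_11 and w_21, hence with a multiple of
    w_11 w_21. *)
Lemma D_split0 x : s -> M 0 x -> D true (D false x) = 0 ->
  exists y z u, [/\ M 0 y, M 0 z, M 0 u & x = Rb (Ra y) + G z + Rd (Rc u)].
Proof.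
move=> ss Mx Dx; have M0 := (M_sub 0).1; have n1 : nx 0 = 1%N by rewrite /nx ss.
have pv1 : pv 1 = 0%N by rewrite /pv ss.
pose S y := M 0 y /\ D true (D false y) = 0.
pose Q y := exists y1 y2 y3, [/\ M 0 y1, M 0 y2, M 0 y3 & y = Rb (Ra y1) + G y2 + Rd (Rc y3)].
apply: (@weight_down S Q) => //.
- split; first by split; [exact: M0 | rewrite (op0 (D false)) (op0 (D true))].
  move=> k y z [My Dy] [Mz Dz]; split; first exact: (M_sub _).2.
  by rewrite (opD (D false)) (opZ (D false)) /= (opD (D true)) (opZ (D true)) /= Dy Dz scaler0 addr0.
- move=> y [My Dy]; split; first exact: M_W.
  have -> : D true (D false (W y)) = W (D true (D false y)).
    by rewrite W_D W_D (opD (D true) (D false (W y))) (opZ (D true)) /=; coefs; rewrite /wt; ring.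
  by rewrite Dy op0.
- split; first by exists 0, 0, 0; split=> //; rewrite !op0 !addr0.
  move=> k _ _ [y1 [y2 [y3 [My1 My2 My3 ->]]]] [z1 [z2 [z3 [Mz1 Mz2 Mz3 ->]]]].
  exists (k *: y1 + z1), (k *: y2 + z2), (k *: y3 + z3); split; try exact: (M_sub _).2.
  by rewrite (opD G) (opZ G) !RlinE /=; coefs; ring.
- move=> lam IH y [My Dy] Wy.
  have WDy : ev (lam + 1) (D false y).
    by rewrite /ev W_D Wy (opZ (D false)) /=; coefs; rewrite /wt; ring.
  have MDy : M 1 (D false y) by rewrite -n1; apply: M_D.
  have [z [Mz Wz Dz]] := D_exact_ev (isT : (0 < 1)%N) MDy WDy Dy.
  rewrite pv1 in Mz.
  have Wz2 : ev (lam + 2) z by rewrite (_ : lam + 2 = lam + 1 - wt true) // /wt; ring.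
  have Sz : S z by split => //; rewrite D_D Dz DD oppr0.
  have [z1 [z2 [z3 [Mz1 Mz2 Mz3 Ez]]]] := IH z Sz Wz2.
  have Dyz : D false (y + (G z1 + Rd (Rc z2))) = 0.
    rewrite (opD (D false)) /= -Dz Ez (opD (D true) (Rb (Ra z1) + G z2)) /=.
    rewrite (opD (D true) (Rb (Ra z1))) /= D_true_RdRc addr0.
    by rewrite D_true_RbRa D_true_G (opD (D false) (G z1)) /=; coefs; ring.
  have Mw : M 0 (y + (G z1 + Rd (Rc z2))).
    apply: subD => //; apply: subD => //; first exact: M_G.
    by do 2!apply: M_R.
  have [wa wb] := D_inj0 ss Mw Dyz.
  have [v [Mv Ev]] := ker_R2 (isT : (false, false) != (true, false)) Mw wa wb.
  exists v, (- z1), (- z2); split=> //; try by rewrite -scaleN1r; apply: subZ.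
  by rewrite -Ev (opN G) /= !(opN (R _ _)) -addrA -opprD addrK.
Qed.

Lemma D_cap1 x : s -> M 1 x -> D false x = 0 -> D true x = 0 ->
  exists y z, [/\ M 0 y, M 0 z & x = D true (Rb (Ra y)) + D true (G z)].
Proof.
move=> ss Mx D1x D2x.
have [y [My Ey]] := D_exact (isT : (0 < 1)%N) Mx D2x.
rewrite /pv ss /= in My.
have Dy : D true (D false y) = 0 by rewrite D_D Ey D1x oppr0.
have [y1 [y2 [y3 [M1 M2 _ E]]]] := D_split0 ss My Dy.
exists y1, y2; split=> //.
by rewrite -Ey E (opD (D true) (_ + G y2)) /= D_true_RdRc addr0 (opD (D true) (Rb (Ra y1))).
Qed.

(** Subtracting the contribution of u reduces to x2 = 0 and x1 = D_1 v with D_2 D_1 v = 0. In the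
    decomposition of v, the part in w_11 w_21 dies under D_1, and the part in w_12 w_22 is absorbed
    into u because D_2 kills it. What remains is the obstruction [G z]. *)
Lemma D_pair1 x1 x2 : s -> M 1 x1 -> M 1 x2 ->
    D false x1 = 0 -> D true x2 = 0 -> D false x2 + D true x1 = 0 ->
  exists u z, [/\ M 0 u, M 0 z, x1 = D false u + D false (G z) & x2 = D true u].
Proof.
move=> ss M1 M2 E1 E2 E12.
have [u [Mu Eu]] := D_exact (isT : (0 < 1)%N) M2 E2.
rewrite /pv ss /= in Mu.
have MDu : M 1 (D false u) by have := M_D false Mu; rewrite /nx ss.
have F1 : D false (x1 - D false u) = 0 by rewrite (opB (D false)) /= DD E1 subr0.
have F2 : D true (x1 - D false u) = 0.
  by rewrite (opB (D true)) /= D_D Eu opprK addrC.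
have [v [Mv Ev]] := D_exact (isT : (0 < 1)%N) (subB (M_sub 1) M1 MDu) F1.
rewrite /pv ss /= in Mv; rewrite -Ev in F2.
have [y1 [y2 [y3 [N1 N2 N3 E]]]] := D_split0 ss Mv F2.
exists (u + Rd (Rc y3)), y2; split=> //.
- by apply: subD => //; do 2!apply: M_R.
- rewrite -[x1](subrK (D false u)) -Ev E (opD (D false) (_ + G y2)) /=.
  rewrite (opD (D false) (Rb (Ra y1))) (opD (D false) u) /= D_false_RbRa.
  by coefs; ring.
- by rewrite (opD (D true)) /= D_true_RdRc addr0.
Qed.

Lemma D_false_G_R m a b x : M m x ->
  exists v, [/\ M m v, D true v = 0 & D false (G (R a b x)) = D false v].
Proof.
move=> Mx; have [y [z [My Mz ->]]] := G_R a b Mx; exists (Rd (Rc z)).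
split; [by do 2!apply: M_R | exact: D_true_RdRc |].
by rewrite (opD (D false)) /= D_false_RbRa add0r.
Qed.

(* The preimage is found one x-degree higher: X below satisfies p false X = x. *)
Lemma D_split1 x : ~~ s -> M 1 x ->
    let v := Rc (Ra (p false x)) + Rc (Rb (p true x)) + Rd (Ra (p true x)) in
    Rb v = 0 -> Rd v = 0 ->
  exists z1 z2, [/\ M 2 z1, M 2 z2 & x = D false z1 + D true z2].
Proof.
move=> ns Mx v vb vd.
have nxE m : nx m.+1 = m by rewrite /nx (negbTE ns).
have pvE m : pv m = m.+1 by rewrite /pv (negbTE ns).
have Mp j : M 0 (p j x) by rewrite -(nxE 0%N); apply: M_p.
have Mv : M 0 v by rewrite /v; do !(apply: subD => //); do 2!apply: M_R.
have [u [Mu Eu]] := ker_R2 (isT : (true, false) != (true, true)) Mv vb vd.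
have Mq m j y : M m y -> M m.+1 (q j y) by move=> My; rewrite -pvE; apply: M_q.
(* The condition [p false X = x] leaves free only the coefficient of the square of the second
   variable; the value - u / 2 makes [D true (D false X)] equal to [v - Rd (Rb u) = 0]. *)
pose X := 2^-1 *: q false (q false (p false x)) + q false (q true (p true x))
          - 2^-1 *: q true (q true u).
have MX : M 2 X.
  have MZ k y : M 2 y -> M 2 (k *: y) by move=> ?; apply: subZ.
  apply: (subB (M_sub 2)); first apply: (subD (M_sub 2)).
  - by apply: MZ; apply: (Mq 1%N); apply: (Mq 0%N).
  - by apply: (Mq 1%N); apply: (Mq 0%N).
  - by apply: MZ; apply: (Mq 1%N); apply: (Mq 0%N).
have p0 j y : M 0 y -> p j y = 0 by move=> My; apply: M0_p.
have epsE : eps = 1 by rewrite /eps (negbTE ns).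
have pX : (p false X = x) /\ (p true X = q false (p true x) - q true u).
  have Ex : x = q false (p false x) + q true (p true x).
    by rewrite (M_eul Mx) /eul (negbTE ns) scale1r.
  rewrite /X !(opB (p _)) !(opD (p _)) !(opZ (p _)) !p_q !(opD (q _)) !(opZ (q _)).
  rewrite !(p0 _ _ (Mp _)) !(p0 _ _ Mu) !(op0 (q _)) epsE [in RHS]Ex.
  by split=> /=; coefs; field.
have DX : D true (D false X) = 0.
  rewrite !DE !pX.1 !pX.2.
  rewrite !(opD (p _)) !p_R !(opB (p _)) !p_q.
  rewrite !(p0 _ _ (Mp _)) !(p0 _ _ Mu) !(op0 (q _)) epsE /=.
  transitivity (v - Rd (Rb u)); first by rewrite /v !RlinE; coefs; ring.
  by rewrite -Eu subrr.
have s2 : s || (1 < 2)%N by rewrite orbT.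
have [z1 [z2 [Mz1 Mz2 E]]] := D_split (isT : (0 < 2)%N) s2 MX DX.
rewrite pvE in Mz1 Mz2.
exists (p false z1), (p false z2); split.
- by rewrite -(nxE 2%N); apply: M_p.
- by rewrite -(nxE 2%N); apply: M_p.
- by rewrite -pX.1 E (opD (p false)) !DE !(opD (p false)) !p_R !(p_p false).
Qed.

(** Here D_1 x1 lies in degree 0, out of reach of [D_split], so the relation is split by weight: the
    part of x1 of weight r is paired with a part of x2 of weight r - 2. For r = -2 and r = -1 the
    partner is zero. For r = 2, D_1 x1 has weight 3 and vanishes. For r = 0 the partner is in the
    image of D_2 and can be moved over to x1. For r = 1, multiplication by w_11 w_21 leaves Theta
    D_1 x1 = 0. *)
Lemma D_pair_split x1 x2 : ~~ s -> M 1 x1 -> M 1 x2 -> D true x1 + D false x2 = 0 ->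
  exists z1 z2, [/\ M 2 z1, M 2 z2 & x1 = D false z1 + D true z2].
Proof.
move=> ns M1 M2 E12; have pvE m : pv m = m.+1 by rewrite /pv (negbTE ns).
have MN m y : M m y -> M m (- y) by move=> My; rewrite -scaleN1r; apply: subZ.
have M00 m : M m 0 := (M_sub m).1.
pose S y := M 1 y /\ exists y', M 1 y' /\ D true y + D false y' = 0.
pose Q y := exists z1 z2, [/\ M 2 z1, M 2 z2 & y = D false z1 + D true z2].
have SS : subspace S.
  split; first by split=> //; exists 0; split=> //; rewrite (op0 (D true)) (op0 (D false)) addr0.
  move=> k y z [My [y' [My' Ey]]] [Mz [z' [Mz' Ez]]]; split; first exact: (M_sub 1).2.
  exists (k *: y' + z'); split; first exact: (M_sub 1).2.
  rewrite (opD (D true)) (opZ (D true)) (opD (D false)) (opZ (D false)) /= addrACA -scalerDr.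
  by rewrite Ey Ez scaler0 addr0.
have SW y : S y -> S (W y).
  move=> [My [y' [My' Ey]]]; split; first exact: M_W.
  exists (W y' + 2 *: y'); split; first by apply: subD => //; [exact: M_W | exact: subZ].
  have -> : D true (W y) + D false (W y' + 2 *: y') =
    W (D true y + D false y') + (D true y + D false y').
    rewrite (opD W) !W_D (opD (D false) (W y')) (opZ (D false)) /=.
    by coefs; rewrite /wt; ring.
  by rewrite Ey op0 addr0.
have QS : subspace Q.
  split; first by exists 0, 0; split=> //; rewrite (op0 (D true)) (op0 (D false)) addr0.
  move=> k _ _ [y1 [y2 [My1 My2 ->]]] [z1 [z2 [Mz1 Mz2 ->]]].
  exists (k *: y1 + z1), (k *: y2 + z2); split; try exact: (M_sub _).2.
  by rewrite (opD (D false)) (opZ (D false)) (opD (D true)) (opZ (D true)) /=; coefs; ring.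
have pick lam y : S y -> ev lam y ->
  exists y', [/\ M 1 y', ev (lam - 2) y' & D true y + D false y' = 0].
  move=> [My [y' [My' Ey]]] Wy.
  have Ey' : D false y' = - D true y by apply/eqP; rewrite -addr_eq0 addrC Ey.
  pose S1 v := M 1 v /\ ev (lam - 1) (D false v).
  pose Q1 v := exists v', [/\ M 1 v', ev (lam - 2) v' & D false v' = D false v].
  have SS1 : subspace S1.
    split; first by split=> //; rewrite (op0 (D false)); exact: (ev_sub _).1.
    move=> k u v [Mu Wu] [Mv Wv]; split; first exact: (M_sub 1).2.
    by rewrite (opD (D false)) (opZ (D false)) /=; apply: (ev_sub _).2.
  have SW1 v : S1 v -> S1 (W v).
    move=> [Mv Wv]; split; first exact: M_W.
    have -> : D false (W v) = (lam - 2) *: D false v.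
      have -> : D false (W v) = W (D false v) - D false v.
        by rewrite W_D; coefs; rewrite /wt; ring.
      by rewrite Wv; coefs; ring.
    by apply: subZ => //; apply: ev_sub.
  have QS1 : subspace Q1.
    split; first by exists 0; split=> //; exact: (ev_sub _).1.
    move=> k u v [u' [Mu Wu Eu]] [v' [Mv Wv Ev]]; exists (k *: u' + v').
    split; [exact: (M_sub 1).2 | exact: (ev_sub _).2 |].
    by rewrite !(opD (D false)) !(opZ (D false)) /= Eu Ev.
  have Qy : Q1 y'.
    apply: (@eigen_ind _ _ _ _ co_lin co_sep W _ S1 Q1 uniq_rs SS1 SW1 QS1 _ y') => //.
      move=> r v _ [Mv Wv] rv.
      have [lr|lr] := eqVneq r (lam - 2); first by exists v; split=> //; rewrite /ev rv lr.
      exists 0; split=> //; first exact: (ev_sub _).1.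
      rewrite (op0 (D false)); apply/esym/eqP.
      have : ((lam - 2) - r) *: D false v = 0.
        have := W_D false v; rewrite Wv rv (opZ (D false)) /= => /eqP.
        by rewrite -subr_eq0 => /eqP <-; coefs; rewrite /wt; ring.
      by move/eqP; rewrite scaler_eq0 subr_eq0 eq_sym (negbTE lr).
    split=> //; rewrite Ey' -scaleN1r; apply: subZ; first exact: ev_sub.
    by rewrite /ev W_D Wy (opZ (D true)) /=; coefs; rewrite /wt; ring.
  by have [v' [Mv Wv Ev]] := Qy; exists v'; split=> //; rewrite Ev Ey' addrN.
have Dt0 y : S y -> D true y = 0 -> Q y.
  move=> [My _] Dy; have [z [Mz Dz]] := D_exact (isT : (0 < 1)%N) My Dy.
  rewrite pvE in Mz; exists 0, z; split=> //.
  by rewrite (op0 (D false)) add0r.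
have Df0 y : S y -> D false y = 0 -> Q y.
  move=> [My _] Dy; have [z [Mz Dz]] := D_exact (isT : (0 < 1)%N) My Dy.
  rewrite pvE in Mz; exists z, 0; split=> //.
  by rewrite (op0 (D true)) addr0.
have Sx1 : S x1 by split=> //; exists x2.
apply: (@eigen_ind _ _ _ _ co_lin co_sep W _ S Q uniq_rs SS SW QS _ x1) => // r y rP Sy Wy.
have [y' [My' Wy' Ey]] := pick r y Sy Wy.
move: rP; rewrite !inE.
case/orP => [/eqP r2|/orP[/eqP r2|/orP[/eqP r2|/orP[/eqP r2|/eqP r2]]]]; rewrite {}r2 in Wy Wy'.
- apply: Dt0 => //; rewrite -Ey (@evN4 y') ?(op0 (D false)) ?addr0 //.
  by move: Wy'; rewrite (_ : -2 - 2 = -4) //; ring.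
- apply: Dt0 => //; rewrite -Ey (@evN3 y') ?(op0 (D false)) ?addr0 //.
  by move: Wy'; rewrite (_ : -1 - 2 = -3) //; ring.
- have Dy' : D true y' = 0.
    apply: evN3; rewrite /ev W_D Wy' (opZ (D true)) /=; coefs; rewrite /wt; ring.
  have [z [Mz Dz]] := D_exact (isT : (0 < 1)%N) My' Dy'.
  rewrite pvE in Mz.
  have E : D true (y - D false z) = 0.
    by rewrite (opB (D true)) /= [D true (D false z)]D_D Dz opprK Ey.
  have MDz : M 1 (D false z) by have := M_D false Mz; rewrite /nx (negbTE ns).
  have [u [Mu Du]] := D_exact (isT : (0 < 1)%N) (subB (M_sub 1) Sy.1 MDz) E.
  rewrite pvE in Mu; exists z, u; split=> //.
  by rewrite Du addrC subrK.
- apply: Df0 => //; apply: th_inj.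
  have /eqP := congr1 (fun v => Rb (Ra v)) Ey.
  rewrite (opD Ra (D true y)) (opD Rb (Ra (D true y))) /= RbRa_D_true.
  have -> : Rb (Ra (D false y')) = 0 by rewrite !DE; R_normal.
  have -> : Rb (Ra y) = 0.
    by apply: ev3; rewrite /ev !W_R Wy (opZ Ra) !(opD Rb) !(opZ Rb); coefs; rewrite /wt; ring.
  rewrite (op0 (D true)) !(op0 (R _ _)) !addr0 scaler_eq0 oppr_eq0 pnatr_eq0 /=.
  by move/eqP.
- apply: Df0 => //; apply: ev3.
  by rewrite /ev W_D Wy (opZ (D false)) /=; coefs; rewrite /wt; ring.
Qed.

(** There is one more unknown than equations. The first equation fixes two unknowns, and every later
    one determines the next unknown by exactness of D_1. *)
Lemma chain_lower m N (y : nat -> V) : (0 < m)%N ->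
    (forall i, (i <= N)%N -> M m (y i)) ->
    (exists u v, [/\ M (pv m) u, M (pv m) v & y 0 = D false u + D true v]) ->
    (forall i, (i < N)%N -> D false (y i.+1) + D true (y i) = 0) ->
  exists z : nat -> V, (forall i, M (pv m) (z i)) /\
    forall i, (i <= N)%N -> y i = D false (z i.+1) + D true (z i).
Proof.
move=> m0 My [u [v [Mu Mv E0]]] Dy.
suff: forall k, (k <= N)%N -> exists z : nat -> V, (forall i, M (pv m) (z i)) /\
    forall i, (i <= k)%N -> y i = D false (z i.+1) + D true (z i) by move=> /(_ N); apply.
elim=> [|k IH] kN.
  exists (fun i => if i is 0 then v else u); split; first by case.
  by case.
have [z [Mz Ez]] := IH (ltnW kN).
have Dk : D false (y k.+1 - D true (z k.+1)) = 0.
  rewrite (opB (D false)) /= D_D opprK -[RHS](Dy k kN) (Ez k (leqnn k)).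
  by rewrite (opD (D true) (D false (z k.+1))) /= DD addr0.
have MD : M m (D true (z k.+1)) by apply: M_D2.
have [w [Mw Dw]] := D_exact m0 (subB (M_sub m) (My _ kN) MD) Dk.
exists (fun i => if i == k.+2 then w else z i); split=> [i|i]; first by case: eqP.
rewrite leq_eqVlt => /orP[/eqP->|ik].
  by rewrite eqxx ltn_eqF // Dw subrK.
by rewrite !ltn_eqF ?ltnS //; [exact: Ez | exact: ltnW].
Qed.

(** Now there is one more equation than unknowns. Exactness of D_2 produces a surplus unknown, and a
    correction at the end of the chain removes it. *)
Lemma chain_upper m N (y : nat -> V) : (0 < m)%N -> ~~ s || (1 < m)%N ->
    (forall i, (i <= N.+1)%N -> M m (y i)) -> D true (y 0) = 0 ->
    (forall i, (i <= N)%N -> D false (y i) + D true (y i.+1) = 0) -> D false (y N.+1) = 0 ->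
  exists z : nat -> V, [/\ forall i, M (pv m) (z i), y 0 = D true (z 0),
    forall i, (i < N)%N -> y i.+1 = D false (z i) + D true (z i.+1) &
    y N.+1 = D false (z N)].
Proof.
move=> m0 sm My D0 Dy DN.
have : forall k, (k <= N.+1)%N -> exists z : nat -> V, [/\ forall i, M (pv m) (z i),
    y 0 = D true (z 0) & forall i, (i < k)%N -> y i.+1 = D false (z i) + D true (z i.+1)].
  elim=> [|k IH] kN.
    have [z [Mz Ez]] := D_exact m0 (My 0%N kN) D0.
    by exists (fun=> z); split.
  have [z [Mz Ez0 Ez]] := IH (ltnW kN).
  have Dk : D true (y k.+1 - D false (z k)) = 0.
    rewrite (opB (D true)) /= D_D opprK -[RHS](Dy k kN) addrC; congr (_ + _).
    case: k {kN IH} Ez => [|k] Ez; first by rewrite Ez0.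
    by rewrite (Ez k) // (opD (D false) (D false (z k))) /= DD add0r.
  have [w [Mw Dw]] := D_exact m0 (subB (M_sub m) (My _ kN) (M_D2 false m0 (Mz k))) Dk.
  exists (fun i => if i == k.+1 then w else z i); split=> [i| |i]; [by case: eqP | by [] |].
  rewrite ltnS leq_eqVlt => /orP[/eqP->|ik].
    by rewrite eqxx ltn_eqF // Dw addrC subrK.
  by rewrite !ltn_eqF ?ltnS //; [exact: Ez | exact: ltnW].
move=> /(_ N.+1 (leqnn _)) [z [Mz Ez0 Ez]].
have Dr : D false (D true (z N.+1)) = 0.
  by have := DN; rewrite (Ez N) // (opD (D false) (D false (z N))) /= DD add0r.
(* The surplus term D_2 z_(N+1) is killed by D_1 and D_2, hence equals D_2 D_1 u. Replacing z_N by
   z_N - D_2 u absorbs it without touching the earlier equations. *)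
have [u [Mu Eu]] := D_cap m0 sm (M_D2 true m0 (Mz N.+1)) Dr (DD _ _).
have Mv : M (pv m) (D true u).
  have := M_D true Mu; rewrite /nx /pv; move: sm.
  by case: (s) => /=; case: m m0 {My Mz Mu} => [|[|m]].
exists (fun i => if i == N then z N - D true u else z i); split.
- by move=> i; case: eqP => // _; apply: (subB (M_sub _)).
- by case: N {My Dy DN Ez Dr Eu} => [|N] //=; rewrite (opB (D true)) /= DD subr0.
- move=> i iN; rewrite (ltn_eqF iN) (Ez i (ltnW iN)); congr (_ + _).
  by case: eqP => // ->; rewrite (opB (D true)) /= DD subr0.
- by rewrite eqxx Ez // Eu (opB (D false)) /= [D true (D false u)]D_D.
Qed.

End Koszul.

(** * The operators on the modules M_X *)

Section RightMult.
Variables (K : numClosedFieldType) (V : lmodType K) (I : Type) (co : I -> V -> K).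
Hypothesis co_lin : forall d k x y, co d (k *: x + y) = k * co d x + co d y.
Hypothesis co_sep : forall x y, (forall d, co d x = co d y) -> x = y.
Local Ltac coefs := coefs_with co_lin co_sep.
Variables (th : {linear V -> V}) (u v u' v' : V).

(** Separates right multiplication by w_ab into its exterior part and its Theta-part; [u], [v] stand
    for the two creations and [u'], [v'] for the two annihilations. *)
Lemma rmul_terms a b : let t c y z := c *: (y - 2^-1 *: th z) in
  match a, b with
  | true, true => t 1 u u' + (t (- 'i) v v' + 0) =
      u - 'i *: v + -1 *: th (2^-1 *: (u' - 'i *: v'))
  | true, false => t 1 u u' + (t 'i v v' + 0) =
      u + 'i *: v + 1 *: th (2^-1 *: (- u' - 'i *: v'))
  | false, true => t (-1) u u' + (t 'i v v' + 0) =
      - u + 'i *: v + 1 *: th (2^-1 *: (u' - 'i *: v'))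
  | false, false => t 1 u u' + (t 'i v v' + 0) =
      u + 'i *: v + -1 *: th (2^-1 *: (u' + 'i *: v'))
  end.
Proof.
by case: a; case: b; rewrite /= (opZ th) (opD th) ?(opN th) (opZ th); coefs; ring.
Qed.
End RightMult.

(** * Realization on Theta-powers, Grassmann monomials and polynomial variables *)

Section Fock.
Variable K : numClosedFieldType.
Implicit Types (x y : vec K) (J : {set 'I_4}) (i : 'I_4).
Notation vec := (vec K).
Notation bv := (@bv K).

Definition coef (d : MB) (x : vec) : K := x@_d.
Lemma coef_lin d k x y : coef d (k *: x + y) = k * coef d x + coef d y.
Proof. by rewrite /coef mcoeffD mcoeffZ. Qed.
Lemma coef_sep x y : (forall d, coef d x = coef d y) -> x = y.
Proof. by move=> H; apply/malgP. Qed.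

Let cl := coef_lin.
Let cs := coef_sep.
Definition o0 : 'I_4 := inord 0.
Definition o1 : 'I_4 := inord 1.
Definition o2 : 'I_4 := inord 2.
Definition o3 : 'I_4 := inord 3.
Lemma o_uniq : uniq [:: o0; o1; o2; o3].
Proof.
rewrite -(map_inj_uniq val_inj) /= /o0 /o1 /o2 /o3 !inordK //.
Qed.

Definition crL : 'I_4 -> {linear vec -> vec} := fun i => @crea K i.
Definition anL : 'I_4 -> {linear vec -> vec} := fun i => @anni K i.
Definition thL : {linear vec -> vec} := @theta K.
Definition cAL : bool -> bool -> {linear vec -> vec} := fun a b => cA crL o0 o1 o2 o3 a b.
Definition ioL : bool -> bool -> {linear vec -> vec} := fun a b => io anL o0 o1 o2 o3 a b.
Definition RL : bool -> bool -> {linear vec -> vec} := fun a b => Rop thL cAL ioL a b.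
Definition WL : {linear vec -> vec} := weight cAL ioL.

Lemma cAL_cAL a b c d x : cAL a b (cAL c d x) = - cAL c d (cAL a b x).
Proof. by apply: (cA_cA cl cs); move=> *; apply: crea_crea. Qed.
Lemma ioL_ioL a b c d x : ioL a b (ioL c d x) = - ioL c d (ioL a b x).
Proof. by apply: (io_io cl cs); move=> *; apply: anni_anni. Qed.
Lemma ioL_cAL a b c d x :
  ioL a b (cAL c d x) = ((a == c) && (b == d))%:R *: x - cAL c d (ioL a b x).
Proof. by apply: (io_cA cl cs o_uniq); move=> *; apply: anni_crea. Qed.
Lemma cAL_th a b x : cAL a b (thL x) = thL (cAL a b x).
Proof. by apply: cA_comm => *; apply: theta_crea. Qed.
Lemma ioL_th a b x : ioL a b (thL x) = thL (ioL a b x).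
Proof. by apply: io_comm => *; apply: theta_anni. Qed.

Lemma RL_RL a b c d x : RL a b (RL c d x) =
  (((a == ~~ c) && (b == ~~ d))%:R * (dual_sgn K a b + dual_sgn K c d)) *: thL x - RL c d (RL a b x).
Proof. exact: (Rop_Rop cl cs cAL_cAL ioL_ioL ioL_cAL cAL_th ioL_th). Qed.
Lemma ioL_RL a b c d x :
  ioL a b (RL c d x) = ((a == c) && (b == d))%:R *: x - RL c d (ioL a b x).
Proof. exact: (io_Rop cl cs ioL_ioL ioL_cAL ioL_th). Qed.
Lemma RL_th a b x : RL a b (thL x) = thL (RL a b x).
Proof. exact: (Rop_th cAL_th ioL_th). Qed.
Lemma WL_RL a b x : WL (RL a b x) = RL a b (WL x) + wt K b *: RL a b x.
Proof. exact: (weight_Rop cl cs cAL_cAL ioL_ioL ioL_cAL cAL_th ioL_th). Qed.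
Lemma WL_ioL a b x : WL (ioL a b x) = ioL a b (WL x) - wt K b *: ioL a b x.
Proof. exact: (weight_io cl cs ioL_ioL ioL_cAL). Qed.
Lemma WL_ann x : annihilated WL [:: -2; -1; 0; 1; 2] x.
Proof. exact: (weight_annihilated cl cs cAL_cAL ioL_ioL ioL_cAL). Qed.

Lemma rmulwE a b x : rmulw (w K a b) x = RL a b x.
Proof.
rewrite /RL /= /Rop /= /cA /io /rmulw; case: a; case: b;
  rewrite /w !big_cons big_nil /= !rmulE -/o0 -/o1 -/o2 -/o3 /dual_sgn /=;
  rewrite /crL /anL /thL /=.
- exact: (rmul_terms cl cs thL (crea o1 x) (crea o0 x) (anni o1 x) (anni o0 x) true true).
- exact: (rmul_terms cl cs thL (crea o3 x) (crea o2 x) (anni o3 x) (anni o2 x) true false).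
- exact: (rmul_terms cl cs thL (crea o3 x) (crea o2 x) (anni o3 x) (anni o2 x) false true).
- exact: (rmul_terms cl cs thL (crea o1 x) (crea o0 x) (anni o1 x) (anni o0 x) false false).
Qed.

Definition degm (m n : nat) x : Prop := forall b : MB, x@_b != 0 ->
  let: (_, _, (a1, a2, b1, b2)) := b in (a1 + a2 = m)%N /\ (b1 + b2 = n)%N.

Lemma degm_sub m n : subspace (degm m n).
Proof.
split; first by move=> b; rewrite mcoeff0 eqxx.
move=> k x y Mx My b; rewrite mcoeffD mcoeffZ => nz.
have [x0|/Mx//] := eqVneq x@_b 0; have [y0|/My//] := eqVneq y@_b 0.
by rewrite x0 y0 mulr0 addr0 eqxx in nz.
Qed.

Lemma degm_sum m n (J : Type) (r : seq J) (P : pred J) (F : J -> vec) :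
  (forall j, P j -> degm m n (F j)) -> degm m n (\sum_(j <- r | P j) F j).
Proof.
move=> H; elim/big_ind: _ => //; first exact: (degm_sub m n).1.
by move=> u v Mu Mv; exact: (subD (degm_sub m n) Mu Mv).
Qed.

Lemma degm_bv m n k J (a1 a2 b1 b2 : nat) : (a1 + a2 = m)%N -> (b1 + b2 = n)%N ->
  degm m n (bv (k, J, (a1, a2, b1, b2))).
Proof.
move=> Em En b; rewrite coef_bv; case: (eqVneq (k, J, (a1, a2, b1, b2)) b) => [<-//|_] /=.
by rewrite eqxx.
Qed.

Lemma degm_lext m n m' n' (f : MB -> vec) x :
  (forall k J (a1 a2 b1 b2 : nat), (a1 + a2 = m)%N -> (b1 + b2 = n)%N ->
     degm m' n' (f (k, J, (a1, a2, b1, b2)))) ->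
  degm m n x -> degm m' n' (lext f x).
Proof.
move=> H Mx; rewrite /lext big_seq; apply: degm_sum => b bx.
apply: (subZ _ (degm_sub m' n')).
have := Mx b; rewrite mcoeff_neq0 bx; case: b bx => -[k J] [[[a1 a2] b1] b2] _ /(_ isT) [].
exact: H.
Qed.

Lemma lin_ext_on (f g : {linear vec -> vec}) x :
  (forall b, x@_b != 0 -> f (bv b) = g (bv b)) -> f x = g x.
Proof.
move=> fg; rewrite (vecE x) !linear_sum !big_seq; apply: eq_bigr => b bx.
by rewrite !linearZ /= fg // mcoeff_neq0.
Qed.

Lemma degm_opU m n c s x : degm m n x -> degm m n (opU c s x).
Proof.
apply: degm_lext => k J a1 a2 b1 b2 Em En /=.
by apply: (subZ _ (degm_sub m n)); case: (s _) => ? ?; apply: degm_bv.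
Qed.

Lemma degm_ioL m n a b x : degm m n x -> degm m n (ioL a b x).
Proof.
have SS := degm_sub m n; have A i : degm m n x -> degm m n (anL i x) by apply: degm_opU.
move=> Mx; rewrite /ioL /= /io; apply: (subZ _ SS).
have Z i : degm m n ('i *: anL i x) := subZ _ SS (A i Mx).
case: a; case: b.
- exact: (subD SS (A o1 Mx) (Z o0)).
- exact: (subB SS (A o3 Mx) (Z o2)).
- exact: (subB SS (subN SS (A o3 Mx)) (Z o2)).
- exact: (subB SS (A o1 Mx) (Z o0)).
Qed.
Lemma degm_cAL m n a b x : degm m n x -> degm m n (cAL a b x).
Proof.
have SS := degm_sub m n; have A i : degm m n x -> degm m n (crL i x) by apply: degm_opU.
move=> Mx; rewrite /cAL /= /cA.
have Z i : degm m n ('i *: crL i x) := subZ _ SS (A i Mx).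
case: a; case: b.
- exact: (subB SS (A o1 Mx) (Z o0)).
- exact: (subD SS (A o3 Mx) (Z o2)).
- exact: (subD SS (subN SS (A o3 Mx)) (Z o2)).
- exact: (subD SS (A o1 Mx) (Z o0)).
Qed.
Lemma degm_thL m n x : degm m n x -> degm m n (thL x).
Proof. exact: degm_opU. Qed.
Lemma degm_RL m n a b x : degm m n x -> degm m n (RL a b x).
Proof.
move=> Mx; rewrite /RL /= /Rop; apply: (subD (degm_sub m n)); first exact: degm_cAL.
by apply: (subZ _ (degm_sub m n)); apply: degm_thL; apply: degm_ioL.
Qed.
Lemma degm_WL m n x : degm m n x -> degm m n (WL x).
Proof.
have SS := degm_sub m n; move=> Mx; rewrite /WL /= /weight /num.
have A a b : degm m n (cAL a b (ioL a b x)) by apply: degm_cAL; apply: degm_ioL.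
exact: (subB SS (subB SS (subD SS (A false false) (A true false)) (A false true)) (A true true)).
Qed.

Lemma crL_opE i c s x : crL i (opE c s x) = opE c s (crL i x).
Proof. exact: opUE. Qed.
Lemma anL_opE i c s x : anL i (opE c s x) = opE c s (anL i x).
Proof. exact: opUE. Qed.
Lemma thL_opE c s x : thL (opE c s x) = opE c s (thL x).
Proof. exact: opUE. Qed.
Definition opEL c s : {linear vec -> vec} := opE c s.
Lemma cAL_opE a b c s x : cAL a b (opEL c s x) = opEL c s (cAL a b x).
Proof. by apply: cA_comm => *; apply: crL_opE. Qed.
Lemma ioL_opE a b c s x : ioL a b (opEL c s x) = opEL c s (ioL a b x).
Proof. by apply: io_comm => *; apply: anL_opE. Qed.
Lemma RL_opE a b c s x : RL a b (opEL c s x) = opEL c s (RL a b x).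
Proof.
by apply: Rop_comm => *; [apply: cAL_opE | apply: ioL_opE | apply: thL_opE].
Qed.
Lemma WL_opE c s x : WL (opEL c s x) = opEL c s (WL x).
Proof. by apply: weight_comm => *; [apply: cAL_opE | apply: ioL_opE]. Qed.

Lemma opE_comp (c c' : mon -> K) s s' x : opEL c s (opEL c' s' x) = opEL (fun e => c' e * c (s' e)) (s \o s') x.
Proof.
apply: (@lin_ext _ (opEL c s \o opEL c' s') (opEL (fun e => c' e * c (s' e)) (s \o s'))) => b.
by rewrite /= !opE_bv linearZ /= opE_bv scalerA.
Qed.

Lemma degm_opE m n m' n' c s x :
  (forall a1 a2 b1 b2, (a1 + a2 = m)%N -> (b1 + b2 = n)%N ->
     c (a1, a2, b1, b2) = 0 \/
     let: (a1', a2', b1', b2') := s (a1, a2, b1, b2) in (a1' + a2' = m')%N /\ (b1' + b2' = n')%N) ->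
  degm m n x -> degm m' n' (opEL c s x).
Proof.
move=> H; apply: degm_lext => k J a1 a2 b1 b2 Em En /=.
have [->|] := H _ _ _ _ Em En; first by rewrite scale0r; exact: (degm_sub m' n').1.
by case: (s _) => -[[? ?] ?] ? [? ?]; apply: (subZ _ (degm_sub m' n')); apply: degm_bv.
Qed.

Definition pX (j : bool) : {linear vec -> vec} :=
  opEL (fun '(a1, a2, b1, b2) => (if j then a2 else a1)%:R)
       (fun '(a1, a2, b1, b2) => if j then (a1, a2.-1, b1, b2) else (a1.-1, a2, b1, b2)).
Definition mX (j : bool) : {linear vec -> vec} :=
  opEL (fun=> 1) (fun '(a1, a2, b1, b2) => if j then (a1, a2.+1, b1, b2) else (a1.+1, a2, b1, b2)).
Definition pY (j : bool) : {linear vec -> vec} :=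
  opEL (fun '(a1, a2, b1, b2) => (if j then b2 else b1)%:R)
       (fun '(a1, a2, b1, b2) => if j then (a1, a2, b1, b2.-1) else (a1, a2, b1.-1, b2)).
Definition mY (j : bool) : {linear vec -> vec} :=
  opEL (fun=> 1) (fun '(a1, a2, b1, b2) => if j then (a1, a2, b1, b2.+1) else (a1, a2, b1.+1, b2)).

Lemma dXE X j x : dX X j x = (if sx X then mX j else pX j) x.
Proof.
apply: (@lin_ext _ (dX X j) (if sx X then mX j else pX j)) => -[[k J] [[[a1 a2] b1] b2]].
by rewrite [LHS]lext_bv /=; case: (sx X); rewrite /= opE_bv; case: (j); rewrite ?scale1r.
Qed.
Lemma dYE X j x : dY X j x = (if sy X then mY j else pY j) x.
Proof.
apply: (@lin_ext _ (dY X j) (if sy X then mY j else pY j)) => -[[k J] [[[a1 a2] b1] b2]].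
by rewrite [LHS]lext_bv /=; case: (sy X); rewrite /= opE_bv; case: (j); rewrite ?scale1r.
Qed.
End Fock.

Section Inst.
Variable K : numClosedFieldType.
Implicit Types (x y : vec K) (J : {set 'I_4}) (i : 'I_4).
Notation vec := (vec K).
Notation bv := (@bv K).
Notation pX := (@pX K).
Notation mX := (@mX K).
Notation pY := (@pY K).
Notation mY := (@mY K).
Notation opEL := (@opEL K).
Notation RL := (@RL K).

Definition px (s j : bool) : {linear vec -> vec} := if s then mX j else pX j.
Definition qx (s j : bool) : {linear vec -> vec} := if s then pX j else mX j.

Lemma opEL_bv c s k J e : opEL c s (bv (k, J, e)) = c e *: bv (k, J, s e).
Proof. exact: opE_bv. Qed.

Lemma opEL2_bv c s c' s' k J e :
  opEL c s (opEL c' s' (bv (k, J, e))) = (c' e * c (s' e)) *: bv (k, J, s (s' e)).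
Proof.
exact: etrans (congr1 (opEL c s) (opEL_bv c' s' k J e)) (etrans (opZ (opEL c s) _ _)
  (etrans (congr1 ( *:%R (c' e)) (opEL_bv c s k J (s' e))) (scalerA _ _ _))).
Qed.

(** The substitutions need to agree only where the coefficient is nonzero: a derivative at exponent
    0 has coefficient 0 but a meaningless truncated target. *)
Lemma eq_opE2 c s c' s' d t d' t' x :
  (forall a1 a2 b1 b2, let e := (a1, a2, b1, b2) in
    c' e * c (s' e) = d' e * d (t' e) /\ (s (s' e) = t (t' e) \/ c' e * c (s' e) = 0)) ->
  opEL c s (opEL c' s' x) = opEL d t (opEL d' t' x).
Proof.
move=> H; apply: (etrans (opE_comp c c' s s' x)).
apply: (etrans _ (esym (opE_comp d d' t t' x))).
apply: eq_bigr => -[[k J] [[[a1 a2] b1] b2]] _.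
have /= [E SZ] := H a1 a2 b1 b2.
apply: (congr1 (fun v => _ *: v)); rewrite -E.
case: SZ => [->|->]; first reflexivity.
exact: etrans (scale0r _) (esym (scale0r _)).
Qed.

Lemma px_px s j k x : px s j (px s k x) = px s k (px s j x).
Proof.
have [<-|jk] := eqVneq j k; first reflexivity.
have -> : k = ~~ j by move: jk; case: (j); case: (k).
rewrite /px; case: s; case: (j); apply: eq_opE2 => a1 a2 b1 b2 /=;
  by split; [ring | left].
Qed.

Lemma pX_mX j k x : pX j (mX k x) = mX k (pX j x) + (j == k)%:R *: x.
Proof.
have [<-|jk] := eqVneq j k; last first.
  have -> : k = ~~ j by move: jk; case: (j); case: (k).
  rewrite scale0r addr0; case: (j); apply: eq_opE2 => a1 a2 b1 b2 /=;
  by split; [ring | left].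
apply: (@lin_ext _ (pX j \o mX j) ((mX j \o pX j) \+ 1 \*: idfun)).
move=> [[n J] [[[a1 a2] b1] b2]] /=.
apply: (etrans (opEL2_bv _ _ _ _ n J (a1, a2, b1, b2))).
apply: (etrans _ (congr1 (fun v => v + _) (esym (opEL2_bv _ _ _ _ n J (a1, a2, b1, b2))))).
rewrite /= mul1r mulr1.
case: j => /=.
  case: a2 => [|a2] /=; first by rewrite [X in X + _]scale0r add0r.
  by rewrite -scalerDl -natr1.
case: a1 => [|a1] /=; first by rewrite [X in X + _]scale0r add0r.
by rewrite -scalerDl -natr1.
Qed.

Lemma px_qx s j k x :
  px s j (qx s k x) = qx s k (px s j x) + ((j == k)%:R * (if s then -1 else 1)) *: x.
Proof.
rewrite /px /qx; case: s; last by rewrite mulr1; apply: pX_mX.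
have := pX_mX k j x; generalize (pX k (mX j x)) (mX j (pX k x)) => u v ->.
by rewrite [k == j]eq_sym mulrN1 scaleNr addrK.
Qed.

Lemma degm_px n s m j x : degm m n x -> degm (nx s m) n (px s j x).
Proof.
rewrite /nx /px; case: s; case: j; apply: degm_opE => a1 a2 b1 b2 <- En /=.
- by right; rewrite addnS.
- by right.
- by case: a2 => [|a2]; [left | right; rewrite addnS].
- by case: a1 => [|a1]; [left | right].
Qed.

Lemma degm_qx n s m j x : degm m n x -> degm (pv s m) n (qx s j x).
Proof. by have := @degm_px n (~~ s) m j x; rewrite /nx /px /pv /qx; case: s. Qed.

Lemma px_eul n s m x : degm m n x ->
  qx s false (px s false x) + qx s true (px s true x) = (if s then m.+2%:R else m%:R : K) *: x.
Proof.
move=> Mx.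
apply: (@lin_ext_on _ ((qx s false \o px s false) \+ (qx s true \o px s true))
  ((if s then m.+2%:R else m%:R : K) \*: idfun)).
move=> b /Mx; case: b => -[k J] [[[a1 a2] b1] b2] [<- _].
have E c s1 c' s1' d t d' t' e := f_equal2 (@GRing.add vec)
  (opEL2_bv c s1 c' s1' k J e) (opEL2_bv d t d' t' k J e).
case: s; apply: (etrans (E _ _ _ _ _ _ _ _ _)); rewrite /= ?mul1r ?mulr1.
  by rewrite -scalerDl -natrD addSn addnS.
rewrite natrD scalerDl; apply: (f_equal2 (@GRing.add vec)).
  by case: a1 => [|a1]; [exact: etrans (scale0r _) (esym (scale0r _))|].
by case: a2 => [|a2]; [exact: etrans (scale0r _) (esym (scale0r _))|].
Qed.

Lemma pX0 n j x : degm 0 n x -> pX j x = 0.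
Proof.
move=> Mx; apply: (@lin_ext_on _ (pX j) \0) => b /Mx.
case: b => -[k J] [[[a1 a2] b1] b2] [/eqP]; rewrite addn_eq0 => /andP[/eqP-> /eqP->] _ /=.
by rewrite opE_bv; case: j; rewrite scale0r.
Qed.

Definition DL (X : VX) (b : bool) : {linear vec -> vec} := D RL (px (sx X)) b.

Lemma koszul_vec n s :
  koszul (@thL K) (@WL K) RL (@ioL K) s (px s) (qx s) (fun m => degm m n).
Proof.
split.
- exact: RL_RL.
- exact: ioL_RL.
- exact: ioL_ioL.
- exact: RL_th.
- exact: theta_inj.
- exact: WL_RL.
- exact: WL_ioL.
- exact: WL_ann.
- by move=> j a b x; rewrite /px; case: s; rewrite RL_opE.
- by move=> j a b x; rewrite /qx; case: s; rewrite RL_opE.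
- by move=> j a b x; rewrite /px; case: s; rewrite ioL_opE.
- by move=> j x; rewrite /px; case: s; rewrite WL_opE.
- by move=> j x; rewrite /qx; case: s; rewrite WL_opE.
- exact: px_px.
- exact: px_qx.
- by move=> m; apply: degm_sub.
- by move=> *; apply: degm_RL.
- by move=> *; apply: degm_ioL.
- by move=> *; apply: degm_WL.
- by move=> *; apply: degm_px.
- by move=> *; apply: degm_qx.
- by move=> *; apply: px_eul; eassumption.
- by rewrite /qx => -> j x; apply: pX0.
- by rewrite /px => /negbTE-> j x; apply: pX0.
Qed.

End Inst.

Lemma sum4E (V : zmodType) (A B C D : V) : A + (B + 0) + (C + (D + 0) + 0) = A + C + (B + D).
Proof. by rewrite !addr0 addrACA. Qed.

(** * The arrows in terms of D_1 and D_2, and components along the y-monomials *)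

Section Comp.
Variable K : numClosedFieldType.
Implicit Types (x y z : vec K) (J : {set 'I_4}).
Notation vec := (vec K).
Notation bv := (@bv K).
Notation pX := (@pX K).
Notation mX := (@mX K).
Notation pY := (@pY K).
Notation mY := (@mY K).
Notation opEL := (@opEL K).
Notation RL := (@RL K).
Notation DL := (@DL K).

Lemma rw2E p q x : rw [:: p; q] x = RL q.1 q.2 (RL p.1 p.2 x).
Proof. exact: etrans (rmulwE _ _ _) (congr1 _ (rmulwE _ _ _)). Qed.
Lemma rw3E p q r x : rw [:: p; q; r] x = RL r.1 r.2 (RL q.1 q.2 (RL p.1 p.2 x)).
Proof. exact: etrans (rmulwE _ _ _) (congr1 _ (rw2E _ _ _)). Qed.

Lemma dX_px X j x : dX X j x = px K (sx X) j x.
Proof. exact: dXE. Qed.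
Definition py (s j : bool) : {linear vec -> vec} := if s then mY j else pY j.
Lemma dY_py X j x : dY X j x = py (sy X) j x.
Proof. exact: dYE. Qed.

Lemma nablaE X x : nabla X x = DL X false (py (sy X) false x) + DL X true (py (sy X) true x).
Proof.
rewrite /nabla unlock /=; apply: (etrans (sum4E _ _ _ _)).
have E a b : rmulw (w K a b) (dX X a (dY X b x)) = RL a b (px K (sx X) a (py (sy X) b x)).
  by rewrite rmulwE dX_px dY_py.
exact: f_equal2 (f_equal2 _ (E _ _) (E _ _)) (f_equal2 _ (E _ _) (E _ _)).
Qed.

Lemma nabla2E X x : nabla2 X x = DL X true (DL X false x).
Proof.
have E p q j k : rw [:: p; q] (dX X j (dX X k x)) =
    RL q.1 q.2 (RL p.1 p.2 (px K (sx X) j (px K (sx X) k x))).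
  by rewrite rw2E 2!dX_px.
apply: etrans (esym (D_true_D_false (@coef_lin K) (@coef_sep K) (koszul_vec K 0 (sx X)) x)).
exact: f_equal2 (f_equal2 _ (E _ _ _ _) (f_equal2 _ (E _ _ _ _) (E _ _ _ _))) (E _ _ _ _).
Qed.

Lemma nabla2tE X x : nabla2t X x =
  RL true false (RL false false (py (sy X) false (py (sy X) false x)))
  + (RL true false (RL false true (py (sy X) false (py (sy X) true x)))
     + RL true true (RL false false (py (sy X) false (py (sy X) true x))))
  + RL true true (RL false true (py (sy X) true (py (sy X) true x))).
Proof.
have E p q j k : rw [:: p; q] (dY X j (dY X k x)) =
    RL q.1 q.2 (RL p.1 p.2 (py (sy X) j (py (sy X) k x))).
  by rewrite rw2E 2!dY_py.
exact: f_equal2 (f_equal2 _ (E _ _ _ _) (f_equal2 _ (E _ _ _ _) (E _ _ _ _))) (E _ _ _ _).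
Qed.

Lemma lin_sum (f : {linear vec -> vec}) I (r : seq I) (P : pred I) (F : I -> vec) :
  f (\sum_(i <- r | P i) F i) = \sum_(i <- r | P i) f (F i).
Proof. exact: linear_sum. Qed.

Lemma eq_opE c s c' s' x :
  (forall a1 a2 b1 b2, let e := (a1, a2, b1, b2) in
     c e = c' e /\ (s e = s' e \/ c e = 0)) ->
  opEL c s x = opEL c' s' x.
Proof.
move=> H; apply: eq_bigr => -[[k J] [[[a1 a2] b1] b2]] _.
have /= [E SZ] := H a1 a2 b1 b2.
apply: (congr1 (fun v => _ *: v)); rewrite -E.
case: SZ => [->|->]; first reflexivity.
exact: etrans (scale0r _) (esym (scale0r _)).
Qed.

Lemma opEL_id x : opEL (fun=> 1) id x = x.
Proof.
apply: etrans _ (esym (vecE x)); apply: eq_bigr => -[[k J] e] _.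
by rewrite scale1r.
Qed.

Lemma opEL_0 c s x : (forall e, c e = 0) -> opEL c s x = 0.
Proof.
move=> c0; apply: big1 => b _; rewrite c0.
exact: etrans (congr1 _ (scale0r _)) (scaler0 _ _).
Qed.

Lemma eq_opE_on m n c s c' s' x : degm m n x ->
  (forall a1 a2 b1 b2, (a1 + a2 = m)%N -> (b1 + b2 = n)%N -> let e := (a1, a2, b1, b2) in
     c e = c' e /\ (s e = s' e \/ c e = 0)) ->
  opEL c s x = opEL c' s' x.
Proof.
move=> Mx H; apply: (@lin_ext_on _ (opEL c s) (opEL c' s')) => b /Mx.
case: b => -[k J] [[[a1 a2] b1] b2] [Em En]; have /= [E SZ] := H a1 a2 b1 b2 Em En.
apply: (etrans (opEL_bv _ _ _ _ _)); apply: etrans _ (esym (opEL_bv _ _ _ _ _)); rewrite -E.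
case: SZ => [->|->]; first reflexivity.
exact: etrans (scale0r _) (esym (scale0r _)).
Qed.

Lemma coef_opE c s x k J e : (forall e', c e' != 0 -> s e' = s e -> e' = e) ->
  (opEL c s x)@_(k, J, s e) = c e * x@_(k, J, e).
Proof.
move=> inj; rewrite [in LHS](vecE x) [in RHS](vecE x) lin_sum.
rewrite !(raddf_sum (mcoeff _)) /= mulr_sumr; apply: eq_bigr => -[[k' J'] e'] _.
rewrite (opZ (opEL c s)) opEL_bv !mcoeffZ !coef_bv !xpair_eqE.
have [->|ne] := eqVneq e' e; first by rewrite eqxx !andbT; ring.
rewrite andbF mulr0 mulr0; have [->|c0] := eqVneq (c e') 0; first by rewrite mul0r mulr0.
by rewrite (_ : s e' == s e = false) ?andbF ?mulr0 //; apply/negP => /eqP /(inj _ c0) /eqP; apply/negP.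
Qed.

(** Normalization by divided powers: with i! j! included, differentiation in y becomes a plain shift
    of the component index. Multiplication is already a shift, hence the factor 1. *)
Definition fct (t : bool) (i j : nat) : K := if t then 1 else (i`! * j`!)%:R.
Lemma fct_neq0 t i j : fct t i j != 0.
Proof.
by rewrite /fct; case: t; rewrite ?oner_eq0 // pnatr_eq0 -lt0n muln_gt0 !fact_gt0.
Qed.

Definition ycomp (t : bool) (i j : nat) : {linear vec -> vec} :=
  opEL (fun '(a1, a2, b1, b2) => if (b1 == i) && (b2 == j) then fct t i j else 0)
       (fun '(a1, a2, _, _) => (a1, a2, 0, 0)%N).
Definition yput (t : bool) (i j : nat) : {linear vec -> vec} :=
  opEL (fun=> (fct t i j)^-1) (fun '(a1, a2, _, _) => (a1, a2, i, j)).

Lemma opE_comp1 c s c' s' d t x :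
  (forall a1 a2 b1 b2, let e := (a1, a2, b1, b2) in
    c' e * c (s' e) = d e /\ (s (s' e) = t e \/ d e = 0)) ->
  opEL c s (opEL c' s' x) = opEL d t x.
Proof.
move=> H; apply: (etrans (opE_comp c c' s s' x)); apply: eq_opE => a1 a2 b1 b2 /=.
by have [E [S|Z]] := H a1 a2 b1 b2; split=> //; [left | right; rewrite E].
Qed.

Lemma opE_comp0 c s c' s' x :
  (forall a1 a2 b1 b2, let e := (a1, a2, b1, b2) in c' e * c (s' e) = 0) ->
  opEL c s (opEL c' s' x) = 0.
Proof.
move=> H; apply: (etrans (opE_comp c c' s s' x)); apply: opEL_0 => -[[[a1 a2] b1] b2] /=.
exact: H.
Qed.

Lemma ycomp_pY1 i j x : ycomp false i j (pY false x) = ycomp false i.+1 j x.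
Proof.
apply: opE_comp1 => a1 a2 [|b1] b2 /=; rewrite ?mul0r ?eqSS; first by split=> //; right.
split; last by left.
have [->|_] := eqVneq b1 i; last by rewrite mulr0.
by case: (b2 == j); rewrite /= ?mulr0 // -natrM factS mulnA.
Qed.
Lemma ycomp_pY2 i j x : ycomp false i j (pY true x) = ycomp false i j.+1 x.
Proof.
apply: opE_comp1 => a1 a2 b1 [|b2] /=; rewrite ?mul0r ?eqSS ?andbF; first by split=> //; right.
split; last by left.
have [->|_] := eqVneq b2 j; last by rewrite andbF mulr0.
by case: (b1 == i); rewrite /= ?mulr0 // -natrM factS mulnCA.
Qed.
Lemma ycomp_mY1 i j x : ycomp true i.+1 j (mY false x) = ycomp true i j x.
Proof.
by apply: opE_comp1 => a1 a2 b1 b2 /=; rewrite mul1r eqSS; split; last left.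
Qed.
Lemma ycomp_mY2 i j x : ycomp true i j.+1 (mY true x) = ycomp true i j x.
Proof.
by apply: opE_comp1 => a1 a2 b1 b2 /=; rewrite mul1r eqSS; split; last left.
Qed.
Lemma ycomp_mY1_0 j x : ycomp true 0 j (mY false x) = 0.
Proof. by apply: opE_comp0 => a1 a2 b1 b2 /=; rewrite mulr0. Qed.
Lemma ycomp_mY2_0 i x : ycomp true i 0 (mY true x) = 0.
Proof. by apply: opE_comp0 => a1 a2 b1 b2 /=; rewrite andbF mulr0. Qed.

Lemma ycomp_yput t i j x m : degm m 0 x -> ycomp t i j (yput t i j x) = x.
Proof.
move=> Mx; apply: etrans _ (opEL_id x); apply: (etrans (opE_comp _ _ _ _ _)).
apply: eq_opE_on Mx _ => a1 a2 b1 b2 _ /eqP; rewrite addn_eq0 => /andP[/eqP-> /eqP->] /=.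
by rewrite !eqxx mulVf ?fct_neq0 //; split=> //; left.
Qed.
Lemma ycomp_yput0 t i j k l x : (i == k) && (j == l) = false -> ycomp t i j (yput t k l x) = 0.
Proof.
by move=> H; apply: opE_comp0 => a1 a2 b1 b2 /=; rewrite [k == i]eq_sym [l == j]eq_sym H mulr0.
Qed.

Lemma degm_ycomp t i j m n x : degm m n x -> degm m 0 (ycomp t i j x).
Proof. by apply: degm_opE => a1 a2 b1 b2 Em _ /=; right. Qed.
Lemma degm_yput t i j m n x : degm m n x -> degm m (i + j)%N (yput t i j x).
Proof. by apply: degm_opE => a1 a2 b1 b2 Em _ /=; right. Qed.

Lemma ycomp_ext t m n x y : degm m n x -> degm m n y ->
  (forall i j, (i + j = n)%N -> ycomp t i j x = ycomp t i j y) -> x = y.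
Proof.
move=> Mx My H; apply/malgP => -[[k J] [[[a1 a2] b1] b2]].
have coefE z : (ycomp t b1 b2 z)@_(k, J, (a1, a2, 0, 0)%N) = fct t b1 b2 * z@_(k, J, (a1, a2, b1, b2)).
  have := @coef_opE (fun '(a1, a2, c1, c2) => if (c1 == b1) && (c2 == b2) then fct t b1 b2 else 0)
    (fun '(a1, a2, _, _) => (a1, a2, 0, 0)%N) z k J (a1, a2, b1, b2).
  rewrite /= !eqxx; apply=> -[[[c1 c2] d1] d2] /=.
  have [->|_] := eqVneq d1 b1; last by rewrite eqxx.
  by have [->|_] := eqVneq d2 b2; rewrite /= ?eqxx // => _ [-> ->].
have [En|En] := eqVneq (b1 + b2)%N n.
  by apply: (mulfI (fct_neq0 t b1 b2)); rewrite -2!coefE (H _ _ En).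
have Z z : degm m n z -> z@_(k, J, (a1, a2, b1, b2)) = 0.
  move=> Mz; apply/eqP; apply: contraNT En => /Mz[_ ->] //.
by rewrite (Z _ Mx) (Z _ My).
Qed.

Lemma degm_py s j m n x : degm m n x -> degm m (nx s n) (py s j x).
Proof.
rewrite /nx /py; case: s; case: j; apply: degm_opE => a1 a2 b1 b2 Em <- /=.
- by right; rewrite addnS.
- by right.
- by case: b2 => [|b2]; [left | right; rewrite addnS].
- by case: b1 => [|b1]; [left | right].
Qed.

Lemma RL_py s j a b x : py s j (RL a b x) = RL a b (py s j x).
Proof. by rewrite /py; case: s; apply: esym (RL_opE _ _ _ _ _). Qed.

Lemma ycomp00 t m x : degm m 0 x -> ycomp t 0 0 x = x.
Proof.
move=> Mx; apply: etrans _ (opEL_id x).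
apply: eq_opE_on Mx _ => a1 a2 b1 b2 _ /eqP; rewrite addn_eq0 => /andP[/eqP-> /eqP->] /=.
by split; [rewrite /fct; case: t | left].
Qed.

Lemma py_yput1 i j z : py false false (yput false i.+1 j z) = yput false i j z.
Proof.
apply: opE_comp1 => a1 a2 b1 b2 /=; split; last by left.
by rewrite /fct factS -mulnA natrM invfM mulrC mulrA mulfV ?mul1r // pnatr_eq0.
Qed.
Lemma py_yput2 i j z : py false true (yput false i j.+1 z) = yput false i j z.
Proof.
apply: opE_comp1 => a1 a2 b1 b2 /=; split; last by left.
by rewrite /fct factS mulnCA natrM invfM mulrC mulrA mulfV ?mul1r // pnatr_eq0.
Qed.
Lemma py_yput1_0 j z : py false false (yput false 0 j z) = 0.
Proof. by apply: opE_comp0 => a1 a2 b1 b2 /=; rewrite mulr0. Qed.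
Lemma py_yput2_0 i z : py false true (yput false i 0 z) = 0.
Proof. by apply: opE_comp0 => a1 a2 b1 b2 /=; rewrite mulr0. Qed.
Lemma yput00 m z : degm m 0 z -> yput false 0 0 z = z.
Proof.
move=> Mx; apply: etrans _ (opEL_id z).
apply: eq_opE_on Mx _ => a1 a2 b1 b2 _ /eqP; rewrite addn_eq0 => /andP[/eqP-> /eqP->] /=.
by split; [rewrite /fct mul1n invr1 | left].
Qed.

Lemma px_ycomp s j t i l x : px K s j (ycomp t i l x) = ycomp t i l (px K s j x).
Proof.
rewrite /px; case: s; case: j; apply: eq_opE2 => a1 a2 b1 b2 /=; by split; [ring | left].
Qed.

End Comp.

(** * Exactness at the vertices *)

(** Interface through which the exactness arguments see the modules. In [M m n] the indices are the
    absolute values of the x- and y-degrees; [ycomp] and [yput] extract and insert normalized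
    y-components. *)
Record bigraded (K : numClosedFieldType) (V : lmodType K) (th W : {linear V -> V})
    (R io : bool -> bool -> {linear V -> V}) (px qx py : bool -> bool -> {linear V -> V})
    (M : nat -> nat -> V -> Prop) (ycomp yput : bool -> nat -> nat -> {linear V -> V}) : Prop :=
  Bigraded {
  b_koszul : forall n s, koszul th W R io s (px s) (qx s) (fun m => M m n);
  b_R_py : forall s j a b x, py s j (R a b x) = R a b (py s j x);
  b_R_ycomp : forall t i j a b x, R a b (ycomp t i j x) = ycomp t i j (R a b x);
  b_px_ycomp : forall s t i j k x, px s k (ycomp t i j x) = ycomp t i j (px s k x);
  b_ycomp_pY1 : forall i j x, ycomp false i j (py false false x) = ycomp false i.+1 j x;
  b_ycomp_pY2 : forall i j x, ycomp false i j (py false true x) = ycomp false i j.+1 x;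
  b_ycomp_mY1 : forall i j x, ycomp true i.+1 j (py true false x) = ycomp true i j x;
  b_ycomp_mY2 : forall i j x, ycomp true i j.+1 (py true true x) = ycomp true i j x;
  b_ycomp_mY1_0 : forall j x, ycomp true 0 j (py true false x) = 0;
  b_ycomp_mY2_0 : forall i x, ycomp true i 0 (py true true x) = 0;
  b_py_yput1 : forall i j x, py false false (yput false i.+1 j x) = yput false i j x;
  b_py_yput2 : forall i j x, py false true (yput false i j.+1 x) = yput false i j x;
  b_py_yput1_0 : forall j x, py false false (yput false 0 j x) = 0;
  b_py_yput2_0 : forall i x, py false true (yput false i 0 x) = 0;
  b_ycomp_yput : forall t i j m x, M m 0 x -> ycomp t i j (yput t i j x) = x;
  b_ycomp_yput0 : forall t i j k l x, (i == k) && (j == l) = false ->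
    ycomp t i j (yput t k l x) = 0;
  b_ycomp00 : forall t m x, M m 0 x -> ycomp t 0 0 x = x;
  b_yput00 : forall m x, M m 0 x -> yput false 0 0 x = x;
  b_ycomp_ext : forall t m n x y, M m n x -> M m n y ->
    (forall i j, (i + j = n)%N -> ycomp t i j x = ycomp t i j y) -> x = y;
  b_M_py : forall s j m n x, M m n x -> M m (nx s n) (py s j x);
  b_M_ycomp : forall t i j m n x, M m n x -> M m 0 (ycomp t i j x);
  b_M_yput : forall t i j m n x, M m n x -> M m (i + j)%N (yput t i j x) }.

Section Vertices.
Variables (K : numClosedFieldType) (V : lmodType K) (I : Type) (co : I -> V -> K).
Hypothesis cl : forall d k x y, co d (k *: x + y) = k * co d x + co d y.
Hypothesis cs : forall x y, (forall d, co d x = co d y) -> x = y.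
Variables (th W : {linear V -> V}) (R io : bool -> bool -> {linear V -> V}).
Variables (px qx py : bool -> bool -> {linear V -> V}) (M : nat -> nat -> V -> Prop).
Variables (ycomp yput : bool -> nat -> nat -> {linear V -> V}).
Hypothesis HB : bigraded th W R io px qx py M ycomp yput.
Let kos n s : koszul th W R io s (px s) (qx s) (fun m => M m n) := b_koszul HB n s.

Notation Dx s b := (D R (px s) b).
Definition nab (s t : bool) (x : V) : V := Dx s false (py t false x) + Dx s true (py t true x).

Lemma M_sub m n : subspace (M m n).
Proof. exact: (k_M_sub (kos n true) m). Qed.

Lemma M_Dx s b m n x : M m n x -> M (nx s m) n (Dx s b x).
Proof. exact: (M_D (kos n s)). Qed.

Lemma Dx_ycomp s b t i j x : Dx s b (ycomp t i j x) = ycomp t i j (Dx s b x).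
Proof.
apply: D_comm => *; [by rewrite (b_R_ycomp HB) | by rewrite (b_px_ycomp HB)].
Qed.

Lemma ycomp_nab s t i j x : ycomp t i j (nab s t x) =
  Dx s false (ycomp t i j (py t false x)) + Dx s true (ycomp t i j (py t true x)).
Proof. by rewrite /nab (opD (ycomp t i j)) -2!Dx_ycomp. Qed.

Lemma ycomp_nabla_diff s i j x :
  ycomp false i j (nab s false x) = Dx s false (ycomp false i.+1 j x) + Dx s true (ycomp false i j.+1 x).
Proof. by rewrite ycomp_nab (b_ycomp_pY1 HB) (b_ycomp_pY2 HB). Qed.

Lemma ycomp_nabla_mult s i j x :
  ycomp true i.+1 j.+1 (nab s true x) = Dx s false (ycomp true i j.+1 x) + Dx s true (ycomp true i.+1 j x).
Proof. by rewrite ycomp_nab (b_ycomp_mY1 HB) (b_ycomp_mY2 HB). Qed.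
Lemma ycomp_nabla_mult1 s j x : ycomp true 0 j.+1 (nab s true x) = Dx s true (ycomp true 0 j x).
Proof. by rewrite ycomp_nab (b_ycomp_mY1_0 HB) (b_ycomp_mY2 HB) (op0 (D _ _ _)) add0r. Qed.
Lemma ycomp_nabla_mult2 s i x : ycomp true i.+1 0 (nab s true x) = Dx s false (ycomp true i 0 x).
Proof. by rewrite ycomp_nab (b_ycomp_mY1 HB) (b_ycomp_mY2_0 HB) (op0 (D _ _ _)) addr0. Qed.

Lemma degm_nabla s t m n x : M m n x -> M (nx s m) (nx t n) (nab s t x).
Proof.
by move=> Mx; apply: (subD (M_sub _ _)); apply: M_Dx; apply: (b_M_py HB).
Qed.

Definition glue t n (z : nat -> V) : V := \sum_(i < n.+1) yput t i (n - i)%N (z i).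

Lemma degm_glue t m n (z : nat -> V) : (forall i, M m 0 (z i)) -> M m n (glue t n z).
Proof.
move=> Mz; rewrite /glue; elim/big_ind: _ => [|u v Mu Mv|i _].
- exact: (M_sub m n).1.
- exact: (subD (M_sub m n) Mu Mv).
- have E : (i + (n - i) = n)%N by rewrite subnKC // -ltnS.
  by have := b_M_yput HB t i (n - i)%N (Mz i); rewrite E.
Qed.

Lemma ycomp_glue t m n (z : nat -> V) i j : (forall i, M m 0 (z i)) -> (i + j = n)%N ->
  ycomp t i j (glue t n z) = z i.
Proof.
move=> Mz En; have iN : (i < n.+1)%N by rewrite ltnS -En leq_addr.
rewrite /glue linear_sum (bigD1 (Ordinal iN)) //= big1 ?addr0 => [|k].
  have -> : (n - i = j)%N by rewrite -En addKn.
  exact: (b_ycomp_yput HB _ _ _ (Mz i)).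
rewrite -val_eqE /= => /negbTE ki; apply: (b_ycomp_yput0 HB).
by rewrite eq_sym ki.
Qed.

(** Reduces exactness to the y-component of lowest index: [chain_lower] solves for the others, and
    the solutions are glued. *)
Lemma exact_lower s m n x : (0 < m)%N -> M m n x ->
    (exists u v, [/\ M (pv s m) 0 u, M (pv s m) 0 v &
       ycomp false 0 n x = Dx s false u + Dx s true v]) ->
    ((0 < n)%N -> nab s false x = 0) ->
  exists z, M (pv s m) n.+1 z /\ x = nab s false z.
Proof.
move=> m0 Mx H0 Nx; pose y i := ycomp false i (n - i)%N x.
have [i iN|||z [Mz Ez]] := chain_lower (N := n) (y := y) cl cs (kos 0 s) m0.
- exact: (b_M_ycomp HB _ _ _ Mx).
- by rewrite /y subn0.
- move=> i iN; have := ycomp_nabla_diff s i (n - i).-1%N x.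
  rewrite Nx ?(leq_ltn_trans _ iN) // (op0 (ycomp _ _ _)) => ->.
  by rewrite /y prednK ?subn_gt0 // subnS.
have Mg : M (pv s m) n.+1 (glue false n.+1 z) by exact: degm_glue Mz.
exists (glue false n.+1 z); split=> //.
have Mn : M m n (nab s false (glue false n.+1 z)).
  have := degm_nabla s false Mg; rewrite /nx /pv /=.
  by case: (s) => //; rewrite prednK.
apply: (b_ycomp_ext HB (t := false) Mx Mn) => i j En.
rewrite ycomp_nabla_diff (ycomp_glue false Mz) ?addSn ?En //.
rewrite (ycomp_glue false Mz) ?addnS ?En //.
have := Ez i; rewrite /y -En addKn; apply; exact: leq_addr.
Qed.

(** The lowest component y_0 satisfies D_2 D_1 y_0 = 0: for n = 0 this is the hypothesis, and for n
    > 0 it follows by applying D_1 to D_1 y_1 + D_2 y_0 = 0. *)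
Lemma exact_AB s m n x : (0 < m)%N -> s || (1 < m)%N -> M m n x ->
    (if n == 0%N then Dx s true (Dx s false x) else nab s false x) = 0 ->
  exists z, M (pv s m) n.+1 z /\ x = nab s false z.
Proof.
move=> m0 sm Mx Nx; apply: exact_lower => //; last by case: n Mx Nx.
apply: (D_split cl cs (kos 0 s) m0 sm); first exact: (b_M_ycomp HB _ _ _ Mx).
case: n Mx Nx => [|n] Mx /= Nx; first by rewrite (b_ycomp00 HB _ Mx).
have := ycomp_nabla_diff s 0 n x; rewrite Nx (op0 (ycomp _ _ _)) => E.
rewrite (D_D cl cs (kos 0 s)).
have -> : Dx s true (ycomp false 0 n.+1 x) = - Dx s false (ycomp false 1 n x).
  by apply/eqP; rewrite -addr_eq0 addrC -E.
by rewrite (opN (D R (px s) false)) opprK /= (DD cl cs (kos 0 s)).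
Qed.

(** In x-degree 1 the relation D_1 y_1 + D_2 y_0 = 0 itself has to be used, through [D_pair_split],
    instead of its weaker consequence D_2 D_1 y_0 = 0. *)
Lemma exact_A11 x : M 1 1 x -> nab false false x = 0 ->
  exists z, M 2 2 z /\ x = nab false false z.
Proof.
move=> Mx Nx; apply: (@exact_lower false 1 1) => //.
have E := ycomp_nabla_diff false 0 0 x; rewrite Nx (op0 (ycomp _ _ _)) in E.
have M1 : M 1 0 (ycomp false 0 1 x) by exact: (b_M_ycomp HB _ _ _ Mx).
have M2 : M 1 0 (ycomp false 1 0 x) by exact: (b_M_ycomp HB _ _ _ Mx).
by apply: (D_pair_split cl cs (kos 0 false) isT M1 M2); rewrite addrC.
Qed.

Lemma exact_upper s m n x : (0 < m)%N -> ~~ s || (1 < m)%N -> M m n.+1 x ->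
    nab s true x = 0 -> exists z, M (pv s m) n z /\ x = nab s true z.
Proof.
move=> m0 sm Mx Nx; pose y i := ycomp true i (n.+1 - i)%N x.
have E0 i j : ycomp true i j (nab s true x) = 0 by rewrite Nx (op0 (ycomp _ _ _)).
have [i iN||i||z [Mz Ez0 Ez EzN]] := chain_upper (N := n) (y := y) cl cs (kos 0 s) m0 sm.
- exact: (b_M_ycomp HB _ _ _ Mx).
- by rewrite /y subn0 -ycomp_nabla_mult1 E0.
- by move=> iN; rewrite /y subSS subSn // -ycomp_nabla_mult E0.
- by rewrite /y subnn -ycomp_nabla_mult2 E0.
have Mg : M (pv s m) n (glue true n z) by exact: degm_glue Mz.
exists (glue true n z); split=> //.
have Mn : M m n.+1 (nab s true (glue true n z)).
  have := degm_nabla s true Mg; rewrite /nx /pv /=.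
  by case: (s) => //; rewrite prednK.
apply: (b_ycomp_ext HB (t := true) Mx Mn) => -[|i] j En.
  rewrite add0n in En; rewrite En ycomp_nabla_mult1 (ycomp_glue true Mz) //.
rewrite addSn in En; case: En => En; case: j En => [|j] En.
  rewrite addn0 in En; rewrite En ycomp_nabla_mult2 (ycomp_glue true Mz) ?addn0 //.
  by rewrite -EzN /y subnn.
rewrite ycomp_nabla_mult (ycomp_glue true Mz) // (ycomp_glue true Mz); last by rewrite addSnnS.
have := Ez i; rewrite /y subSS -En addKn; apply.
by rewrite addnS ltnS leq_addr.
Qed.

Lemma nabla_mult0 s m x : M m 0 x -> nab s true x = 0 -> Dx s false x = 0 /\ Dx s true x = 0.
Proof.
move=> Mx Nx; have E0 i j : ycomp true i j (nab s true x) = 0 by rewrite Nx (op0 (ycomp _ _ _)).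
have := ycomp_nabla_mult2 s 0 x; have := ycomp_nabla_mult1 s 0 x.
by rewrite 2!E0 !(b_ycomp00 HB _ Mx) => <- <-.
Qed.

Lemma exact_CD0 s m x : (0 < m)%N -> ~~ s || (1 < m)%N -> M m 0 x -> nab s true x = 0 ->
  exists z, M (pv s (pv s m)) 0 z /\ x = Dx s true (Dx s false z).
Proof.
move=> m0 sm Mx Nx; have [D1 D2] := nabla_mult0 Mx Nx.
exact: (D_cap cl cs (kos 0 s) m0 sm Mx D1 D2).
Qed.

(** All four w_ab kill x, hence so does {w_11, w_22} = -2 Theta, and Theta can be cancelled. *)
Lemma exact_C00 x : M 0 0 x -> nab true true x = 0 -> x = 0.
Proof.
move=> Mx Nx; have [D1 D2] := nabla_mult0 Mx Nx.
have kv := kos 0 true.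
have [Ra Rb] := D_inj0 cl cs kv isT Mx D1; have [Rc Rd] := D_inj0 cl cs kv isT Mx D2.
have := k_R_R kv true true false false x; rewrite Ra Rd !(op0 (R _ _)) subr0 mul1r.
move/esym/eqP; rewrite scaler_eq0 => /orP[|/eqP]; last exact: (k_th_inj kv).
by rewrite /= -opprD oppr_eq0 -(natrD _ 1 1) pnatr_eq0.
Qed.

Notation Ra := (R false false).
Notation Rb := (R true false).
Notation Rc := (R false true).
Notation Rd := (R true true).

Definition nab2t t x : V := let p := py t in
  Rb (Ra (p false (p false x)))
  + (Rb (Rc (p false (p true x))) + Rd (Ra (p false (p true x))))
  + Rd (Rc (p true (p true x))).

Lemma exact_B00 x : M 0 0 x -> Dx true true (Dx true false x) = 0 ->
  exists z, M 0 2 z /\ x = nab2t false z.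
Proof.
move=> Mx Nx.
have [a [b [c [Ma Mb Mc E]]]] := D_split0 cl cs (kos 0 true) isT Mx Nx.
(* With divided powers the second derivatives of z in y are exactly [a], [b] and [c]. *)
pose z := yput false 2 0 a + yput false 1 1 b + yput false 0 2 c.
exists z; split.
  apply: (subD (M_sub 0 2)); first apply: (subD (M_sub 0 2)).
  - exact: (b_M_yput HB _ 2 0 Ma).
  - exact: (b_M_yput HB _ 1 1 Mb).
  - exact: (b_M_yput HB _ 0 2 Mc).
have z1 : py false false z = yput false 1 0 a + yput false 0 1 b.
  by rewrite /z !(opD (py _ _)) !(b_py_yput1 HB) (b_py_yput1_0 HB) addr0.
have z2 : py false true z = yput false 1 0 b + yput false 0 1 c.
  by rewrite /z !(opD (py _ _)) !(b_py_yput2 HB) (b_py_yput2_0 HB) add0r.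
rewrite /nab2t /= z1 z2 !(opD (py _ _)) !(b_py_yput1 HB) !(b_py_yput1_0 HB) (b_py_yput2 HB)
  (b_py_yput2_0 HB) (b_yput00 HB Ma) (b_yput00 HB Mb) (b_yput00 HB Mc) !addr0 !add0r.
by rewrite E.
Qed.

(** The third-order map factors as D_2 after the coefficients w_11 w_21 and w_12 w_21 + w_11 w_22;
    [nab3E] recovers the six explicit terms. *)
Definition nab3 x : V :=
  Dx true true (Rb (Ra (py false false x))) + Dx true true (G R (py false true x)).

Lemma nab3E x : nab3 x =
  let p := px true in let a := py false false x in let b := py false true x in
  Rc (Rb (Ra (p false a))) + Rd (Rb (Ra (p true a)))
  + (Rc (Rb (Rc (p false b))) + Rc (Rd (Ra (p false b))))
  + (Rd (Rb (Rc (p true b))) + Rd (Rd (Ra (p true b)))).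
Proof.
have pR := k_p_R (kos 0 true).
rewrite /nab3 /D /G !(opD (px true _)) !pR (opD Rc) (opD Rd) /=.
by rewrite !addrA.
Qed.

Definition nab3t x : V :=
  let a := px false false x in let b := px false true x in
  let u := py true false in let v := py true true in
  Rb (Rc (Ra (u a))) + Rd (Rc (Ra (v a))) + (Rb (Rc (Rb (u b))) + Rb (Rd (Ra (u b))))
  + (Rd (Rc (Rb (v b))) + Rd (Rd (Ra (v b)))).

Section Swap.
Variable f : {linear V -> V}.
Hypothesis f_R : forall a b x, f (R a b x) = R b a (f x).
Hypothesis f_px : forall s j x, f (px s j x) = py s j (f x).
Hypothesis f_py : forall s j x, f (py s j x) = px s j (f x).
Hypothesis px_py : forall s t j k x, px s j (py t k x) = py t k (px s j x).

Lemma nab_swap s t x : f (nab s t x) = nab t s (f x).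
Proof.
rewrite /nab /D !(opD f) !f_R !f_px !f_py !px_py /=.
by rewrite addrACA.
Qed.

Lemma nab2_swap s x : f (Dx s true (Dx s false x)) = nab2t s (f x).
Proof.
rewrite (D_true_D_false cl cs (kos 0 s)) /nab2t !(opD f) !f_R !f_px /=.
by congr (_ + _ + _); rewrite addrC.
Qed.

Lemma nab3_swap x : f (nab3 x) = nab3t (f x).
Proof. by rewrite nab3E /nab3t /= !(opD f) !f_R !f_px !f_py. Qed.
End Swap.

Lemma exact_C10 x : M 1 0 x -> nab true true x = 0 -> exists z, M 0 1 z /\ x = nab3 z.
Proof.
move=> Mx Nx; have [D1 D2] := nabla_mult0 Mx Nx.
have [a [b [Ma Mb E]]] := D_cap1 cl cs (kos 0 true) isT Mx D1 D2.
exists (yput false 1 0 a + yput false 0 1 b); split.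
  apply: (subD (M_sub 0 1)); first exact: (b_M_yput HB _ 1 0 Ma).
  exact: (b_M_yput HB _ 0 1 Mb).
rewrite /nab3 !(opD (py _ _)) (b_py_yput1 HB) (b_py_yput1_0 HB) (b_py_yput2 HB)
  (b_py_yput2_0 HB) (b_yput00 HB Ma) (b_yput00 HB Mb) addr0 add0r.
exact: E.
Qed.

(** The two y-components of the third-order map at x are [Rb v] and [Rd v], with v as in
    [D_split1]. *)
Lemma exact_A10 x : M 1 0 x -> nab3t x = 0 -> exists z, M 2 1 z /\ x = nab false false z.
Proof.
move=> Mx Nx; apply: (@exact_lower false 1 0) => //.
rewrite (b_ycomp00 HB _ Mx).
have Rth t i j a b y : ycomp t i j (R a b y) = R a b (ycomp t i j y) by rewrite (b_R_ycomp HB).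
have Mp j : M 0 0 (px false j x) := k_M_p (kos 0 false) j Mx.
apply: (D_split1 cl cs (kos 0 false)) => //.
- have := congr1 (ycomp true 1 0) Nx; rewrite (op0 (ycomp _ _ _)) /nab3t !(opD (ycomp _ _ _)) !Rth.
  rewrite !(b_ycomp_mY1 HB) !(b_ycomp_mY2_0 HB) !(b_ycomp00 HB _ (Mp _)) !(op0 (R _ _)) !addr0.
  by rewrite !(opD Rb) !addrA.
- have := congr1 (ycomp true 0 1) Nx; rewrite (op0 (ycomp _ _ _)) /nab3t !(opD (ycomp _ _ _)) !Rth.
  rewrite !(b_ycomp_mY2 HB) !(b_ycomp_mY1_0 HB) !(b_ycomp00 HB _ (Mp _)) !(op0 (R _ _)) !add0r.
  by rewrite !(opD Rd) ?addr0 ?add0r ?addrA.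
Qed.

(** Representative of the surviving class, x_0 being its value at 1. It is a cycle because D_1 (G z)
    = - D_2 (z w_11 w_21), so that D_1 and D_2 both kill its only component. *)
Definition extra z : V := yput true 1 0 (Dx true false (G R z)).

Lemma extra_is_linear : linear extra.
Proof. exact: (linearP (yput true 1 0 \o (Dx true false \o G R))). Qed.

Lemma ycomp_nab0 u : M 0 0 u ->
  ycomp true 1 0 (nab true true u) = Dx true false u /\
  ycomp true 0 1 (nab true true u) = Dx true true u.
Proof.
by move=> Mu; rewrite ycomp_nabla_mult2 ycomp_nabla_mult1 !(b_ycomp00 HB _ Mu).
Qed.

Lemma M_DG z : M 0 0 z -> M 1 0 (Dx true false (G R z)).
Proof. by move=> Mz; apply: (M_Dx true); apply: (M_G (kos 0 true)). Qed.

Lemma M_extra z : M 0 0 z -> M 1 1 (extra z).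
Proof. by move=> Mz; apply: (b_M_yput HB _ 1 0); apply: M_DG. Qed.

Lemma nab_extra z : M 0 0 z -> nab true true (extra z) = 0.
Proof.
move=> Mz; have Me := M_extra Mz.
have DG : Dx true false (G R z) = - Dx true true (Rb (Ra z)).
  by rewrite (D_true_RbRa cl cs (kos 0 true)) opprK.
have E10 : ycomp true 1 0 (extra z) = Dx true false (G R z) by apply: (b_ycomp_yput HB); apply: M_DG.
have E01 : ycomp true 0 1 (extra z) = 0 by apply: (b_ycomp_yput0 HB).
apply: (b_ycomp_ext HB (t := true) (degm_nabla true true Me) (M_sub 2 2).1) => -[|[|[|i]]] [|[|[|j]]] // _;
  rewrite (op0 (ycomp _ _ _)).
- by rewrite ycomp_nabla_mult1 E01 (op0 (D _ _ _)).
- rewrite ycomp_nabla_mult E01 E10 (op0 (D _ _ _)) add0r DG (opN (D _ _ _)) /=.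
  by rewrite (DD cl cs (kos 0 true)) oppr0.
- by rewrite ycomp_nabla_mult2 E10 (DD cl cs (kos 0 true)).
Qed.

Lemma ext11 x y : M 1 1 x -> M 1 1 y -> ycomp true 1 0 x = ycomp true 1 0 y ->
  ycomp true 0 1 x = ycomp true 0 1 y -> x = y.
Proof.
move=> Mx My E1 E2; apply: (b_ycomp_ext HB (t := true) Mx My) => -[|[|i]] [|[|j]] //.
Qed.

Lemma ker_C11 x : M 1 1 x -> nab true true x = 0 ->
  exists u z, [/\ M 0 0 u, M 0 0 z & x = nab true true u + extra z].
Proof.
move=> Mx Nx; have E0 i j : ycomp true i j (nab true true x) = 0 by rewrite Nx (op0 (ycomp _ _ _)).
have M1 : M 1 0 (ycomp true 1 0 x) by exact: (b_M_ycomp HB _ _ _ Mx).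
have M2 : M 1 0 (ycomp true 0 1 x) by exact: (b_M_ycomp HB _ _ _ Mx).
have [||| u [z [Mu Mz E1 E2]]] := D_pair1 cl cs (kos 0 true) isT M1 M2.
- by rewrite -ycomp_nabla_mult2 E0.
- by rewrite -ycomp_nabla_mult1 E0.
- by rewrite -ycomp_nabla_mult E0.
exists u, z; split=> //.
have [F1 F2] := ycomp_nab0 Mu.
apply: (ext11 Mx).
  by apply: (subD (M_sub 1 1)); [exact: (degm_nabla true true Mu) | exact: M_extra].
- by rewrite (opD (ycomp _ _ _)) /= F1 (b_ycomp_yput HB _ _ _ (M_DG Mz)).
- by rewrite (opD (ycomp _ _ _)) /= F2 (b_ycomp_yput0 HB) // addr0.
Qed.

(** On multiples of w_ab, [G] reduces to the outer products: D_1 kills the first, and D_2 kills the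
    second, which therefore supplies a preimage under nabla. *)
Lemma extra_R a b z : M 0 0 z -> exists v, M 0 0 v /\ extra (R a b z) = nab true true v.
Proof.
move=> Mz; have [v [Mv D1 D2]] := D_false_G_R cl cs (kos 0 true) a b Mz.
have [F1 F2] := ycomp_nab0 Mv.
have MR : M 0 0 (R a b z) by apply: (k_M_R (kos 0 true)).
exists v; split=> //; apply: ext11; [exact: M_extra | exact: (degm_nabla true true Mv) | |].
- by rewrite F1 (b_ycomp_yput HB _ _ _ (M_DG MR)) D2.
- by rewrite F2 (b_ycomp_yput0 HB) // D1.
Qed.

(** If [extra z] is a boundary of u, then D_2 u = 0 puts u among the multiples of w_12 w_22, and D_1
    (G z - u) = 0 puts [G z - u] among those of w_11 w_21. *)
Lemma extra_nab z u : M 0 0 z -> M 0 0 u -> extra z = nab true true u ->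
  exists a b, Rb (Rc z) + Rd (Ra z) = Rb (Ra a) + Rd (Rc b).
Proof.
move=> Mz Mu E; have [F1 F2] := ycomp_nab0 Mu; rewrite -E in F1 F2.
have D2 : Dx true true u = 0 by rewrite -F2 (b_ycomp_yput0 HB).
have D1 : Dx true false (G R z) = Dx true false u.
  by rewrite -F1 (b_ycomp_yput HB _ _ _ (M_DG Mz)).
have [uc ud] := D_inj0 cl cs (kos 0 true) isT Mu D2.
have [b [_ Eb]] := ker_R2 (kos 0 true) (isT : (false, true) != (true, true)) Mu uc ud.
have MG : M 0 0 (G R z) by apply: (M_G (kos 0 true)).
have D3 : Dx true false (G R z - u) = 0.
  by rewrite (opB (D R (px true) false)) /= D1 subrr.
have Mv := subB (M_sub 0 0) MG Mu.
have [ga gb] := D_inj0 cl cs (kos 0 true) isT Mv D3.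
have [a [_ Ea]] := ker_R2 (kos 0 true) (isT : (false, false) != (true, false)) Mv ga gb.
by exists a, b; rewrite -Ea -Eb subrK.
Qed.

End Vertices.

(** * Transfer to the arrows and vertices of the diagram *)

Section Final.
Variable K : numClosedFieldType.
Notation vec := (vec K).
Let cl := @coef_lin K.
Let cs := @coef_sep K.

Lemma bigraded_vec : bigraded (@thL K) (@WL K) (@RL K) (@ioL K) (px K) (qx K) (py K)
  (@degm K) (@ycomp K) (@yput K).
Proof.
split.
- exact: koszul_vec.
- exact: RL_py.
- by move=> *; apply: RL_opE.
- by move=> *; apply: px_ycomp.
- exact: ycomp_pY1.
- exact: ycomp_pY2.
- exact: ycomp_mY1.
- exact: ycomp_mY2.
- exact: ycomp_mY1_0.
- exact: ycomp_mY2_0.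
- exact: py_yput1.
- exact: py_yput2.
- exact: py_yput1_0.
- exact: py_yput2_0.
- by move=> t i j m x; apply: ycomp_yput.
- exact: ycomp_yput0.
- by move=> t m x; apply: ycomp00.
- by move=> m x; apply: yput00.
- by move=> t m n x y; apply: ycomp_ext.
- by move=> s j m n x; apply: degm_py.
- by move=> t i j m n x; apply: degm_ycomp.
- by move=> t i j m n x; apply: degm_yput.
Qed.

Notation nab := (nab (@RL K) (px K) (py K)).

Lemma nabla_nab X x : nabla X x = nab (sx X) (sy X) x.
Proof. exact: nablaE. Qed.

Lemma nabla2t_nab X x : nabla2t X x = nab2t (@RL K) (py K) (sy X) x.
Proof. exact: nabla2tE. Qed.

Lemma nabla3_nab x : nabla3 x = nab3 (@RL K) (px K) (py K) x.
Proof.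
have E p q r j k : rw [:: p; q; r] (dX VC j (dY VA k x)) =
    RL K r.1 r.2 (RL K q.1 q.2 (RL K p.1 p.2 (px K true j (py K false k x)))).
  exact: etrans (rw3E _ _ _ _) (congr1 (fun v => RL K _ _ (RL K _ _ (RL K _ _ v)))
    (etrans (congr1 _ (dY_py VA k x)) (dX_px VC j _))).
apply: etrans _ (esym (nab3E bigraded_vec x)).
exact: f_equal2 (f_equal2 _ (f_equal2 _ (E _ _ _ _ _) (E _ _ _ _ _))
  (f_equal2 _ (E _ _ _ _ _) (E _ _ _ _ _))) (f_equal2 _ (E _ _ _ _ _) (E _ _ _ _ _)).
Qed.

Lemma nabla3t_nab x : nabla3t x = nab3t (@RL K) (px K) (py K) x.
Proof.
have E p q r j k : rw [:: p; q; r] (dY VC j (dX VA k x)) =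
    RL K r.1 r.2 (RL K q.1 q.2 (RL K p.1 p.2 (py K true j (px K false k x)))).
  exact: etrans (rw3E _ _ _ _) (congr1 (fun v => RL K _ _ (RL K _ _ (RL K _ _ v)))
    (etrans (congr1 _ (dX_px VA k x)) (dY_py VC j _))).
exact: f_equal2 (f_equal2 _ (f_equal2 _ (E _ _ _ _ _) (E _ _ _ _ _))
  (f_equal2 _ (E _ _ _ _ _) (E _ _ _ _ _))) (f_equal2 _ (E _ _ _ _ _) (E _ _ _ _ _)).
Qed.

(** The three equations record that the neighbouring arrows are the expected ones; they hold by
    computation for A with m at least 2 and for B with m at least 1. *)
Lemma hz_AB X m n : sy X = false -> (0 < m)%N -> sx X || (1 < m)%N ->
  @outmap K (X, m, n) = (if n == 0%N then @nabla2 K X else @nabla K X) ->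
  target (X, pv (sx X) m, n.+1) = Some (X, m, n) ->
  @outmap K (X, pv (sx X) m, n.+1) = @nabla K X -> homology_zero K (X, m, n).
Proof.
move=> sX m0 sm Eo Et Eo' x [Mx]; rewrite Eo => Nx.
have [|z [Mz Ez]] := @exact_AB _ _ _ _ cl cs _ _ _ _ _ _ _ _ _ _ bigraded_vec (sx X) m n x m0 sm Mx.
  case: (n == 0%N) Nx => Nx; first exact: etrans (esym (nabla2E X x)) Nx.
  by rewrite -sX; apply: etrans (esym (nabla_nab X x)) Nx.
right; exists (X, pv (sx X) m, n.+1), z; split=> //.
by rewrite Eo' nabla_nab sX.
Qed.

Lemma hz_A m n : (1 < m)%N -> homology_zero K (VA, m, n).
Proof.
move=> m1; apply: hz_AB => //; first exact: ltnW m1.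
by case: m m1 => [|[|m]] //; case: n.
Qed.

Lemma hz_B m n : (0 < m)%N -> homology_zero K (VB, m, n).
Proof.
move=> m0; apply: hz_AB => //; first by case: n.
by case: m m0.
Qed.

Lemma hz_A11 : homology_zero K (VA, 1, 1)%N.
Proof.
move=> x [Mx Nx].
have [|z [Mz Ez]] := @exact_A11 _ _ _ _ cl cs _ _ _ _ _ _ _ _ _ _ bigraded_vec x Mx.
  exact: etrans (esym (nabla_nab VA x)) Nx.
right; exists (VA, 2, 2)%N, z; split=> //.
exact: etrans Ez (esym (nabla_nab VA z)).
Qed.

Lemma hz_A10 : homology_zero K (VA, 1, 0)%N.
Proof.
move=> x [Mx Nx].
have [|z [Mz Ez]] := @exact_A10 _ _ _ _ cl cs _ _ _ _ _ _ _ _ _ _ bigraded_vec x Mx.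
  exact: etrans (esym (nabla3t_nab x)) Nx.
right; exists (VA, 2, 1)%N, z; split=> //.
exact: etrans Ez (esym (nabla_nab VA z)).
Qed.

Lemma hz_B00 : homology_zero K (VB, 0, 0)%N.
Proof.
move=> x [Mx Nx].
have [|z [Mz Ez]] := @exact_B00 _ _ _ _ cl cs _ _ _ _ _ _ _ _ _ _ bigraded_vec x Mx.
  exact: etrans (esym (nabla2E VB x)) Nx.
right; exists (VA, 0, 2)%N, z; split=> //.
exact: etrans Ez (esym (nabla2t_nab VA z)).
Qed.

Lemma hz_C00 : homology_zero K (VC, 0, 0)%N.
Proof.
move=> x [Mx Nx]; left.
apply: (@exact_C00 _ _ _ _ cl cs _ _ _ _ _ _ _ _ _ _ bigraded_vec x Mx).
exact: etrans (esym (nabla_nab VC x)) Nx.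
Qed.

Lemma hz_C10 : homology_zero K (VC, 1, 0)%N.
Proof.
move=> x [Mx Nx].
have [|z [Mz Ez]] := @exact_C10 _ _ _ _ cl cs _ _ _ _ _ _ _ _ _ _ bigraded_vec x Mx.
  exact: etrans (esym (nabla_nab VC x)) Nx.
right; exists (VA, 0, 1)%N, z; split=> //.
by rewrite Ez -nabla3_nab.
Qed.

Lemma hz_C m n : (1 < m)%N -> homology_zero K (VC, m, n).
Proof.
move=> m1 x [Mx Nx]; have m0 := ltnW m1.
have Nx' : nab true true x = 0 by apply: etrans (esym (nabla_nab VC x)) Nx.
case: n Mx {Nx} => [|n] Mx.
  have [z [Mz Ez]] := @exact_CD0 _ _ _ _ cl cs _ _ _ _ _ _ _ _ _ _ bigraded_vec true m x m0 m1 Mx Nx'.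
  right; exists (VB, m.-2, 0)%N, z; split=> //; first by rewrite /= addn2; case: m m1 {Mx Nx' m0 Mz} => [|[|m]].
  exact: etrans Ez (esym (nabla2E VB z)).
have [z [Mz Ez]] := @exact_upper _ _ _ _ cl cs _ _ _ _ _ _ _ _ _ _ bigraded_vec true m n x m0 m1 Mx Nx'.
right; exists (VC, m.-1, n), z; split=> //; first by rewrite /= prednK.
exact: etrans Ez (esym (nabla_nab VC z)).
Qed.

Lemma hz_D0 m : (0 < m)%N -> homology_zero K (VD, m, 0)%N.
Proof.
move=> m0 x [Mx Nx].
have Nx' : nab false true x = 0.
  by apply: etrans (esym (nabla_nab VD x)) _; move: Nx; rewrite /= m0.
have [z [Mz Ez]] := @exact_CD0 _ _ _ _ cl cs _ _ _ _ _ _ _ _ _ _ bigraded_vec false m x m0 isT Mx Nx'.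
right; exists (VA, m.+2, 0)%N, z; split=> //; first by rewrite /= subn2.
exact: etrans Ez (esym (nabla2E VA z)).
Qed.
End Final.

(** * The symmetry exchanging x and y *)

Lemma scaler_swap (K : comRingType) (V : lmodType K) (k a c : K) (v : V) :
  k *: (a *: (c *: v)) = a *: ((k * c) *: v).
Proof. by rewrite !scalerA mulrCA mulrA. Qed.

Section Swap.
Variable K : numClosedFieldType.
Notation vec := (vec K).
Notation bv := (@bv K).
Implicit Types x y z : vec.
Let cl := @coef_lin K.
Let cs := @coef_sep K.

Definition signU : {linear vec -> vec} := opU (fun p => (-1) ^+ (o3 \in p.2)) id.
Definition flipE : {linear vec -> vec} :=
  @opEL K (fun=> 1) (fun '(a1, a2, b1, b2) => (b1, b2, a1, a2)).
(* Exchanges the x- and y-variables; the sign is the automorphism eta_4 -> -eta_4,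
   which exchanges w_12 and w_21. *)
Definition swap : {linear vec -> vec} := signU \o flipE.

Lemma swapE x : swap x = signU (flipE x). Proof. by []. Qed.

Lemma opU_comp c s c' s' x : opU c s (opU c' s' x) = opU (fun p => c' p * c (s' p)) (s \o s') x :> vec.
Proof.
apply: (@lin_ext _ (opU c s \o opU c' s') (opU (fun e => c' e * c (s' e)) (s \o s'))) => b.
by rewrite /= !opU_bv linearZ /= opU_bv scalerA.
Qed.

Lemma eq_opU c s c' s' x : (forall p, c p = c' p /\ (c p = 0 \/ s p = s' p)) ->
  opU c s x = opU c' s' x :> vec.
Proof.
move=> H; apply: eq_bigr => -[p e] _; have [E SZ] := H p.
apply: (congr1 (fun v => _ *: v)); rewrite /= -E.
case: SZ => [->|->]; last reflexivity.
exact: etrans (scale0r _) (esym (scale0r _)).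
Qed.

Lemma scale_opU k c s x : k *: opU c s x = opU (fun p => k * c p) s x :> vec.
Proof.
rewrite /opU /lext scaler_sumr; apply: eq_bigr => b _.
exact: scaler_swap.
Qed.

Lemma crL_signU i x : crL K i (signU x) = (if i == o3 then -1 else 1) *: signU (crL K i x).
Proof.
apply: (etrans (opU_comp _ _ _ _ _)).
apply: (etrans _ (esym (congr1 _ (opU_comp _ _ _ _ _)))).
apply: (etrans _ (esym (scale_opU _ _ _ _))).
apply: eq_opU => -[k J] /=; split; last by right.
rewrite !inE eq_sym; have [<-|_] /= := eqVneq i o3.
  by case: (i \in J); rewrite /= ?expr0 ?expr1; ring.
by ring.
Qed.
Lemma anL_signU i x : anL K i (signU x) = (if i == o3 then -1 else 1) *: signU (anL K i x).
Proof.
apply: (etrans (opU_comp _ _ _ _ _)).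
apply: (etrans _ (esym (congr1 _ (opU_comp _ _ _ _ _)))).
apply: (etrans _ (esym (scale_opU _ _ _ _))).
apply: eq_opU => -[k J] /=; split; last by right.
rewrite !inE eq_sym; have [<-|_] /= := eqVneq i o3.
  by case: (i \in J); rewrite /= ?expr0 ?expr1; ring.
by ring.
Qed.
Lemma thL_signU x : thL K (signU x) = signU (thL K x).
Proof.
apply: (etrans (opU_comp _ _ _ _ _)); apply: (etrans _ (esym (opU_comp _ _ _ _ _))).
by apply: eq_opU => -[k J] /=; split; [rewrite mulrC | right].
Qed.

Lemma RL_swap a b x : swap (RL K a b x) = RL K b a (swap x).
Proof.
have S y : RL K b a (signU y) = signU (RL K a b y).
  apply: Rop_swap => [c d z|c d z|z].
  - exact: (cA_swap o_uniq crL_signU).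
  - exact: (io_swap o_uniq anL_signU).
  - exact: thL_signU.
exact: etrans (congr1 signU (esym (RL_opE _ _ _ _ _))) (esym (S (flipE x))).
Qed.

Lemma signU_opEL c s x : signU (@opEL K c s x) = @opEL K c s (signU x).
Proof. exact: opUE. Qed.

Lemma px_flip s j x : flipE (px K s j x) = py K s j (flipE x).
Proof.
rewrite /px /py; case: s; case: j; apply: eq_opE2 => a1 a2 b1 b2 /=; by split; [ring | left].
Qed.
Lemma py_flip s j x : flipE (py K s j x) = px K s j (flipE x).
Proof.
rewrite /px /py; case: s; case: j; apply: eq_opE2 => a1 a2 b1 b2 /=; by split; [ring | left].
Qed.
Lemma px_pyC s t j k x : px K s j (py K t k x) = py K t k (px K s j x).
Proof.
rewrite /px /py; case: s; case: t; case: j; case: k; apply: eq_opE2 => a1 a2 b1 b2 /=;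
  by split; [ring | left].
Qed.

Lemma px_signU s j x : signU (px K s j x) = px K s j (signU x).
Proof. by rewrite /px; case: s; apply: signU_opEL. Qed.
Lemma py_signU s j x : signU (py K s j x) = py K s j (signU x).
Proof. by rewrite /py; case: s; apply: signU_opEL. Qed.

Lemma px_swap s j x : swap (px K s j x) = py K s j (swap x).
Proof. exact: etrans (congr1 signU (px_flip s j x)) (py_signU s j _). Qed.
Lemma py_swap s j x : swap (py K s j x) = px K s j (swap x).
Proof. exact: etrans (congr1 signU (py_flip s j x)) (px_signU s j _). Qed.

Lemma swapK x : swap (swap x) = x.
Proof.
have E : flipE (flipE x) = x.
  apply: etrans _ (opEL_id x); apply: opE_comp1 => a1 a2 b1 b2 /=.
  by split; [ring | left].
have S y : signU (signU y) = y.
  apply: (etrans (opU_comp _ _ _ _ _)).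
  apply: etrans _ (esym (vecE y)); apply: eq_bigr => -[[k J] e] _.
  by rewrite /= -expr2 sqrr_sign scale1r.
have F y : flipE (signU y) = signU (flipE y) by exact: esym (signU_opEL _ _ y).
apply: (etrans (swapE _)); apply: (etrans (congr1 (fun v => signU (flipE v)) (swapE x))).
apply: (etrans (congr1 signU (F (flipE x)))).
by apply: etrans (S x); apply: (congr1 (fun v => signU (signU v))).
Qed.

Lemma degm_swap m n x : degm m n x -> degm n m (swap x).
Proof.
move=> Mx; apply: degm_opU; apply: (degm_opE (m := m) (n := n)) Mx => a1 a2 b1 b2 Em En /=.
by right.
Qed.

Definition swX X := match X with VA => VA | VB => VD | VC => VC | VD => VB end.
Definition swv (v : vtx) : vtx := let: (X, m, n) := v in (swX X, n, m).
Lemma swvK v : swv (swv v) = v.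
Proof. by case: v => -[[] m] n. Qed.

Lemma nabla_swap X x : swap (nabla X x) = nabla (swX X) (swap x).
Proof.
apply: (etrans (congr1 swap (nabla_nab X x))).
apply: (etrans (nab_swap RL_swap px_swap py_swap px_pyC _ _ _)).
by apply: etrans _ (esym (nabla_nab _ _)); case: X.
Qed.
Lemma nabla2_swap X x : swap (nabla2 X x) = nabla2t (swX X) (swap x).
Proof.
apply: (etrans (congr1 swap (nabla2E X x))).
apply: (etrans (nab2_swap cl cs (bigraded_vec K) RL_swap px_swap _ _)).
by apply: etrans _ (esym (nabla2t_nab _ _)); case: X.
Qed.
Lemma nabla2t_swap X x : swap (nabla2t X x) = nabla2 (swX X) (swap x).
Proof.
have E : swap (nabla2 (swX X) (swap x)) = nabla2t X x.
  apply: (etrans (nabla2_swap _ _)); apply: etrans (congr1 (nabla2t _) (swapK x)) _.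
  by case: X.
exact: etrans (congr1 swap (esym E)) (swapK _).
Qed.
Lemma nabla3_swap x : swap (nabla3 x) = nabla3t (swap x).
Proof.
apply: (etrans (congr1 swap (nabla3_nab x))).
apply: (etrans (nab3_swap (bigraded_vec K) RL_swap px_swap py_swap _)).
exact: esym (nabla3t_nab _).
Qed.
Lemma nabla3t_swap x : swap (nabla3t x) = nabla3 (swap x).
Proof.
have E : swap (nabla3 (swap x)) = nabla3t x.
  exact: etrans (nabla3_swap _) (congr1 (@nabla3t K) (swapK x)).
exact: etrans (congr1 swap (esym E)) (swapK _).
Qed.

Lemma outmap_swap v x : swap (outmap v x) = outmap (swv v) (swap x).
Proof.
case: v => -[X m] n; case: X => /=.
- case: m => [|[|m]]; case: n => [|[|n]] /=.
  + exact: (@op0 _ _ swap).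
  + exact: nabla3_swap.
  + exact: nabla2t_swap.
  + exact: nabla3t_swap.
  + exact: nabla_swap.
  + exact: nabla_swap.
  + exact: nabla2_swap.
  + exact: nabla_swap.
  + exact: nabla_swap.
- by case: n => [|n] /=; [exact: nabla2_swap | exact: nabla_swap].
- exact: nabla_swap.
- by case: m => [|m] /=; [exact: nabla2t_swap | exact: nabla_swap].
Qed.

Lemma target_swap v w : target v = Some w -> target (swv v) = Some (swv w).
Proof.
case: v => -[X m] n; case: X => /=.
- by case: m => [|[|m]]; case: n => [|[|n]] //= [<-].
- by case: n => [|n] /= [<-].
- by move=> [<-].
- by case: m => [|m] /= [<-].
Qed.

Lemma inM_swap v x : inM v x -> inM (swv v) (swap x).
Proof. by case: v => -[X m] n; apply: degm_swap. Qed.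

Lemma homology_zero_swap v : homology_zero K v -> homology_zero K (swv v).
Proof.
move=> H x [Mx Ex].
have Ky : Ker v (swap x).
  split; first by rewrite -[v]swvK; apply: inM_swap.
  have := outmap_swap (swv v) x; rewrite swvK => E.
  apply: etrans (esym E) _; apply: etrans (congr1 swap Ex) _; exact: (@op0 _ _ swap).
case: (H _ Ky) => [E|[v' [z [Et Mz Ez]]]].
  by left; apply: etrans (esym (swapK x)) _; apply: etrans (congr1 swap E) _; exact: (@op0 _ _ swap).
right; exists (swv v'), (swap z); split; [exact: target_swap | exact: inM_swap |].
apply: etrans (esym (swapK x)) _; apply: etrans (congr1 swap Ez) _.
exact: outmap_swap.
Qed.
End Swap.

(** * The two vertices with homology *)

Lemma lin_comb2 (K : ringType) (V : lmodType K) (k c d : K) (v s t : V) :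
  k *: (c *: v + s) + (d *: v + t) = (k * c + d) *: v + (k *: s + t).
Proof. by rewrite scalerDr scalerA scalerDl addrACA. Qed.

Lemma lin_comb4 (K : ringType) (V : lmodType K) (k : K) (x y z t x' y' z' t' : V) :
  k *: x + x' + (k *: y + y') + (k *: z + z' + (k *: t + t')) =
  k *: (x + y + (z + t)) + (x' + y' + (z' + t')).
Proof. rewrite !scalerDr.
exact: etrans (f_equal2 _ (addrACA _ _ _ _) (addrACA _ _ _ _)) (addrACA _ _ _ _). Qed.

Lemma halves (K : numClosedFieldType) (V : lmodType K) (k : K) (u v w : V) : k != 0 ->
  v - w = k *: u + k *: u -> u = (2 * k)^-1 *: v + (2 * k)^-1 *: - w.
Proof.
move=> k0 E; rewrite -scalerDr E -scalerDl -(mulr2n k) -(mulr_natl k 2) scalerA mulVf ?scale1r //.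
by rewrite mulf_neq0 ?pnatr_eq0.
Qed.

Section EtaOfW.
Variables (K : numClosedFieldType) (V : lmodType K) (u v : V).
Let N := @neq0Ci K.

Lemma eta_of_w :
  [/\ u = (2 * 'i)^-1 *: (v + 'i *: u) + (2 * 'i)^-1 *: - (v - 'i *: u),
      v = (2 * 1)^-1 *: (v + 'i *: u) + (2 * 1)^-1 *: (v - 'i *: u),
      u = (2 * 'i)^-1 *: (- v + 'i *: u) + (2 * 'i)^-1 *: (v + 'i *: u) &
      v = (2 * 1)^-1 *: - (- v + 'i *: u) + (2 * 1)^-1 *: (v + 'i *: u)].
Proof.
split.
- by apply: halves N _; rewrite opprB (addrC v) addrACA subrr addr0.
- rewrite -[v - _]opprK; apply: halves (oner_neq0 _) _.
  by rewrite opprK addrACA ?subrr ?addNr addr0 scale1r.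
- rewrite -[v + _]opprK; apply: halves N _.
  by rewrite opprK addrACA addNr add0r.
- rewrite -[v + _]opprK; apply: halves (oner_neq0 _) _.
  by rewrite opprD !opprK addrACA addNr addr0 scale1r.
Qed.
End EtaOfW.

(** * The augmentation ideal of U(g_<0) *)

Section Augmentation.
Variable K : numClosedFieldType.
Implicit Types (x y z : vec K) (J : {set 'I_4}) (i : 'I_4).
Notation vec := (vec K).
Notation bv := (@bv K).
Notation RL := (@RL K).
Notation sgn := (@sgn K).
Let cl := @coef_lin K.
Let cs := @coef_sep K.
Notation e0 := (0, 0, 0, 0)%N.
Notation vac := (bv (0%N, set0, e0)).
Notation rm i := (rmul (NEta i)).

Lemma coef_linE (f g : {linear vec -> vec}) (k : K) d d' x :
  (forall b, (f (bv b))@_d = k * (g (bv b))@_d') -> (f x)@_d = k * (g x)@_d'.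
Proof.
move=> H; rewrite [in LHS](vecE x) [in RHS](vecE x) 2!lin_sum.
rewrite !(raddf_sum (mcoeff _)) /= mulr_sumr; apply: eq_bigr => b _.
by rewrite (opZ f) (opZ g) !mcoeffZ H mulrCA.
Qed.

Lemma coef_rmul_out i J e x : i \notin J -> (rm i x)@_(0%N, J, e) = 0.
Proof.
move=> iJ; suff H : (rm i x)@_(0%N, J, e) = 0 * (rm i x)@_(0%N, J, e) by rewrite H mul0r.
apply: (@coef_linE (rm i) (rm i) 0) => -[[k J'] e']; rewrite mul0r /= [rmul _ _]lext_bv /=.
case: ifP => iJ'; rewrite mcoeffZ coef_bv !xpair_eqE /= ?mulr0 //.
case: (i |: J' =P J) => [/setP/(_ i)|_]; last by rewrite andbF mulr0.
by rewrite setU11 (negbTE iJ).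
Qed.

Lemma coef_rmul_in i J e x : i \in J ->
  (rm i x)@_(0%N, J, e) = sgn (cnt_gt (J :\ i) i) * x@_(0%N, J :\ i, e).
Proof.
move=> iJ; apply: (@coef_linE (rm i) idfun) => -[[k J'] e']; rewrite /= [rmul _ _]lext_bv /=.
have [iJ'|iJ'] /= := boolP (i \in J'); rewrite mcoeffZ !coef_bv !xpair_eqE /=.
  case: (J' =P J :\ i) => [E|_]; last by rewrite andbF !mulr0.
  by rewrite E !inE eqxx in iJ'.
have -> : (i |: J' == J) = (J' == J :\ i).
  by apply/eqP/eqP => [<-|->]; rewrite ?setU1K ?setD1K.
have [->//|_] := eqVneq J' (J :\ i).
by rewrite andbF !mulr0.
Qed.

Lemma RLE a b x : RL a b x = \sum_(p <- w K a b) p.1 *: rm p.2 x.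
Proof. exact: esym (rmulwE a b x). Qed.

Lemma RL_eta a b x : RL a b x = match a, b with
  | false, false => rm (o1) x + 'i *: rm o0 x
  | true, true => rm o1 x - 'i *: rm o0 x
  | false, true => - rm o3 x + 'i *: rm o2 x
  | true, false => rm o3 x + 'i *: rm o2 x
  end.
Proof.
apply: (etrans (RLE _ _ _)); rewrite /w; case: a; case: b; rewrite unlock /= -/o0 -/o1 -/o2 -/o3;
  generalize (rm o0 x) (rm o1 x) (rm o2 x) (rm o3 x) => r0 r1 r2 r3;
  coefs_with cl cs; ring.
Qed.

Lemma coef_RL_out a b e x : (RL a b x)@_(0%N, set0, e) = 0.
Proof.
by rewrite RLE (raddf_sum (mcoeff _)) big1 //= => p _; rewrite mcoeffZ coef_rmul_out ?inE ?mulr0.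
Qed.

Definition sumR (F : bool -> bool -> vec) : vec :=
  RL false false (F false false) + RL false true (F false true)
  + (RL true false (F true false) + RL true true (F true true)).

(** Constants plus the left ideal generated by the w_ab. This is everything, because the eta_i are
    combinations of the w_ab and Theta = -2 eta_1^2. *)
Definition augmented x := exists c F, [/\ forall a b, degm 0 0 (F a b) & x = c *: vac + sumR F].

Lemma sumR_lin k F G : sumR (fun a b => k *: F a b + G a b) = k *: sumR F + sumR G.
Proof.
have E a b : RL a b (k *: F a b + G a b) = k *: RL a b (F a b) + RL a b (G a b).
  exact: linearP.
rewrite /sumR.
apply: (etrans (f_equal2 _ (f_equal2 _ (E _ _) (E _ _)) (f_equal2 _ (E _ _) (E _ _)))).
exact: lin_comb4.
Qed.

Lemma augmented_sub : subspace augmented.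
Proof.
split.
  exists 0, (fun _ _ => 0); split=> [a b|]; first exact: (degm_sub K 0 0).1.
  have E a b : RL a b 0 = 0 by exact: linear0.
  rewrite /sumR; apply: esym; rewrite scale0r add0r.
  apply: (etrans (f_equal2 _ (f_equal2 _ (E _ _) (E _ _)) (f_equal2 _ (E _ _) (E _ _)))).
  by rewrite !addr0.
move=> k _ _ [c [F [MF ->]]] [d [G [MG ->]]].
exists (k * c + d), (fun a b => k *: F a b + G a b); split=> [a b|].
  exact: (degm_sub K 0 0).2.
apply: etrans _ (esym (congr1 (fun v => _ + v) (sumR_lin k F G))).
exact: lin_comb2.
Qed.

Lemma augmented_RL a b x : degm 0 0 x -> augmented (RL a b x).
Proof.
move=> Mx; exists 0, (fun c d => if (c == a) && (d == b) then x else 0); split=> [c d|].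
  by case: ifP => // _; exact: (degm_sub K 0 0).1.
have E c d : RL c d (if (c == a) && (d == b) then x else 0) =
    if (c == a) && (d == b) then RL a b x else 0.
  by case: ifP => [/andP[/eqP-> /eqP->]|_]; [reflexivity | exact: linear0].
apply: etrans _ (congr1 (fun v => _ + v) (esym
  (f_equal2 _ (f_equal2 _ (E _ _) (E _ _)) (f_equal2 _ (E _ _) (E _ _))))).
rewrite scale0r add0r; generalize (RL a b x) => y.
by case: a {E}; case: b; rewrite /= ?addr0 ?add0r; reflexivity.
Qed.

Lemma o_cases i : [\/ i = o0, i = o1, i = o2 | i = o3].
Proof.
by case: i => [[|[|[|[|//]]]]] H; [constructor 1 | constructor 2 | constructor 3 | constructor 4];
  apply: val_inj; rewrite /= /o0 /o1 /o2 /o3 inordK.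
Qed.

Lemma augmented_rm i x : degm 0 0 x -> augmented (rm i x).
Proof.
move=> Mx; have A a b := augmented_RL a b Mx; have SS := augmented_sub.
have N2 : (2 : K) != 0 by rewrite pnatr_eq0.
have NI : ('i : K) != 0 by exact: neq0Ci.
have Half u v k : k != 0 -> rm i x = (2 * k)^-1 *: u + (2 * k)^-1 *: v -> 
    augmented u -> augmented v -> augmented (rm i x).
  by move=> k0 -> Au Av; apply: (subD SS); apply: (subZ _ SS).
have [E0 E1 _ _] := eta_of_w (rm o0 x) (rm o1 x); have [_ _ E2 E3] := eta_of_w (rm o2 x) (rm o3 x).
case: (o_cases i) => Ei.
- apply: (Half (RL false false x) (- RL true true x) 'i NI _ (A _ _) (subN SS (A _ _))).
  by rewrite 2!RL_eta Ei; exact: E0.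
- apply: (Half (RL false false x) (RL true true x) 1 (oner_neq0 _) _ (A _ _) (A _ _)).
  by rewrite 2!RL_eta Ei; exact: E1.
- apply: (Half (RL false true x) (RL true false x) 'i NI _ (A _ _) (A _ _)).
  by rewrite 2!RL_eta Ei; exact: E2.
- apply: (Half (- RL false true x) (RL true false x) 1 (oner_neq0 _) _ (subN SS (A _ _)) (A _ _)).
  by rewrite 2!RL_eta Ei; exact: E3.
Qed.

Lemma sgn_neq0 n : sgn n != 0. Proof. by rewrite /Defs.sgn signr_eq0. Qed.

Lemma augmented_bv k J : augmented (bv (k, J, e0)).
Proof.
have SS := augmented_sub.
have A i k' J' : augmented (rmulb K (NEta i) (k', J', e0)).
  by rewrite -[rmulb _ _ _]lext_bv; apply: augmented_rm; apply: degm_bv.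
have [->|[i iJ]] := set_0Vmem J.
  case: k => [|k].
    exists 1, (fun _ _ => 0); split=> [a b|]; first exact: (degm_sub K 0 0).1.
    have E a b : RL a b 0 = 0 by exact: linear0.
    rewrite scale1r /sumR; apply: esym.
    apply: (etrans (congr1 (fun v => vac + v)
      (f_equal2 _ (f_equal2 _ (E _ _) (E _ _)) (f_equal2 _ (E _ _) (E _ _))))).
    by rewrite !addr0.
  (* A power of Theta is reached as Theta^k eta_1 times eta_1. *)
  have := A o0 k [set o0]; rewrite /= inE eqxx /= setDv.
  set c := _ * _ => /(subZ c^-1 SS); rewrite scalerA mulVf ?scale1r //.
  by rewrite mulf_neq0 ?sgn_neq0 // oppr_eq0 invr_eq0 pnatr_eq0.
have := A i k (J :\ i); rewrite /= !inE eqxx /= setD1K //.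
by move=> /(subZ (sgn (cnt_gt (J :\ i) i))^-1 SS); rewrite scalerA mulVf ?scale1r // sgn_neq0.
Qed.

Lemma degm_ind (Q : vec -> Prop) x : subspace Q -> (forall k J, Q (bv (k, J, e0))) -> degm 0 0 x -> Q x.
Proof.
move=> SQ Qb Mx; rewrite (vecE x) big_seq; elim/big_ind: _ => [|u v Qu Qv|b bx].
- exact: SQ.1.
- exact: (subD SQ).
apply: (subZ _ SQ); have := Mx b; rewrite mcoeff_neq0 bx.
case: b {bx} => -[k J] [[[a1 a2] b1] b2] /(_ isT) [].
move=> /eqP; rewrite addn_eq0 => /andP[/eqP-> /eqP->].
by move=> /eqP; rewrite addn_eq0 => /andP[/eqP-> /eqP->].
Qed.

Lemma augmentedP x : degm 0 0 x -> augmented x.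
Proof. exact: (degm_ind augmented_sub augmented_bv). Qed.

Lemma coef_sumR F e : (sumR F)@_(0%N, set0, e) = 0.
Proof.
have C x y : (x + y)@_(0%N, set0, e) = x@_(0%N, set0, e) + y@_(0%N, set0, e) := mcoeffD _ _ _.
apply: etrans (C _ _) _; apply: etrans (f_equal2 _ (C _ _) (C _ _)) _.
apply: etrans (f_equal2 _ (f_equal2 _ (coef_RL_out _ _ _ _) (coef_RL_out _ _ _ _))
  (f_equal2 _ (coef_RL_out _ _ _ _) (coef_RL_out _ _ _ _))) _.
by rewrite !addr0.
Qed.

Lemma aug_coef x : degm 0 0 x -> x@_(0%N, set0, e0) = 0 ->
  exists F, (forall a b, degm 0 0 (F a b)) /\ x = sumR F.
Proof.
move=> /augmentedP[c [F [MF ->]]] E; exists F; split=> //.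
suff -> : c = 0 by apply: etrans (congr1 (fun v => v + _) (scale0r _)) (add0r _).
apply: etrans _ E; apply: esym; apply: etrans (mcoeffD _ _ _) _.
apply: etrans (f_equal2 _ (mcoeffZ _ _ _) (coef_sumR _ _)) _.
by rewrite addr0 coef_bv eqxx mulr1.
Qed.
End Augmentation.

(** * Homology at M_A^(0,0) *)

Section Trivial.
Variable K : numClosedFieldType.
Implicit Types (x y z : vec K) (J : {set 'I_4}) (i : 'I_4).
Notation vec := (vec K).
Notation bv := (@bv K).
Notation RL := (@RL K).
Notation sgn := (@sgn K).
Let cl := @coef_lin K.
Notation e0 := (0, 0, 0, 0)%N.
Notation vac := (bv (0%N, set0, e0)).

Lemma nabla_sumR X x :
  nabla X x = sumR (fun a b => px K (sx X) a (py K (sy X) b x)).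
Proof. exact: etrans (nablaE X x) (addrACA _ _ _ _). Qed.

Lemma sumR_ext (F G : bool -> bool -> vec) : (forall a b, F a b = G a b) -> sumR F = sumR G.
Proof. by move=> H; rewrite /sumR !H. Qed.

Lemma scale_bv_eq (c c' : K) k J e e' : c = c' /\ (e = e' \/ c = 0) ->
  c *: bv (k, J, e) = c' *: bv (k, J, e').
Proof.
move=> [<-] [->|->]; first reflexivity.
exact: etrans (scale0r _) (esym (scale0r _)).
Qed.

Lemma pq_A00 a b c d x : degm 0 0 x ->
  pX K a (pY K b (mX K c (mY K d x))) = ((a == c) && (b == d))%:R *: x.
Proof.
move=> Mx; pose k : K := ((a == c) && (b == d))%:R.
apply: (@lin_ext_on _ (pX K a \o (pY K b \o (mX K c \o mY K d))) (k \*: idfun)) => e /Mx.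
case: e => -[k' J] [[[a1 a2] b1] b2] [].
move=> /eqP; rewrite addn_eq0 => /andP[/eqP-> /eqP->].
move=> /eqP; rewrite addn_eq0 => /andP[/eqP-> /eqP->].
rewrite /pX /pY /mX /mY /= opEL2_bv mul1r scale1r opEL2_bv {}/k.
apply: scale_bv_eq; case: a; case: b; case: c; case: d => /=.
all: by split; [rewrite ?(mul1r, mulr1, mul0r, mulr0) | first [by left | by right; rewrite ?(mul0r, mulr0)]].
Qed.

Lemma Img_A00 x : degm 0 0 x -> x@_(0%N, set0, e0) = 0 -> Img (VA, 0, 0)%N x.
Proof.
move=> Mx /(aug_coef Mx)[F [MF E]].
(* The preimage of the sum of the F_cd w_cd is the sum of the F_cd x_c y_d: on degree 0 the
   derivatives just select coefficients. *)
pose Y c d := mX K c (mY K d (F c d)).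
pose y := Y false false + Y false true + (Y true false + Y true true).
right; exists (VA, 1, 1)%N, y; split=> //.
  have MY c d : degm 1 1 (Y c d).
    have M1 : degm 0 1 (mY K d (F c d)).
      by apply: (degm_opE _ (MF c d)) => a1 a2 b1 b2 Em En; right; case: d; rewrite ?addnS ?addSn En.
    by apply: (degm_opE _ M1) => a1 a2 b1 b2 Em En; right; case: (c); rewrite ?addnS ?addSn Em.
  have SS := degm_sub K 1 1.
  exact: (subD SS (subD SS (MY _ _) (MY _ _)) (subD SS (MY _ _) (MY _ _))).
apply: etrans E _; apply: etrans _ (esym (nabla_sumR VA y)); apply: sumR_ext => a b.
have P c d : pX K a (pY K b (Y c d)) = ((a == c) && (b == d))%:R *: F c d by exact: pq_A00.
have D (f : {linear vec -> vec}) u v : f (u + v) = f u + f v by exact: linearD.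
have Q : pX K a (pY K b y) = pX K a (pY K b (Y false false)) + pX K a (pY K b (Y false true))
   + (pX K a (pY K b (Y true false)) + pX K a (pY K b (Y true true))).
  have Dp u v : pX K a (pY K b (u + v)) = pX K a (pY K b u) + pX K a (pY K b v).
    exact: etrans (congr1 _ (D _ _ _)) (D _ _ _).
  exact: etrans (Dp _ _) (f_equal2 _ (Dp _ _) (Dp _ _)).
apply: esym; apply: etrans Q _.
apply: etrans (f_equal2 _ (f_equal2 _ (P _ _) (P _ _)) (f_equal2 _ (P _ _) (P _ _))) _.
case: (a); case: (b) => /=; rewrite ?scale0r ?scale1r ?addr0 ?add0r; reflexivity.
Qed.

Lemma coef_nabla_A x : (nabla VA x)@_(0%N, set0, e0) = 0.
Proof. exact: etrans (congr1 (mcoeff _) (nabla_sumR _ _)) (coef_sumR _ _). Qed.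

Lemma Img_A00_coef x : Img (VA, 0, 0)%N x -> x@_(0%N, set0, e0) = 0.
Proof.
case=> [->|[[[X m] n] [z [E Mz ->]]]]; first exact: mcoeff0.
(* The only arrow into this vertex starts at M_A^(1,1). *)
have -> : (X, m, n) = (VA, 1, 1)%N.
  case: X E {Mz} => /=.
  - by case: m => [|[|m]]; case: n => [|[|n]].
  - by case: n.
  - by [].
  - by case: m.
exact: coef_nabla_A.
Qed.

(** Left multiplication by a generator never produces the basis vector 1, and g_0 acts on it by zero
    because all exponents and both shifts vanish. So the action always lands in the augmentation
    ideal. *)
Lemma act_subspace_A a x : degm 0 0 x ->
  degm 0 0 (act VA a x) /\ (act VA a x)@_(0%N, set0, e0) = 0.
Proof.
pose Z y := degm 0 0 y /\ y@_(0%N, set0, e0) = 0.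
have SZ : subspace Z.
  split; first by split; [exact: (degm_sub K 0 0).1 | exact: mcoeff0].
  move=> k u v [Mu Eu] [Mv Ev]; split; first exact: (degm_sub K 0 0).2.
  by apply: etrans (cl _ _ _ _) _; rewrite /coef Eu Ev mulr0 addr0.
have Zb k J : (k, J) != (0%N, set0) -> Z (bv (k, J, e0)).
  move=> kJ; split; first exact: degm_bv.
  by rewrite coef_bv !xpair_eqE eqxx andbT -xpair_eqE (negbTE kJ).
have Zl g u : Z u -> Z (lmul g u).
  move=> [Mu _]; apply: (degm_ind (Q := fun u => Z (lmul g u))) Mu; last first.
    move=> k J; rewrite [lmul _ _]lext_bv; case: g => [|i] /=; first exact: Zb.
    case: ifP => iJ; apply: (subZ _ SZ); apply: Zb; rewrite xpair_eqE negb_and //.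
    by apply/orP; right; apply/set0Pn; exists i; exact: setU11.
  have L k u' v : lmul g (k *: u' + v) = k *: lmul g u' + lmul g v by exact: linearP.
  split; first by rewrite (_ : lmul g (0 : vec) = 0); [exact: SZ.1 | exact: linear0].
  by move=> k u' v Zu Zv; rewrite L; apply: SZ.2.
have Z0 b : Z (act0 K VA b e0).
  have m0 (c : K) e : c = 0 -> Z (mvec c e).
    by move=> ->; rewrite (_ : mvec (0 : K) e = 0); [exact: SZ.1 | exact: scale0r].
  have Zr : Z (rho K VA b e0).
    case: b => [|m J]; first by apply: m0; rewrite /= subrr mul0r addr0.
    have Zh : [/\ Z (ex_op K false e0), Z (fx_op K false e0) & Z (hx_op K false e0)].
      by split; apply: m0; rewrite ?subrr.
    have Zk : [/\ Z (ey_op K false e0), Z (fy_op K false e0) & Z (hy_op K false e0)].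
      by split; apply: m0; rewrite ?subrr.
    have ZN u v := @subB _ _ Z u v SZ; have ZD u v := @subD _ _ Z u v SZ.
    have [[ZE ZF ZH] [ZE' ZF' ZH']] := (Zh, Zk).
    have Zall : Z (if J == [set inord 0; inord 1] then i2 K *: (hx_op K false e0 + hy_op K false e0)
      else if J == [set inord 2; inord 3] then (- i2 K) *: (hx_op K false e0 - hy_op K false e0)
      else if J == [set inord 0; inord 2] then
        (- h2 K) *: (ex_op K false e0 - fx_op K false e0 + ey_op K false e0 - fy_op K false e0)
      else if J == [set inord 1; inord 3] then
        h2 K *: (ey_op K false e0 - fy_op K false e0 - ex_op K false e0 + fx_op K false e0)
      else if J == [set inord 0; inord 3] then
        (- i2 K) *: (ey_op K false e0 + fy_op K false e0 - ex_op K false e0 - fx_op K false e0)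
      else if J == [set inord 1; inord 2] then
        (- i2 K) *: (ex_op K false e0 + fx_op K false e0 + ey_op K false e0 + fy_op K false e0)
      else 0).
      do 6 (case: ifP => _; first by apply: (subZ _ SZ); auto).
      exact: SZ.1.
    case: m => [|[|m]]; [exact: Zall | | exact: Zall].
    by apply: m0; rewrite /= mulr0n !addr0 oppr0 mul0r.
  case: b Zr => [//|m J] Zr /=.
  case: ifP => [J0|_]; last by case: ifP => _; [exact: Zr | exact: SZ.1].
  by apply: Zb; rewrite xpair_eqE; case: (J == set0).
have Zw w b : Z (actw K VA w b e0).
  elim: w b => [|g w IH] b /=; first exact: Z0.
  apply: (subD SZ); first by apply: (subZ _ SZ); apply: Zl.
  elim/big_ind: _ => [|u v|cb _]; [exact: SZ.1 | exact: (subD SZ) |].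
  exact: (subZ _ SZ).
move=> Mx; apply: (degm_ind (Q := fun x => Z (act VA a x))) Mx.
  have L k u v : act VA a (k *: u + v) = k *: act VA a u + act VA a v by exact: lext_is_linear.
  split; last by move=> k u v Zu Zv; rewrite L; apply: SZ.2.
  have -> : act VA a (0 : vec) = 0 by exact: (linear0 (lext (actb K VA a))).
  exact: SZ.1.
by move=> k J; rewrite [act _ _ _]lext_bv; apply: Zw.
Qed.

Lemma homology_A00 : homology_trivial1 K (VA, 0, 0)%N.
Proof.
have M0 : degm 0 0 vac by exact: degm_bv.
split.
  exists vac; split.
  - by split.
  - by move/Img_A00_coef/eqP; rewrite coef_bv eqxx oner_eq0.
  - move=> x [Mx _]; exists x@_(0%N, set0, e0); apply: Img_A00.
      exact: (subB (degm_sub K 0 0) Mx (subZ _ (degm_sub K 0 0) M0)).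
    apply: etrans (mcoeffB _ _ _) _; rewrite mcoeffZ coef_bv eqxx mulr1; exact: subrr.
move=> a x [Mx _]; have [? ?] := act_subspace_A a Mx; exact: Img_A00.
Qed.
End Trivial.

Lemma lin_fun0 (R : ringType) (U V : lmodType R) (f : U -> V) :
  (forall k x y, f (k *: x + y) = k *: f x + f y) -> f 0 = 0.
Proof. by move=> /(_ (-1) 0 0) /=; rewrite scaler0 addr0 scaleN1r addNr. Qed.

(** * The extra class at M_C^(-1,-1) *)

Section C11.
Variable K : numClosedFieldType.
Implicit Types (x y z : vec K) (J : {set 'I_4}) (i : 'I_4).
Notation vec := (vec K).
Notation bv := (@bv K).
Notation RL := (@RL K).
Notation sgn := (@sgn K).
Let cl := @coef_lin K.
Let cs := @coef_sep K.
Notation e0 := (0, 0, 0, 0)%N.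
Notation vac := (bv (0%N, set0, e0)).
Notation rm i := (rmul (NEta i)).
Notation nab := (nab RL (px K) (py K)).

Definition nablaL X : {linear vec -> vec} :=
  (DL K X false \o py K (sy X) false) \+ (DL K X true \o py K (sy X) true).
Lemma nablaLE X x : nabla X x = nablaL X x.
Proof. exact: nablaE. Qed.

Definition extraL : vec -> vec := extra RL (px K) (yput K).
Lemma extraL_lin k x y : extraL (k *: x + y) = k *: extraL x + extraL y.
Proof. exact: extra_is_linear. Qed.

Definition imC x := exists2 u, degm 0 0 u & x = nabla VC u.

Lemma imC_sub : subspace imC.
Proof.
split; first by exists 0; [exact: (degm_sub K 0 0).1 | apply: esym; apply: etrans (nablaLE _ _) (linear0 (nablaL VC))].
move=> k _ _ [u Mu ->] [v Mv ->]; exists (k *: u + v); first exact: (degm_sub K 0 0).2.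
apply: etrans (f_equal2 _ (congr1 _ (nablaLE _ _)) (nablaLE _ _)) _.
apply: etrans _ (esym (nablaLE _ _)); exact: esym (linearP (nablaL VC) k u v).
Qed.

(** Modulo the image only the constant term of z matters, since [extra_R] sends every multiple of a
    w_ab into the image. *)
Lemma extra_span z : degm 0 0 z -> exists c, imC (extraL z - c *: extraL vac).
Proof.
pose E z := exists c, imC (extraL z - c *: extraL vac).
have SS := imC_sub.
have SE : subspace E.
  split; first by exists 0; rewrite scale0r subr0; rewrite (_ : extraL 0 = 0); [exact: SS.1 | exact: (lin_fun0 extraL_lin)].
  move=> k x y [c Ix] [d Iy]; exists (k * c + d).
  rewrite extraL_lin.
  rewrite (_ : _ - _ = k *: (extraL x - c *: extraL vac) + (extraL y - d *: extraL vac)).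
    exact: SS.2.
  generalize (extraL x) (extraL y) (extraL vac) => *.
  by rewrite scalerBr scalerA scalerDl opprD addrACA.
have ER a b y : degm 0 0 y -> E (RL a b y).
  move=> My; have [v [Mv Ev]] := extra_R cl cs (bigraded_vec K) a b My.
  exists 0; rewrite scale0r subr0; exists v => //.
  exact: etrans Ev (esym (nabla_nab VC v)).
move=> /augmentedP[c [F [MF ->]]].
apply: (subD SE); last first.
  by apply: (subD SE); apply: (subD SE); apply: ER.
apply: (subZ _ SE); exists 1; rewrite scale1r subrr; exact: SS.1.
Qed.

Lemma ker_C11_span x : degm 1 1 x -> nabla VC x = 0 -> exists c, imC (x - c *: extraL vac).
Proof.
move=> Mx Nx; have [|u [z [Mu Mz Ex]]] := ker_C11 cl cs (bigraded_vec K) Mx.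
  exact: etrans (esym (nabla_nab VC x)) Nx.
have [c Iz] := extra_span Mz; exists c.
rewrite (_ : x - _ = nabla VC u + (extraL z - c *: extraL vac)).
  by apply: (subD imC_sub) => //; exists u.
apply: etrans (congr1 (fun v => v - _) Ex) _; rewrite addrA.
exact: (congr1 (fun v => v + _ - _) (esym (nabla_nab VC u))).
Qed.

Lemma Img_C11 x : Img (VC, 1, 1)%N x <-> imC x.
Proof.
split=> [|[u Mu ->]]; last by right; exists (VC, 0, 0)%N, u.
case=> [->|[[[X m] n] [z [E Mz ->]]]]; first exact: imC_sub.1.
have Ev : (X, m, n) = (VC, 0, 0)%N.
  case: X E {Mz} => /=.
  - by case: m => [|[|m]]; case: n => [|[|n]].
  - by case: n => // [[]]; rewrite addn2.
  - by case=> -> ->.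
  - by case: m => // [[]]; rewrite addn2.
by case: Ev Mz => -> -> -> Mz; exists z.
Qed.

Lemma o_neq (i j : nat) : (i < 4)%N -> (j < 4)%N -> i != j -> @inord 3 i != inord j.
Proof. by move=> Hi Hj; apply: contraNneq => /(congr1 val); rewrite /= !inordK // => ->. Qed.

Lemma coef_RLE a b x d : coef d (RL a b x) = match a, b with
  | false, false => coef d (rm o1 x) + 'i * coef d (rm o0 x)
  | true, true => coef d (rm o1 x) - 'i * coef d (rm o0 x)
  | false, true => - coef d (rm o3 x) + 'i * coef d (rm o2 x)
  | true, false => coef d (rm o3 x) + 'i * coef d (rm o2 x)
  end.
Proof.
apply: etrans (congr1 (coef d) (RL_eta a b x)) _.
by case: a; case: b; rewrite !(coD cl, coN cl, coZ cl).
Qed.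

Lemma gt_set1 i : cnt_gt ([set i] :\ i) i = 0%N.
Proof. by apply/eqP; rewrite setDv cards_eq0; apply/eqP/setP => k; rewrite !inE. Qed.

Lemma sets01 : [/\ o0 != o1, [set o0; o1] :\ o0 = [set o1], [set o0; o1] :\ o1 = [set o0],
  cnt_gt [set o0] o1 = 0%N & cnt_gt [set o1] o0 = 1%N].
Proof.
have n01 : o0 != o1 by exact: o_neq.
split=> //.
- by apply/setP => k; rewrite !inE; case: eqVneq => [->|]//; rewrite (negbTE n01).
- by apply/setP => k; rewrite !inE orbC; case: eqVneq => [->|]//; rewrite eq_sym (negbTE n01).
- apply/eqP; rewrite cards_eq0; apply/eqP/setP => k; rewrite !inE.
  by case: eqP => // ->; rewrite /o0 /o1 !inordK.
- rewrite /cnt_gt (_ : [set _ in _ | _] = [set o1]) ?cards1 //; apply/setP => k; rewrite !inE.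
  by case: eqP => // ->; rewrite /o0 /o1 !inordK.
Qed.

Lemma coef_rm1 i e : (rm i (bv (0%N, set0, e)))@_(0%N, [set i], e) = 1.
Proof. by rewrite coef_rmul_in ?inE // gt_set1 setDv coef_bv eqxx mulr1. Qed.

(** The coefficient of eta_1 eta_2 at Theta^0 decides. It vanishes on multiples of w_21 or w_12,
    which bring in eta_3 or eta_4, hence on w_12 w_21 and on the multiples of w_11 w_21 and w_12
    w_22; on w_11 w_22 it equals 2 i. *)
Lemma extra_vac_notin : ~ imC (extraL vac).
Proof.
case=> u Mu E; have Mv : degm 0 0 vac by exact: degm_bv.
have [|a [b Eab]] := extra_nab cl cs (bigraded_vec K) Mv Mu.
  exact: etrans E (nabla_nab VC u).
have n02 : o0 \notin [set o2; o3] by rewrite !inE negb_or !o_neq.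
pose J := [set o0; o1]; pose c (x : vec) : K := coef (0%N, J, e0) x.
have J2 : o2 \notin J by rewrite !inE negb_or !o_neq.
have J3 : o3 \notin J by rewrite !inE negb_or !o_neq.
have c0 x : c (RL true false x) = 0 /\ c (RL false true x) = 0.
  have H2 : c (rm o2 x) = 0 := coef_rmul_out e0 x J2.
  have H3 : c (rm o3 x) = 0 := coef_rmul_out e0 x J3.
  split; apply: etrans (coef_RLE _ _ _ _) _.
    by apply: etrans (f_equal2 (fun p q => p + 'i * q) H3 H2) _; rewrite mulr0 addr0.
  by apply: etrans (f_equal2 (fun p q => - p + 'i * q) H3 H2) _; rewrite mulr0 oppr0 addr0.
have cD x y : c (x + y) = c x + c y := coD cl _ _ _.
have cN x : c (- x) = - c x := coN cl _ _.
have S x y : c (RL true false x + y) = c y.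
  by apply: etrans (cD _ _) _; apply: etrans (f_equal2 _ (c0 x).1 (erefl _)) (add0r _).
(* Since w_12 and w_22 anticommute, w_12 can be made the last factor. *)
have Z : c (RL true true (RL false true b)) = 0.
  apply: etrans (congr1 c (RL_RL true true false true b)) _.
  apply: etrans (cD _ _) _; apply: etrans (f_equal2 _ (coZ cl _ _ _) (cN _)) _.
  apply: etrans (f_equal2 (fun p q => p - q) (erefl _) (c0 _).2) _.
  by rewrite mul0r mul0r subr0.
have H : c (RL true true (RL false false vac)) = 0.
  apply: etrans (esym (S (RL false true vac) _)) _.
  apply: etrans (congr1 c Eab) _.
  exact: etrans (S (RL false false a) (RL true true (RL false true b))) Z.
have [n01 D0 D1 g0 g1] := sets01.
have J0 : o0 \in J by rewrite !inE eqxx.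
have J1 : o1 \in J by rewrite !inE eqxx orbT.
pose y : vec := RL false false vac.
have rs i := coef_rm1 i e0.
have rn i k : i != k -> (rm i vac)@_(0%N, [set k], e0) = 0.
  by move=> ik; apply: coef_rmul_out; rewrite inE.
have y0 : y@_(0%N, [set o0], e0) = 'i.
  apply: etrans (coef_RLE _ _ _ _) _.
  apply: etrans (f_equal2 (fun p q => p + 'i * q) (rn o1 o0 _) (rs o0)) _.
    by rewrite eq_sym.
  by rewrite add0r mulr1.
have y1 : y@_(0%N, [set o1], e0) = 1.
  apply: etrans (coef_RLE _ _ _ _) _.
  by apply: etrans (f_equal2 (fun p q => p + 'i * q) (rs o1) (rn o0 o1 n01)) _; rewrite mulr0 addr0.
have c1 : c (rm o1 y) = 'i.
  by apply: etrans (coef_rmul_in e0 y J1) _; rewrite D1 g0 y0 /Defs.sgn expr0 mul1r.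
have c2 : c (rm o0 y) = -1.
  by apply: etrans (coef_rmul_in e0 y J0) _; rewrite D0 g1 y1 /Defs.sgn expr1 mulr1.
have := etrans (esym (coef_RLE true true y (0%N, J, e0))) H.
move=> /(etrans (esym (f_equal2 (fun p q => p - 'i * q) c1 c2))) /eqP.
by rewrite mulrN1 opprK -mulr2n mulrn_eq0 /= (negbTE (@neq0Ci K)).
Qed.
End C11.

(** * The action on the homology at M_C^(-1,-1) *)

(* Computable model: [(a, b, n)] stands for [(a + 'i b) / 2 ^ n] and a Grassmann
   monomial is given by its four membership bits. *)
Notation Z := BinNums.Z.
Notation z0 := BinNums.Z0.
Notation z1 := (BinNums.Zpos BinNums.xH).
Notation zm1 := (BinNums.Zneg BinNums.xH).
Notation zn := BinInt.Z.of_nat.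
Definition dyad := (Z * Z * nat)%type.
Definition pow2 (n : nat) : Z := iter n (BinInt.Z.mul (BinNums.Zpos (BinNums.xO BinNums.xH))) z1.
Definition dyad_add (c d : dyad) : dyad :=
  let: (a, b, n) := c in let: (a', b', n') := d in
  if (n <= n')%N then
    let p := pow2 (n' - n) in (BinInt.Z.add (BinInt.Z.mul p a) a', BinInt.Z.add (BinInt.Z.mul p b) b', n')
  else
    let p := pow2 (n - n') in (BinInt.Z.add a (BinInt.Z.mul p a'), BinInt.Z.add b (BinInt.Z.mul p b'), n).
Definition dyad_mul (c d : dyad) : dyad :=
  let: (a, b, n) := c in let: (a', b', n') := d in
  (BinInt.Z.sub (BinInt.Z.mul a a') (BinInt.Z.mul b b'), BinInt.Z.add (BinInt.Z.mul a b') (BinInt.Z.mul b a'), (n + n')%N).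
Definition dyad0 (c : dyad) : bool :=
  let: (a, b, n) := c in match a, b with z0, z0 => true | _, _ => false end.
Definition dint (a : Z) : dyad := (a, z0, 0%N).
Definition dsgn (n : nat) : dyad := dint (if odd n then zm1 else z1).

Definition bits := (bool * bool * bool * bool)%type.
Definition get (m : bits) (i : nat) : bool :=
  let: (b0, b1, b2, b3) := m in match i with 0 => b0 | 1 => b1 | 2 => b2 | _ => b3 end.
Definition upd (m : bits) (i : nat) (b : bool) : bits :=
  let: (b0, b1, b2, b3) := m in
  match i with
  | 0 => (b, b1, b2, b3) | 1 => (b0, b, b2, b3) | 2 => (b0, b1, b, b3) | _ => (b0, b1, b2, b)
  end.
Definition ltb (m : bits) (i : nat) : nat :=
  let: (b0, b1, b2, _) := m in
  match i with 0 => 0 | 1 => b0 | 2 => b0 + b1 | _ => b0 + b1 + b2 end.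
Definition gtb (m : bits) (i : nat) : nat :=
  let: (_, b1, b2, b3) := m in
  match i with 0 => b1 + b2 + b3 | 1 => b2 + b3 | 2 => b3 | _ => 0 end.
Definition nbits (m : bits) : nat := let: (b0, b1, b2, b3) := m in b0 + b1 + b2 + b3.

Definition key := (nat * bits * mon)%type.
Definition lin := seq (dyad * key).

Fixpoint ins (c : dyad) (b : key) (v : lin) : lin :=
  match v with
  | [::] => [:: (c, b)]
  | (c', b') :: v' => if b == b' then (dyad_add c c', b') :: v' else (c', b') :: ins c b v'
  end.
Definition norm (v : lin) : lin :=
  [seq p <- foldr (fun p => ins p.1 p.2) [::] v | ~~ dyad0 p.1].
Definition scal (c : dyad) (v : lin) : lin := [seq (dyad_mul c p.1, p.2) | p <- v].
Definition ext (f : key -> lin) (v : lin) : lin := norm (flatten [seq scal p.1 (f p.2) | p <- v]).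

Definition mulm (cnt : bits -> nat -> nat) (y : option nat) (b : key) : lin :=
  let: (k, J, e) := b in
  match y with
  | None => [:: (dint z1, (k.+1, J, e))]
  | Some i =>
    if get J i then [:: (dyad_mul (dsgn (cnt J i)) (zm1, z0, 1%N), (k.+1, upd J i false, e))]
    else [:: (dsgn (cnt J i), (k, upd J i true, e))]
  end.

Definition single (c : dyad) (e : mon) : lin := [:: (c, (0%N, (false, false, false, false), e))].
Definition hI : dyad := (z0, z1, 1%N).
Definition mhI : dyad := (z0, zm1, 1%N).
Definition hR : dyad := (z1, z0, 1%N).
Definition mhR : dyad := (zm1, z0, 1%N).
Definition neg (v : lin) := scal (dint zm1) v.

(** Specialized to V_C^(-1,-1), where t acts by (1 + 1) / 2 + 2 = 3. *)
Definition rhom (m : nat) (I : bits) (e : mon) : lin :=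
  let: (a1, a2, b1, b2) := e in
  if m is 1 then single (dint (BinNums.Zpos (BinNums.xI BinNums.xH))) e else
  let ex := single (dint (BinInt.Z.opp (zn a1))) (a1.-1, a2.+1, b1, b2) in
  let fx := single (dint (BinInt.Z.opp (zn a2))) (a1.+1, a2.-1, b1, b2) in
  let hx := single (dint (BinInt.Z.sub (zn a2) (zn a1))) e in
  let ey := single (dint (BinInt.Z.opp (zn b1))) (a1, a2, b1.-1, b2.+1) in
  let fy := single (dint (BinInt.Z.opp (zn b2))) (a1, a2, b1.+1, b2.-1) in
  let hy := single (dint (BinInt.Z.sub (zn b2) (zn b1))) e in
  match I with
  | (true, true, false, false) => scal hI (hx ++ hy)
  | (false, false, true, true) => scal mhI (hx ++ neg hy)
  | (true, false, true, false) => scal mhR (ex ++ neg fx ++ ey ++ neg fy)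
  | (false, true, false, true) => scal hR (ey ++ neg fy ++ neg ex ++ fx)
  | (true, false, false, true) => scal mhI (ey ++ fy ++ neg ex ++ neg fx)
  | (false, true, true, false) => scal mhI (ex ++ fx ++ ey ++ fy)
  | _ => [::]
  end.

Definition act0m (m : nat) (I : bits) (e : mon) : lin :=
  if (2 * m + nbits I < 2)%N then [:: (dint z1, (nat_of_bool (nbits I == 0%N), I, e))]
  else if (2 * m + nbits I == 2)%N then rhom m I e else [::].

(** The brackets are written out: [t^m xi_I, 1] = -2 m t^(m-1) xi_I, while [t^m xi_I, xi_i] combines
    - m t^(m-1) xi_I xi_i with the signed derivative of xi_I. Terms in C are left out, since C acts
    by zero on this module. *)
Fixpoint actm (w : seq (option nat)) (m : nat) (I : bits) (e : mon) : lin :=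
  match w with
  | [::] => act0m m I e
  | y :: w' =>
    let u := ext (mulm ltb y) (actm w' m I e) in
    norm match y with
    | None => u ++ (if m is m'.+1 then scal (dint (BinInt.Z.opp (zn (2 * m)))) (actm w' m' I e) else [::])
    | Some i =>
      scal (dsgn (nbits I)) u
      ++ (if m is m'.+1 then
            if get I i then [::]
            else scal (dyad_mul (dint (BinInt.Z.opp (zn m))) (dsgn (gtb I i))) (actm w' m' (upd I i true) e)
          else [::])
      ++ (if get I i then scal (dsgn (nbits I + ltb I i)) (actm w' m (upd I i false) e) else [::])
    end
  end.

Definition wordm (k : nat) (J : bits) : seq (option nat) :=
  nseq k None ++ [seq Some i | i <- [:: 0; 1; 2; 3]%N & get J i].
Definition actv (m : nat) (I : bits) : lin -> lin :=
  ext (fun b => let: (k, J, e) := b in actm (wordm k J) m I e).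

Definition Rm (a b : bool) (v : lin) : lin :=
  let r i := ext (mulm gtb (Some i)) v in
  match a, b with
  | false, false => r 1%N ++ scal (z0, z1, 0%N) (r 0%N)
  | true, true => r 1%N ++ scal (z0, zm1, 0%N) (r 0%N)
  | false, true => neg (r 3%N) ++ scal (z0, z1, 0%N) (r 2%N)
  | true, false => r 3%N ++ scal (z0, z1, 0%N) (r 2%N)
  end.
Definition sete (e : mon) (v : lin) : lin := [seq (p.1, (p.2.1, e)) | p <- v].
Definition ee (a b : bool) : mon :=
  ((~~ a : nat), (a : nat), (~~ b : nat), (b : nat)).
Definition nablam (v : lin) : lin :=
  norm ((Rm false false (sete (ee false false) v) ++ Rm false true (sete (ee false true) v))
    ++ (Rm true false (sete (ee true false) v) ++ Rm true true (sete (ee true true) v))).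

Definition filt (e : mon) (v : lin) : lin := [seq p <- v | p.2.2 == e].
(* If [x = nabla u] then [x_11 w_22 + x_22 w_11 = - 2 Theta u]. *)
Definition certm (x : lin) : lin :=
  let y := norm (Rm true true (filt (ee false false) x) ++ Rm false false (filt (ee true true) x)) in
  [seq (dyad_mul p.1 mhR, (p.2.1.1.-1, p.2.1.2, (0, 0, 0, 0)%N)) | p <- y].

Definition Gm (v : lin) : lin := Rm true false (Rm false true v) ++ Rm true true (Rm false false v).
Definition x0m : lin :=
  Rm false false (Gm (single (dint z1) (ee false false))) ++ Rm true false (Gm (single (dint z1) (ee true false))).

Definition bools := [:: false; true].
Definition allbits : seq bits :=
  [seq (p.1, p.2.1, p.2.2.1, p.2.2.2) | p <- allpairs pair bools (allpairs pair bools (allpairs pair bools bools))].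
Definition vectors : seq lin :=
  norm x0m :: [seq nablam [:: (dint z1, (0%N, J, (0, 0, 0, 0)%N))] | J <- allbits].

(** The bound 4 on the length of the PBW words is what later makes t^m xi_I act by zero for m at
    least 6. *)
Definition good (v : lin) : bool :=
  all (fun p => let: (k, J, (a1, a2, b1, b2)) := p.2 in
    [&& (k + nbits J <= 4)%N, (a1 + a2 == 1)%N & (b1 + b2 == 1)%N]) v.
(** The candidate preimage is untrusted: nabla is recomputed on it and compared with the vector. *)
Definition exact_at (m : nat) (I : bits) (v : lin) : bool :=
  let x := actv m I v in nilp (norm (x ++ neg (nablam (certm x)))).
Definition check : bool :=
  all (fun v => good v && all (fun m => all (fun I => exact_at m I v) allbits) (iota 0 6)) vectors.

(** * Bit vectors as sets of odd generators *)

Section Bits.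
(** Indices above 3 are read as 3, in agreement with the default branches of [get] and [upd], so the
    translation lemmas hold for every natural number. *)
Definition idx (i : nat) : 'I_4 := match i with 0 => o0 | 1 => o1 | 2 => o2 | _ => o3 end.
Definition so (m : bits) : {set 'I_4} := [set j : 'I_4 | get m j].

Lemma get_minn m i : get m (minn i 3) = get m i.
Proof. by case: m => [[[b0 b1] b2] b3]; case: i => [|[|[|[|i]]]]. Qed.
Lemma val_idx i : idx i = minn i 3 :> nat.
Proof.
by case: i => [|[|[|i]]]; rewrite /= ?inordK // (minn_idPr _).
Qed.
Lemma in_so m i : (idx i \in so m) = get m i.
Proof. by rewrite inE val_idx get_minn. Qed.

Lemma so_upd1 m i : so (upd m i true) = idx i |: so m.
Proof.
apply/setP => j; rewrite !inE -val_eqE /= val_idx.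
by case: m => [[[b0 b1] b2] b3]; case: i => [|[|[|i]]]; case: j => [[|[|[|[|j]]]] //= Hj];
  rewrite ?(minn_idPr _).
Qed.
Lemma so_upd0 m i : so (upd m i false) = so m :\ idx i.
Proof.
apply/setP => j; rewrite !inE -val_eqE /= val_idx.
by case: m => [[[b0 b1] b2] b3]; case: i => [|[|[|i]]]; case: j => [[|[|[|[|j]]]] //= Hj];
  rewrite ?(minn_idPr _).
Qed.

Lemma card_so (P : pred nat) (m : bits) :
  #|[set j in so m | P j]| = let: (b0, b1, b2, b3) := m in
    ((b0 && P 0%N) + (b1 && P 1%N) + (b2 && P 2%N) + (b3 && P 3%N))%N.
Proof.
rewrite -sum1dep_card big_mkcond /= !big_ord_recl big_ord0 /= !inE /=.
rewrite -[bump 0 0]/(1%N) -[bump 0 1]/(2%N) -[bump 0 2]/(3%N).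
by case: m => [[[[] []] []] []] /=; case: (P 0%N); case: (P 1%N); case: (P 2%N); case: (P 3%N).
Qed.

Lemma cnt_lt_so m i : cnt_lt (so m) (idx i) = ltb m i.
Proof.
rewrite /cnt_lt (card_so (fun j => (j < idx i)%N)) val_idx.
by case: m => [[[[] []] []] []]; case: i => [|[|[|i]]].
Qed.
Lemma cnt_gt_so m i : cnt_gt (so m) (idx i) = gtb m i.
Proof.
rewrite /cnt_gt (card_so (fun j => (idx i < j)%N)) val_idx.
by case: m => [[[[] []] []] []]; case: i => [|[|[|i]]].
Qed.
Lemma nbits_so m : #|so m| = nbits m.
Proof.
rewrite -(_ : [set j in so m | xpredT (val j)] = so m); last by apply/setP => j; rewrite !inE andbT.
by rewrite (card_so xpredT); case: m => [[[[] []] []] []].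
Qed.

Lemma so_surj (J : {set 'I_4}) : {m | J = so m}.
Proof.
exists (o0 \in J, o1 \in J, o2 \in J, o3 \in J); apply/setP => j; rewrite inE.
by case: (o_cases j) => ->; rewrite /= /o0 /o1 /o2 /o3 inordK.
Qed.

Lemma so_inj : injective so.
Proof.
move=> m m' /setP E; have G i : get m i = get m' i by rewrite -2!in_so E.
case: m m' E G => [[[b0 b1] b2] b3] [[[c0 c1] c2] c3] _ G.
by have /= -> := G 0%N; have /= -> := G 1%N; have /= -> := G 2%N; have /= -> := G 3%N.
Qed.

Lemma enum_so m : enum (so m) = [seq idx i | i <- [:: 0; 1; 2; 3]%N & get m i].
Proof.
apply: (inj_map val_inj); rewrite -map_comp.
have -> : [seq val j | j <- enum (so m)] = [seq i <- iota 0 4 | get m i].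
  have -> : enum (so m) = [seq j <- enum 'I_4 | get m (val j)].
    by rewrite enumT; apply: eq_filter => j; rewrite -[LHS]/(j \in so m) inE.
  by rewrite -(val_enum_ord 4) filter_map.
rewrite -[LHS]map_id; apply/eq_in_map => i; rewrite mem_filter => /andP[_].
by rewrite /= val_idx !inE; case/or4P => /eqP->.
Qed.
End Bits.

(** * Dyadic Gaussian numbers and the meaning of formal combinations *)

Section Dyadic.
Variable K : numClosedFieldType.

Definition Zr (z : Z) : K := (int_of_Z z)%:~R.
Lemma ZrD a b : Zr (BinInt.Z.add a b) = Zr a + Zr b.
Proof. by rewrite /Zr -[BinInt.Z.add a b]/(a + b) rmorphD rmorphD. Qed.
Lemma ZrM a b : Zr (BinInt.Z.mul a b) = Zr a * Zr b.
Proof. by rewrite /Zr -[BinInt.Z.mul a b]/(a * b) rmorphM rmorphM. Qed.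
Lemma ZrN a : Zr (BinInt.Z.opp a) = - Zr a.
Proof. by rewrite /Zr -[BinInt.Z.opp a]/(- a) rmorphN rmorphN. Qed.
Lemma ZrB a b : Zr (BinInt.Z.sub a b) = Zr a - Zr b.
Proof. by rewrite -ZrN -ZrD. Qed.
Lemma Zrn n : Zr (zn n) = n%:R.
Proof.
have E m : zn m = m%:R by elim: m => // m; rewrite Znat.Nat2Z.inj_succ -natr1 => <-.
by rewrite /Zr E !rmorph_nat.
Qed.
Lemma Zr_pow2 n : Zr (pow2 n) = 2 ^+ n.
Proof. elim: n => // n IH; rewrite exprS -IH; exact: ZrM. Qed.

Definition dval (c : dyad) : K := let: (a, b, n) := c in (Zr a + 'i * Zr b) / 2 ^+ n.

Lemma pow2_neq0 n : (2 : K) ^+ n != 0.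
Proof. by rewrite expf_neq0 // pnatr_eq0. Qed.

Lemma dyD c d : dval (dyad_add c d) = dval c + dval d.
Proof.
case: c d => [[a b] n] [[a' b'] n'] /=.
have P p q : (p <= q)%N -> 2 ^+ q = 2 ^+ (q - p) * 2 ^+ p :> K.
  by move=> le; rewrite -exprD subnK.
by have [/P E|/ltnW/P E] := leqP n n'; rewrite /= !ZrD !ZrM Zr_pow2 E; field; rewrite !pow2_neq0.
Qed.

Lemma dyM c d : dval (dyad_mul c d) = dval c * dval d.
Proof.
case: c d => [[a b] n] [[a' b'] n'] /=; rewrite ZrD ZrB !ZrM exprD.
rewrite mulf_div; congr (_ / _).
rewrite mulrDl !mulrDr [_ * _ * ('i * _)]mulrACA -expr2 sqrCi; ring.
Qed.

Lemma dyad0P c : dyad0 c -> dval c = 0.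
Proof.
by case: c => [[a b] n] /=; case: a => //; case: b => // _; rewrite /Zr mulr0 addr0 mul0r.
Qed.
Lemma dy_int a : dval (dint a) = Zr a.
Proof. by rewrite /= [Zr z0]/= mulr0 addr0 expr0 divr1. Qed.
Lemma dy_sgn n : dval (dsgn n) = sgn K n.
Proof. by rewrite dy_int sgn_odd; case: (odd n). Qed.
Lemma dy_half : dval hR = 2^-1 /\ dval mhR = - 2^-1.
Proof. by rewrite /= !mulr0 !addr0 expr1; split; rewrite ?mul1r ?mulN1r. Qed.
Lemma dy_halfI : dval hI = i2 K /\ dval mhI = - i2 K.
Proof. by rewrite /= !add0r expr1 mulr1 /i2 mulrN1 mulNr. Qed.

Section Interp.
Variables (V : lmodType K) (base : key -> V).
Definition interp (v : lin) : V := \sum_(p <- v) dval p.1 *: base p.2.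
Lemma itp0 : interp [::] = 0. Proof. exact: big_nil. Qed.
Lemma itp_cons p v : interp (p :: v) = dval p.1 *: base p.2 + interp v.
Proof. exact: big_cons. Qed.
Lemma itp_cat u v : interp (u ++ v) = interp u + interp v.
Proof. exact: big_cat. Qed.
Lemma itp_scal c v : interp (scal c v) = dval c *: interp v.
Proof.
rewrite /interp big_map scaler_sumr; apply: eq_bigr => p _.
by rewrite dyM scalerA.
Qed.
Lemma itp_neg v : interp (neg v) = - interp v.
Proof. by rewrite itp_scal dy_int [Zr zm1]/= scaleN1r. Qed.
Lemma itp_ins c b v : interp (ins c b v) = dval c *: base b + interp v.
Proof.
elim: v => [|[c' b'] v IH] /=; first by rewrite itp_cons.
case: eqP => [->|_]; rewrite !itp_cons /=; first by rewrite dyD scalerDl addrA.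
by rewrite IH addrCA.
Qed.
Lemma itp_norm v : interp (norm v) = interp v.
Proof.
have -> : interp v = interp (foldr (fun p => ins p.1 p.2) [::] v).
  by elim: v => [|[c b] v IH] //=; rewrite itp_ins itp_cons IH.
rewrite /norm; elim: (foldr _ _ _) => [|[c b] u IH] //=.
case: (boolP (dyad0 c)) => [c0|_] /=; rewrite !itp_cons IH //=.
by rewrite (dyad0P c0) scale0r add0r.
Qed.
End Interp.

(** Soundness of linear extension: an operator agrees with its computable version as soon as it does
    so on the keys that occur, which allows side conditions such as [good]. *)
Lemma itp_ext (V W : lmodType K) (base : key -> V) (base' : key -> W) (f : {linear V -> W}) F v :
  (forall p, p \in v -> f (base p.2) = interp base' (F p.2)) ->
  f (interp base v) = interp base' (ext F v).
Proof.
move=> H; rewrite itp_norm; elim: v H => [|p v IH] H /=; first by rewrite !itp0 linear0.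
rewrite itp_cons linearP IH => [|q qv]; last by apply: H; rewrite inE qv orbT.
by rewrite itp_cat itp_scal -H // inE eqxx.
Qed.
End Dyadic.

(** * Brackets with the generators of g_<0 *)

Section BracketSums.
Variables (K : numClosedFieldType) (V : lmodType K) (F : gb -> V).
Hypothesis F_GC : F GC = 0.
Implicit Types (I : {set 'I_4}) (i : 'I_4).
Notation sgn := (@sgn K).

Lemma mulsgn1 I i : mulsgn I [set i] = cnt_gt I i.
Proof.
rewrite /mulsgn /cnt_gt -sum1dep_card [RHS]big_mkcondr; apply: eq_bigr => a _.
case: ltnP => ia.
  rewrite (_ : [set _ in _ | _] = [set i]) ?cards1 //; apply/setP => j; rewrite !inE.
  by case: eqP => // ->.
apply/eqP; rewrite cards_eq0; apply/eqP/setP => j; rewrite !inE.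
by case: eqP => // ->; rewrite ltnNge ia.
Qed.

Lemma mulsgn0 I : mulsgn I set0 = 0%N.
Proof.
by rewrite /mulsgn big1 // => a _; apply/eqP; rewrite cards_eq0; apply/eqP/setP => j; rewrite !inE.
Qed.

(** [F] stands for the action of the basis of g on a fixed vector. Because [F GC] is zero, the
    cocycle disappears and only the bracket of K(1,4)_+ remains. *)
Lemma sum_gbr_Th m I :
  \sum_(cb <- gbr K (GT m I) (n2g NTh)) cb.1 *: F cb.2 =
  if m is m'.+1 then (- (2 * m)%:R) *: F (GT m' I) else 0.
Proof.
rewrite /= -setI_eq0 setI0 eqxx addn0 /=.
rewrite (eq_filter (a2 := pred0)) => [|k]; last by rewrite !inE andbF.
rewrite filter_pred0 /=; case: m => [|m] /=.
  by rewrite big_seq1 F_GC scaler0.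
rewrite big_cons big_seq1 F_GC scaler0 addr0 setU0 cards0 mulsgn0 mulr0 subr0 sub0r mulr1.
by rewrite natrM mulrC.
Qed.

Lemma sum_gbr_Eta m I i :
  \sum_(cb <- gbr K (GT m I) (n2g (NEta i))) cb.1 *: F cb.2 =
  (if m is m'.+1 then
     if i \in I then 0 else (- m%:R * sgn (cnt_gt I i)) *: F (GT m' (i |: I))
   else 0)
  + (if i \in I then sgn (#|I| + cnt_lt I i) *: F (GT m (I :\ i)) else 0).
Proof.
rewrite /= disjoint_sym disjoints1 addn0 !big_cat /= big_seq1 F_GC scaler0 addr0; congr (_ + _).
  case: m => [|m]; rewrite ?andbF ?big_nil // andbT; case: (i \in I) => /=; first by rewrite big_nil.
  by rewrite big_seq1 cards1 mulsgn1 setUC; congr (_ *: _) => /=; ring.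
rewrite big_map big_filter (eq_bigl (fun k => (k == i) && (i \in I))) => [|k]; last first.
  rewrite !inE; case: eqP => [->|_]; rewrite ?andbF //= andbC.
  by case: (i \in I); rewrite ?andbF //= -setI_eq0 setDv setI0 eqxx.
case: ifP => iI; last by rewrite big_pred0 // => k; rewrite andbF.
rewrite (eq_bigl (pred1 i)) => [|k]; last by rewrite /= andbT.
rewrite -big_filter filter_pred1_uniq ?enum_uniq ?mem_enum // big_seq1 /=.
have -> : cnt_lt [set i] i = 0%N.
  apply/eqP; rewrite cards_eq0; apply/eqP/setP => j; rewrite !inE.
  by case: eqP => // ->; rewrite ltnn.
by rewrite setDv setU0 mulsgn0 sgnD /Defs.sgn expr0 !mulr1.
Qed.
End BracketSums.

(** * Agreement of the computable action with the module action *)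

Section Model.
Variable K : numClosedFieldType.
Notation vec := (vec K).
Notation bv := (@bv K).
Notation sgn := (@sgn K).
Notation dy := (@dval K).
#[local] Arguments dyad_mul : simpl never.
#[local] Arguments dval : simpl never.
#[local] Arguments rhom : simpl never.

Definition base (b : key) : vec := bv (b.1.1, so b.1.2, b.2).
Notation itp := (interp base).
Definition nbd (y : option nat) : nb := if y is Some i then NEta (idx i) else NTh.

Lemma itp1 c b : itp [:: (c, b)] = dy c *: base b.
Proof. exact: etrans (itp_cons _ _ _) (etrans (congr1 _ (itp0 _)) (addr0 _)). Qed.

Lemma dy1 : dy (dint z1) = 1. Proof. exact: dy_int. Qed.

Lemma lmul_base y b : lmul (nbd y) (base b) = itp (mulm ltb y b).
Proof.
case: b => -[k J] e; apply: (etrans (lext_bv _ _)); case: y => [i|] /=; last first.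
  by rewrite itp1 dy1 scale1r.
rewrite in_so cnt_lt_so; case: (get J i) => /=; rewrite itp1 /base /= ?so_upd0 ?so_upd1.
  by rewrite dyM dy_sgn (dy_half K).2.
by rewrite dy_sgn.
Qed.
Lemma rmul_base y b : rmul (nbd y) (base b) = itp (mulm gtb y b).
Proof.
case: b => -[k J] e; apply: (etrans (lext_bv _ _)); case: y => [i|] /=; last first.
  by rewrite itp1 dy1 scale1r.
rewrite in_so cnt_gt_so; case: (get J i) => /=; rewrite itp1 /base /= ?so_upd0 ?so_upd1.
  by rewrite dyM dy_sgn (dy_half K).2.
by rewrite dy_sgn.
Qed.

Lemma lmul_itp y v : lmul (nbd y) (itp v) = itp (ext (mulm ltb y) v).
Proof. by apply: (itp_ext (f := lmul (nbd y))) => p _; apply: lmul_base. Qed.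
Lemma rmul_itp y v : rmul (nbd y) (itp v) = itp (ext (mulm gtb y) v).
Proof. by apply: (itp_ext (f := rmul (nbd y))) => p _; apply: rmul_base. Qed.

Lemma so0 : so (false, false, false, false) = set0.
Proof. by apply/setP => -[[|[|[|[|j]]]] Hj]; rewrite !inE. Qed.

Lemma itp_single c e : itp (single c e) = mvec (dy c) e.
Proof. by rewrite itp1 /base /= so0. Qed.

Lemma word_base k J : word k (so J) = [seq nbd y | y <- wordm k J].
Proof.
rewrite /word /wordm enum_so map_cat map_nseq -2!map_comp; reflexivity.
Qed.

Lemma so_pairs : [/\ [set o0; o1] = so (true, true, false, false),
  [set o2; o3] = so (false, false, true, true), [set o0; o2] = so (true, false, true, false),
  [set o1; o3] = so (false, true, false, true) & [set o0; o3] = so (true, false, false, true)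
  /\ [set o1; o2] = so (false, true, true, false)].
Proof.
have E i j : [set idx i; idx j] = so (upd (upd (false, false, false, false) j true) i true).
  by rewrite !so_upd1 so0 setU0.
by split; [exact: (E 0 1)%N | exact: (E 2 3)%N | exact: (E 0 2)%N | exact: (E 1 3)%N |
  split; [exact: (E 0 3)%N | exact: (E 1 2)%N]].
Qed.

Definition deg11 (e : mon) : bool := let: (a1, a2, b1, b2) := e in (a1 + a2 == 1)%N && (b1 + b2 == 1)%N.

Lemma dy_opp_nat n : dy (dint (BinInt.Z.opp (zn n))) = - n%:R.
Proof. by rewrite dy_int ZrN Zrn. Qed.

Lemma rho0_itp I e : nbits I = 2 -> rho K VC (GT 0 (so I)) e = itp (rhom 0 I e).
Proof.
move: e => [[[a1 a2] b1] b2] nI.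
pose e := (a1, a2, b1, b2).
have Eex : ex_op K true e = itp (single (dint (BinInt.Z.opp (zn a1))) (a1.-1, a2.+1, b1, b2)).
  by rewrite itp_single dy_opp_nat.
have Efx : fx_op K true e = itp (single (dint (BinInt.Z.opp (zn a2))) (a1.+1, a2.-1, b1, b2)).
  by rewrite itp_single dy_opp_nat.
have Ehx : hx_op K true e = itp (single (dint (BinInt.Z.sub (zn a2) (zn a1))) e).
  by rewrite itp_single dy_int ZrB !Zrn.
have Eey : ey_op K true e = itp (single (dint (BinInt.Z.opp (zn b1))) (a1, a2, b1.-1, b2.+1)).
  by rewrite itp_single dy_opp_nat.
have Efy : fy_op K true e = itp (single (dint (BinInt.Z.opp (zn b2))) (a1, a2, b1.+1, b2.-1)).
  by rewrite itp_single dy_opp_nat.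
have Ehy : hy_op K true e = itp (single (dint (BinInt.Z.sub (zn b2) (zn b1))) e).
  by rewrite itp_single dy_int ZrB !Zrn.
have [S1 S2 S3 S4 [S5 S6]] := so_pairs.
rewrite /rho [sx _]/= [sy _]/= -/o0 -/o1 -/o2 -/o3 S1 S2 S3 S4 S5 S6 !(inj_eq so_inj) -/e Eex Efx Ehx Eey Efy Ehy.
have [[h mh] [hi mhi]] := (dy_half K, dy_halfI K).
case: I nI => [[[[] []] []] []] //= _; rewrite /rhom itp_scal ?hi ?mhi ?h ?mh !itp_cat ?itp_neg ?addrA;
  reflexivity.
Qed.

Lemma rho1_itp I e : deg11 e -> rho K VC (GT 1 (so I)) e = itp (rhom 1 I e).
Proof.
case: e => [[[a1 a2] b1] b2] /andP[/eqP Ea /eqP Eb].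
rewrite /rhom itp_single /rho; apply: (congr1 (fun c => mvec c _)); rewrite /= Ea Eb /h2.
transitivity (3 : K); last by rewrite dy_int.
by field.
Qed.

Lemma act0_itp m I e : deg11 e -> act0 K VC (GT m (so I)) e = itp (act0m m I e).
Proof.
move=> De; rewrite /act0 /act0m nbits_so.
case: ifP => [_|]; first by rewrite itp1 dy1 scale1r /base /= -cards_eq0 nbits_so.
case: ifP => [|_ _]; last by rewrite itp0.
move=> /eqP E _; case: m E => [|[|m]] E.
- exact: rho0_itp.
- exact: rho1_itp.
- by exfalso; move: E; rewrite mul2n.
Qed.

(** In bidegree (1,1) the scalar (E_x - E_y) / 2 by which C acts is zero, and C is central. *)
Lemma actw_GC w e : deg11 e -> actw K VC w GC e = 0.
Proof.
move=> De; elim: w => [|y w IH].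
  move: De; case: e => [[[a1 a2] b1] b2] /andP[/eqP Ea /eqP Eb].
  by rewrite /= Ea Eb subrr mul0r addr0; exact: scale0r.
apply: etrans (f_equal2 _ (congr1 (fun v => _ *: lmul y v) IH) (big_nil _ _ _ _)) _.
by rewrite addr0 (_ : lmul y 0 = 0) ?scaler0 //; exact: linear0.
Qed.

Lemma actw_itp w m I e : deg11 e ->
  actw K VC [seq nbd y | y <- w] (GT m (so I)) e = itp (actm w m I e).
Proof.
move=> De; elim: w m I => [|y w IH] m I; first exact: act0_itp.
set w' := [seq nbd y | y <- w] in IH.
have GC0 := actw_GC w' De.
have E1 := congr1 (lmul (nbd y)) (IH m I).
have {}E1 := etrans E1 (lmul_itp y (actm w m I e)).
apply: etrans (f_equal2 _ (congr1 ( *:%R _) E1) (erefl _)) _.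
apply: esym; apply: etrans (itp_norm _ _) _.
case: y E1 => [i|] _.
  apply: etrans (itp_cat _ _ _) _; apply: f_equal2.
    by apply: etrans (itp_scal _ _ _) _; rewrite dy_sgn /= nbits_so andbT sgn_odd.
  apply: etrans (itp_cat _ _ _) _.
  apply: esym; apply: etrans (sum_gbr_Eta (F := fun c => actw K VC w' c e) GC0 _ _ _) _.
  apply: f_equal2.
    case: m => [|m]; first exact: esym (itp0 _).
    rewrite in_so; case: (get I i); first exact: esym (itp0 _).
    apply: esym; apply: etrans (itp_scal _ _ _) _.
    rewrite dyM dy_opp_nat dy_sgn cnt_gt_so -so_upd1; exact: congr1 (esym (IH _ _)).
  rewrite in_so; case: (get I i); last exact: esym (itp0 _).
  apply: esym; apply: etrans (itp_scal _ _ _) _.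
  rewrite dy_sgn nbits_so cnt_lt_so -so_upd0; exact: congr1 (esym (IH _ _)).
apply: etrans (itp_cat _ _ _) _; apply: f_equal2.
  by rewrite andbF; exact: esym (scale1r _).
apply: esym; apply: etrans (sum_gbr_Th (F := fun c => actw K VC w' c e) GC0 _ _) _.
case: m => [|m]; first exact: esym (itp0 _).
apply: esym; apply: etrans (itp_scal _ _ _) _.
rewrite dy_opp_nat; exact: congr1 (esym (IH _ _)).
Qed.

End Model.

Section Sound.
Variable K : numClosedFieldType.
Notation vec := (vec K).
Notation bv := (@bv K).
Notation dy := (@dval K).
Notation RL := (@RL K).
Notation base := (@base K).
Notation itp := (interp base).
Notation e0 := (0, 0, 0, 0)%N.
Implicit Types (x : vec) (v : lin).

Definition actL a : {linear vec -> vec} := lext (actb K VC a).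

Lemma goodP v p : good v -> p \in v -> deg11 p.2.2 /\ (p.2.1.1 + nbits p.2.1.2 <= 4)%N.
Proof.
move=> /allP/(_ p) H /H; case: p {H} => c [[k J] [[[a1 a2] b1] b2]] /and3P[sz Ea Eb].
by split; rewrite /deg11 /= ?Ea.
Qed.

Lemma actL_base a k J e : actL a (base (k, J, e)) = actw K VC (word k (so J)) a e.
Proof. exact: lext_bv. Qed.

Lemma act_itp m I v : good v -> actL (GT m (so I)) (itp v) = itp (actv m I v).
Proof.
move=> gv; apply: itp_ext => p /(goodP gv)[De _]; case: p De => c [[k J] e] /= De.
apply: etrans (actL_base _ _ _ _) _; rewrite word_base; exact: actw_itp.
Qed.

Lemma lin_itp0 (f : {linear vec -> vec}) v : (forall p, p \in v -> f (base p.2) = 0) -> f (itp v) = 0.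
Proof.
elim: v => [|p v IH] H; first by rewrite itp0 linear0.
rewrite itp_cons linearP IH => [|q qv]; last by apply: H; rewrite inE qv orbT.
by rewrite H ?inE ?eqxx // scaler0 addr0.
Qed.

Lemma act_GC v : good v -> actL GC (itp v) = 0.
Proof.
move=> gv; apply: lin_itp0 => p /(goodP gv)[De _]; case: p De => c [[k J] e] /= De.
apply: etrans (actL_base _ _ _ _) _; exact: actw_GC.
Qed.

(** Each letter of the word lowers m by at most 1, and t^m xi_I with m at least 2 has positive
    degree, so it kills V_C. *)
Lemma actw_large w m I e : deg11 e -> (size w + 1 < m)%N -> actw K VC w (GT m I) e = 0.
Proof.
move=> De; elim: w m I => [|y w IH] m I /= wm.
  have H : (2 < 2 * m + #|I|)%N.
    by apply: leq_trans (leq_addr _ _); apply: (@leq_trans (2 * 2)%N); rewrite ?leq_mul2l.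
  by rewrite ltnNge (ltnW H) /= gtn_eqF.
have GC0 := actw_GC K w De.
have Z m' I' : (m <= m'.+1)%N -> actw K VC w (GT m' I') e = 0.
  by move=> mm; apply: IH; rewrite -ltnS (leq_trans _ mm) // -addSn.
have L0 : lmul y (0 : vec) = 0 by exact: linear0.
rewrite Z ?leqnSn // L0 scaler0 add0r.
case: y {L0} => [|i].
  apply: etrans (sum_gbr_Th (F := fun c => actw K VC w c e) GC0 _ _) _.
  by case: m wm Z {IH} => // m _ Z; rewrite Z // scaler0.
apply: etrans (sum_gbr_Eta (F := fun c => actw K VC w c e) GC0 _ _ _) _.
rewrite (Z m) ?leqnSn // scaler0 (fun_if (fun u => _ + u)) addr0 if_same.
by case: m wm Z {IH} => // m _ Z; rewrite Z // scaler0 if_same.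
Qed.

Lemma act_large m I v : good v -> (5 < m)%N -> actL (GT m I) (itp v) = 0.
Proof.
move=> gv m5; apply: lin_itp0 => p /(goodP gv)[De sz]; case: p De sz => c [[k J] e] /= De sz.
apply: etrans (actL_base _ _ _ _) _; apply: actw_large => //.
rewrite /word size_cat size_nseq size_map -cardE nbits_so addn1.
by apply: leq_ltn_trans m5.
Qed.

Lemma RL_itp a b v : RL a b (itp v) = itp (Rm a b v).
Proof.
have dI : dy (z0, z1, 0%N) = 'i by rewrite /= expr0 divr1 add0r mulr1.
have dN : dy (z0, zm1, 0%N) = - 'i by rewrite /= expr0 divr1 add0r mulrN1.
have R0 := rmul_itp K (Some 0%N) v; have R1 := rmul_itp K (Some 1%N) v.
have R2 := rmul_itp K (Some 2%N) v; have R3 := rmul_itp K (Some 3%N) v.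
apply: etrans (RL_eta _ _ _) _; rewrite /Rm; case: a; case: b; apply: esym;
  apply: etrans (itp_cat _ _ _) _; rewrite itp_scal ?dI ?dN ?scaleNr ?itp_neg -?R0 -?R1 -?R2 -?R3; reflexivity.
Qed.

Lemma lin_itp_sete (f : {linear vec -> vec}) e v :
  (forall p, p \in v -> f (base p.2) = base (p.2.1, e)) -> f (itp v) = itp (sete e v).
Proof.
elim: v => [|p v IH] H; first by rewrite !itp0 linear0.
rewrite itp_cons linearP IH => [|q qv]; last by apply: H; rewrite inE qv orbT.
by rewrite H ?inE ?eqxx // itp_cons.
Qed.

Definition keys0 v := all (fun p => p.2.2 == e0) v.

Lemma nabla_itp v : keys0 v -> nabla VC (itp v) = itp (nablam v).
Proof.
move=> /allP v0; apply: etrans (nabla_sumR _ _) _; apply: esym; apply: etrans (itp_norm _ _) _.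
have E a b : px K true a (py K true b (itp v)) = itp (sete (ee a b) v).
  apply: (lin_itp_sete (f := px K true a \o py K true b)) => p /v0 /eqP.
  case: p => d [[k J] e] /= ->.
  have B c s c' s' : c' e0 = 1 -> c (s' e0) = 1 ->
      @opEL K c s (@opEL K c' s' (base (k, J, e0))) = base (k, J, s (s' e0)).
    move=> E1 E2; apply: etrans (opEL2_bv c s c' s' k (so J) e0) _.
    by rewrite E1 E2 mul1r; exact: scale1r.
  by case: a; case: b; apply: B.
rewrite itp_cat 2!itp_cat -4!RL_itp -4!E; reflexivity.
Qed.

Lemma keys0_degm v : keys0 v -> degm 0 0 (itp v).
Proof.
move=> /allP v0; rewrite /interp big_seq; apply: degm_sum => p /v0 /eqP pe.
by apply: (subZ _ (degm_sub K 0 0)); case: p pe => c [[k J] e] /= ->; apply: degm_bv.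
Qed.

Lemma keys0_cert v : keys0 (certm v).
Proof. by apply/allP => q /mapP[p _ ->]. Qed.

Lemma exact_at_imC m I v : good v -> exact_at m I v -> imC (actL (GT m (so I)) (itp v)).
Proof.
move=> gv; rewrite /exact_at; set x := actv m I v => /nilP E.
exists (itp (certm x)); first exact: keys0_degm (keys0_cert x).
rewrite (nabla_itp (keys0_cert x)) (act_itp m I gv).
have := itp_norm base (x ++ neg (nablam (certm x))); rewrite E itp0 itp_cat itp_neg.
by move/esym/eqP; rewrite subr_eq0 => /eqP.
Qed.

Lemma mem_allbits I : I \in allbits.
Proof. by case: I => [[[[] []] []] []]. Qed.

(** Evaluates 17 vectors against 6 exponents of t and 16 Grassmann monomials. *)
Lemma checkT : check.
Proof. by vm_compute. Qed.

Lemma act_vectors a v : v \in vectors -> imC (actL a (itp v)).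
Proof.
move=> vv; have /andP[gv /allP H] := allP checkT v vv.
have Z x : x = 0 -> imC x by move=> ->; exact: (imC_sub K).1.
case: a => [|m J]; first by apply: Z; exact: act_GC.
have [m5|m5] := ltnP 5 m; first by apply: Z; exact: act_large.
have [I ->] := so_surj J; apply: exact_at_imC => //.
apply: (allP (H m _)); [by rewrite mem_iota | exact: mem_allbits].
Qed.
End Sound.

Section ExtraShape.
Variables (K : numClosedFieldType) (V : lmodType K).
Variables (R : bool -> bool -> {linear V -> V}) (px : bool -> bool -> {linear V -> V}).
Variable yput : bool -> nat -> nat -> {linear V -> V}.
Hypothesis px_R : forall s j a b x, px s j (R a b x) = R a b (px s j x).
Hypothesis yput_R : forall a b x, yput true 1 0 (R a b x) = R a b (yput true 1 0 x).

(** Insertion in y and d_x commute with the w_ab, so all polynomial factors can be produced first;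
    this is the order in which [x0m] is computed. *)
Lemma extra_shape z : let g x := R true false (R false true x) + R true true (R false false x) in
  extra R px yput z =
  R false false (g (yput true 1 0 (px true false z))) + R true false (g (yput true 1 0 (px true true z))).
Proof.
have E a : yput true 1 0 (R a false (px true a (G R z))) = R a false
  (R true false (R false true (yput true 1 0 (px true a z))) + R true true (R false false (yput true 1 0 (px true a z)))).
  by rewrite /G (opD (px _ _)) !px_R yput_R (opD (yput _ _ _)) !yput_R.
by rewrite /extra /D (opD (yput _ _ _)) !E.
Qed.
End ExtraShape.

(** * Triviality of the action on the extra class, and the theorem *)

Section Main.
Variable K : numClosedFieldType.
Notation vec := (vec K).
Notation bv := (@bv K).
Let cl := @coef_lin K.
Let cs := @coef_sep K.
Notation RL := (@RL K).
Notation base := (@base K).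
Notation itp := (interp base).
Notation e0 := (0, 0, 0, 0)%N.
Notation vac := (bv (0%N, set0, e0)).
Notation actL := (actL K).
Implicit Types (x : vec).

Lemma itp_x0 : itp (norm x0m) = extraL vac.
Proof.
apply: etrans (itp_norm _ _) _.
have E := @extra_shape K vec RL (px K) (yput K) _ _ vac.
apply: esym; apply: etrans (E _ _) _.
- by move=> s j a b x; case: s; apply: esym (RL_opE _ _ _ _ _).
- by move=> a b x; apply: esym (RL_opE _ _ _ _ _).
have B a : yput K true 1 0 (px K true a vac) = itp (single (dint z1) (ee a false)).
  rewrite itp_single dy1; apply: esym; apply: etrans (scale1r _) _.
  case: a; apply: esym; apply: etrans (opEL2_bv _ _ _ _ _ _ _) _;
  by rewrite mul1r /fct invr1; exact: scale1r.
have G v : itp (Gm v) = RL true false (RL false true (itp v)) + RL true true (RL false false (itp v)).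
  have R2 a b c d : itp (Rm a b (Rm c d v)) = RL a b (RL c d (itp v)).
    exact: etrans (esym (RL_itp K a b _)) (congr1 (RL a b) (esym (RL_itp K c d v))).
  by apply: etrans (itp_cat _ _ _) _; apply: f_equal2 (R2 _ _ _ _) (R2 _ _ _ _).
apply: esym; apply: etrans (itp_cat _ _ _) _.
apply: etrans (f_equal2 _ (esym (RL_itp K false false _)) (esym (RL_itp K true false _))) _.
have G' a := etrans (G (single (dint z1) (ee a false))) (congr1 (fun v =>
   RL true false (RL false true v) + RL true true (RL false false v)) (esym (B a))).
exact: f_equal2 (congr1 _ (G' false)) (congr1 _ (G' true)).
Qed.

Lemma itp_nabla1 J : itp (nablam [:: (dint z1, (0%N, J, e0))]) = nabla VC (bv (0%N, so J, e0)).
Proof.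
apply: etrans (esym (nabla_itp K _)) _; first by [].
by apply: (congr1 (nabla VC)); rewrite itp1 dy1; exact: scale1r.
Qed.

Lemma act_x0 a : imC (actL a (extraL vac)).
Proof.
apply: (eq_ind _ (fun v => imC (actL a v)) (act_vectors K a _) _ itp_x0); exact: mem_head.
Qed.

Lemma act_nabla1 a J : imC (actL a (nabla VC (bv (0%N, J, e0)))).
Proof.
have [I ->] := so_surj J.
apply: (eq_ind _ (fun v => imC (actL a v)) (act_vectors K a _) _ (itp_nabla1 I)).
rewrite inE; apply/orP; right.
exact: (map_f (fun J => nablam [:: (dint z1, (0%N, J, e0))]) (mem_allbits I)).
Qed.

Lemma nabla_th x : nabla VC (thL K x) = thL K (nabla VC x).
Proof.
apply: etrans (nabla_sumR _ _) _; apply: esym; apply: etrans (congr1 _ (nabla_sumR _ _)) _.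
have E a b : thL K (RL a b (px K true a (py K true b x))) = RL a b (px K true a (py K true b (thL K x))).
  apply: etrans (esym (RL_th _ _ _)) _; apply: (congr1 (RL a b)).
  by apply: etrans (thL_opE _ _ _) _; apply: (congr1 (px K true a)); exact: thL_opE.
have D u v : thL K (u + v) = thL K u + thL K v by exact: linearD.
apply: etrans (D _ _) _; apply: etrans (f_equal2 _ (D _ _) (D _ _)) _.
exact: f_equal2 (f_equal2 _ (E _ _) (E _ _)) (f_equal2 _ (E _ _) (E _ _)).
Qed.

(** Theta is even and stands first in PBW words, so this is one step of the recursion defining the
    action. *)
Lemma act_th a x : actL a (thL K x) =
  thL K (actL a x) + \sum_(cb <- gbr K a (n2g NTh)) cb.1 *: actL cb.2 x.
Proof.
have L y : lmul NTh y = thL K y.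
  apply: (@lin_ext _ (lmul NTh) (thL K)) => -[[k J] e].
  by apply: etrans (lext_bv _ _) _; apply: esym; apply: etrans (opU_bv _ _ _) _; exact: scale1r.
pose f : {linear vec -> vec} := thL K \o actL a.
pose g (cb : K * gb) : {linear vec -> vec} := cb.1 \*: actL cb.2.
have E s : exists h : {linear vec -> vec}, forall y, h y = \sum_(cb <- s) cb.1 *: actL cb.2 y.
  elim: s => [|c s [h Eh]]; first by exists \0 => y; rewrite big_nil.
  by exists (g c \+ h) => y; rewrite big_cons -Eh.
have [h Eh] := E (gbr K a (n2g NTh)); rewrite -Eh.
apply: (@lin_ext _ (actL a \o thL K) (f \+ h)) => -[[k J] e].
apply: etrans (congr1 (actL a) (etrans (opU_bv _ _ _) (scale1r _))) _.
have S : actb K VC a (k.+1, J, e) = sgn K (gpar a && false) *: lmul NTh (actw K VC (word k J) a e)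
  + \sum_(cb <- gbr K a (n2g NTh)) cb.1 *: actw K VC (word k J) cb.2 e by reflexivity.
apply: etrans (lext_bv _ _) _; apply: etrans S _.
apply: etrans _ (congr1 (fun v => _ + v) (esym (Eh _))).
have A b : actL b (bv (k, J, e)) = actw K VC (word k J) b e by exact: lext_bv.
apply: f_equal2; last by apply: eq_bigr => cb _; rewrite -A.
rewrite andbF; apply: etrans (scale1r _) _; apply: etrans (L _) _.
exact: congr1 (esym (A a)).
Qed.

Lemma imC_th x : imC x -> imC (thL K x).
Proof. by case=> u Mu ->; exists (thL K u); [exact: degm_thL | rewrite nabla_th]. Qed.

Lemma imC_sum (s : seq (K * gb)) x : (forall b, imC (actL b x)) ->
  imC (\sum_(cb <- s) cb.1 *: actL cb.2 x).
Proof.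
move=> H; elim/big_ind: _ => [|u v|cb _]; [exact: (imC_sub K).1 | exact: (subD (imC_sub K)) |].
exact: (subZ _ (imC_sub K)).
Qed.

(** Induction on the power of Theta, for all elements of g at once because commuting with Theta
    replaces [a] by its bracket with Theta. *)
Lemma act_nabla u : degm 0 0 u -> forall a, imC (actL a (nabla VC u)).
Proof.
apply: (degm_ind (Q := fun u => forall a, imC (actL a (nabla VC u)))).
  split=> [a|k x y Hx Hy a].
    rewrite (_ : actL a (nabla VC 0) = 0); first exact: (imC_sub K).1.
    by apply: etrans (congr1 (actL a) (etrans (nablaLE _ _) (linear0 (nablaL K VC)))) (linear0 (actL a)).
  rewrite (_ : actL a (nabla VC (k *: x + y)) = k *: actL a (nabla VC x) + actL a (nabla VC y)).
    exact: ((imC_sub K).2 k _ _ (Hx a) (Hy a)).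
  apply: etrans (congr1 (actL a) (etrans (nablaLE _ _) (linearP (nablaL K VC) k x y))) _.
  apply: etrans (linearP (actL a) k _ _) _.
  exact: esym (f_equal2 (fun p q => k *: actL a p + actL a q) (nablaLE _ _) (nablaLE _ _)).
move=> k J; elim: k => [|k IH] a; first exact: act_nabla1.
have E : nabla VC (bv (k.+1, J, e0)) = thL K (nabla VC (bv (k, J, e0))).
  apply: etrans _ (nabla_th _); apply: (congr1 (nabla VC)); apply: esym.
  by apply: etrans (opU_bv _ _ _) _; exact: scale1r.
rewrite E act_th; apply: (subD (imC_sub K)); first exact: imC_th.
exact: imC_sum.
Qed.

Lemma homology_C11 : homology_trivial1 K (VC, 1, 1)%N.
Proof.
have Mv : degm 0 0 vac by exact: degm_bv.
have Span x : Ker (VC, 1, 1)%N x -> exists c, imC (x - c *: extraL vac).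
  by case=> Mx Nx; apply: ker_C11_span.
split; last first.
  move=> a x /Span[c [u Mu E]]; apply/Img_C11.
  have -> : act VC a x = actL a (nabla VC u) + c *: actL a (extraL vac).
    have Ex : x = nabla VC u + c *: extraL vac.
      by apply: etrans (esym (subrK (c *: extraL vac) x)) (congr1 (fun v => v + _) E).
    apply: etrans (congr1 (actL a) Ex) _; apply: etrans (opD (actL a) _ _) _.
    apply: (f_equal2 +%R) _ _; first reflexivity.
    exact: (opZ (actL a) c (extraL vac)).
  by apply: (subD (imC_sub K)); [exact: act_nabla | apply: (subZ _ (imC_sub K)); exact: act_x0].
exists (extraL vac); split.
- split; first exact: (M_extra (bigraded_vec K) Mv).
  exact: etrans (nabla_nab VC _) (nab_extra cl cs (bigraded_vec K) Mv).
- by move/Img_C11; exact: extra_vac_notin.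
- by move=> x /Span[c H]; exists c; apply/Img_C11.
Qed.

End Main.

Theorem theorem6p1 (K : numClosedFieldType) :
  forall v : vtx,
    if (v == (VA, 0, 0)%N) || (v == (VC, 1, 1)%N)
    then homology_trivial1 K v
    else homology_zero K v.
Proof.
have sw := @homology_zero_swap K; case=> -[[] m] n.
(* Vertices of x-degree at most 1 and larger y-degree are mirror images of vertices with the degrees
   exchanged. *)
- case: m n => [|[|m]] [|[|n]] /=.
  + exact: homology_A00.
  + exact: sw (VA, 1, 0)%N (@hz_A10 K).
  + exact: sw (VA, n.+2, 0)%N (@hz_A K n.+2 0 isT).
  + exact: hz_A10.
  + exact: hz_A11.
  + exact: sw (VA, n.+2, 1)%N (@hz_A K n.+2 1 isT).
  + exact: hz_A.
  + exact: hz_A.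
  + exact: hz_A.
- case: m => [|m]; last exact: hz_B.
  case: n => [|n]; [exact: hz_B00 | exact: sw (VD, n.+1, 0)%N (@hz_D0 K n.+1 isT)].
- case: m n => [|[|m]] [|[|n]] /=.
  + exact: hz_C00.
  + exact: sw (VC, 1, 0)%N (@hz_C10 K).
  + exact: sw (VC, n.+2, 0)%N (@hz_C K n.+2 0 isT).
  + exact: hz_C10.
  + exact: homology_C11.
  + exact: sw (VC, n.+2, 1)%N (@hz_C K n.+2 1 isT).
  + exact: hz_C.
  + exact: hz_C.
  + exact: hz_C.
(* D is the mirror image of B, so a positive y-degree here corresponds to a positive x-degree
   there. *)
- case: n => [|n]; last exact: sw (VB, n.+1, m) (@hz_B K n.+1 m isT).
  case: m => [|m]; [exact: sw (VB, 0, 0)%N (@hz_B00 K) | exact: hz_D0].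
Qed.
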